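(* Let $\mathcal{G}_6$ be the set of germs $(M,p)\in\mathcal{G}$ such that $p\in LD$, the $LD$ and the $LPL$ are regular at $p$, and $m(LD,LPL:p)>2$. For generic $(M,p)\in\mathcal{G}_6$ the following hold. (1) $m(LD,LPL:p)=4$ and $m(LD,MCNC:p)=2$. There are two possible configurations of the three curves near $p$: away from $p$, either the $MCNC$ and the $LPL$ lie on opposite sides of the $LD$, or they lie on the same side of the $LD$ (with the $LPL$ between the $LD$ and the $MCNC$). (2) For a generic 1-parameter family of surfaces $M_t$ with $M_0=M$, the configuration of the three curves deforms near $p$, for $t\neq0$ small, as follows: for one sign of $t$, $LD_t$ and $MCNC_t$ intersect transversally at exactly two points, $LPL_t$ passes through these two points and has an ordinary tangency with $LD_t$ at each of them, and there are no other intersections between the three curves; for the other sign of $t$, the curves $LD_t$, $LPL_t$, $MCNC_t$ are pairwise disjoint.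
   Context: Minkowski space $\mathbb{R}^3_1$ is $\mathbb{R}^3$ with $\langle \mathbf{u},\mathbf{v}\rangle=u_0v_0+u_1v_1-u_2v_2$. The vector product is defined by $\langle \mathbf a\times \mathbf b,\mathbf c\rangle=\det(\mathbf a,\mathbf b,\mathbf c)$. For a smooth regular surface $M\subset\mathbb{R}^3_1$ with local parametrization $\mathbf{x}(u,v)$, put $E=\langle \mathbf{x}_u,\mathbf{x}_u\rangle$, $F=\langle \mathbf{x}_u,\mathbf{x}_v\rangle$, $G=\langle \mathbf{x}_v,\mathbf{x}_v\rangle$, $\bar l=\langle \mathbf{x}_u\times\mathbf{x}_v,\mathbf{x}_{uu}\rangle$, $\bar m=\langle \mathbf{x}_u\times\mathbf{x}_v,\mathbf{x}_{uv}\rangle$, $\bar n=\langle \mathbf{x}_u\times\mathbf{x}_v,\mathbf{x}_{vv}\rangle$, and $$\delta=F^2-EG,\quad \tilde\delta=(E\bar n-G\bar l)^2-4(F\bar n-G\bar m)(E\bar m-F\bar l),\quad \bar H=\bar lG-2\bar mF+\bar nE.$$ The curves $LD$ (locus of degeneracy), $LPL$ (lightlike principal locus), $MCNC$ (mean curvature null curve) are the zero sets of $\delta,\tilde\delta,\bar H$. A curve is regular at a point if the differential of its defining function is nonzero there. If $\gamma$ is a regular parametrization of one of these curves $\gamma_1$ near a regular point $p=\gamma(0)$ and $g$ is the defining function of another one $\gamma_2$, then $m(\gamma_1,\gamma_2:p)$ is the order of contact, i.e. the order of vanishing of $g\circ\gamma$ at $0$ (ordinary tangency: order $2$). Genericity: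 $\mathcal{G}$ is the set of germs $(M,p)$ of smooth surfaces $M\subset\mathbb{R}^3_1$ at $p\in M$, identified with the set of germs of local parametrizations $(\mathbb{R}^2,0)\to(\mathbb{R}^3_1,p)$, $p\in \mathbb{R}^3_1$, with the Whitney topology, modulo diffeomorphism germs of the source $(\mathbb{R}^2,0)$ (quotient topology). A property holds for generic $(M,p)$ in a subset $\tilde{\mathcal{G}}\subset\mathcal{G}$ if the set of $(M,p)\in\tilde{\mathcal{G}}$ satisfying it is open and dense in $\tilde{\mathcal{G}}$ (induced topology). Families: a 1-parameter family $M_t$, $t\in(\mathbb{R},0)$, with $M_0=M$ is a family of surfaces given, when $M$ is the graph of $f$ over a coordinate plane (Monge form), by the graphs of $f+h(\cdot,\cdot,t)$ with $h$ smooth and $h(\cdot,\cdot,0)=0$; it is generic if $h$ satisfies suitable open and dense conditions. $LD_t$, $LPL_t$, $MCNC_t$ denote the corresponding curves of $M_t$; all assertions are local, in a neighbourhood of $p$. *)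

(* Defs.v *)
From HB Require Import structures.
From mathcomp Require Import all_boot all_order all_algebra.
From mathcomp Require Import generic_quotient.
From mathcomp Require Import all_classical all_reals all_analysis.
From mathcomp Require Import ring.
Import Order.TTheory GRing.Theory Num.Theory.
Import numFieldNormedType.Exports.

Set Implicit Arguments.
Unset Strict Implicit.
Unset Printing Implicit Defensive.

Local Open Scope classical_set_scope.
Local Open Scope ring_scope.
Local Open Scope quotient_scope.

Section Smooth.
Context {R : realType} {V W : normedModType R}.
Implicit Types (f g : V -> W) (U : set V).

Definition iterD (vs : seq V) (f : V -> W) : V -> W :=
  foldr (fun v g => 'D_v g) f vs.

(* Smoothness of the germ of f at x: on one neighbourhood of x, all iterated
   directional derivatives exist and are differentiable. *)
Definition smooth_at (f : V -> W) (x : V) : Prop :=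
  \forall y \near x, forall vs, differentiable (iterD vs f) y.

(* The infinite jet: the product topology of its target induces on functions
   the topology generated by the sets of f whose k-jet at x lies in an open
   set of k-jets, k being arbitrary. *)
Definition jet (x : V) (f : V -> W) : prod_topology (fun _ : seq V => W) :=
  fun vs => iterD vs f x.

Definition diff_on (n : nat) U f :=
  forall vs y, (size vs <= n)%N -> U y -> differentiable (iterD vs f) y.

Lemma diff_on0 U f :
  diff_on 0 U f <-> forall y, U y -> differentiable f y.
Proof.
split=> [df y Uy|df [|//] y _]; [exact: (df [::])|exact: df].
Qed.

Lemma diff_onS n U f : diff_on n.+1 U f <->
  (forall y, U y -> differentiable f y) /\ forall v, diff_on n U ('D_v f).
Proof.
split=> [df|[df dDf] vs].
  split=> [y Uy|v vs y szv Uy]; first exact: (df [::]).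
  have := df (rcons vs v) y; rewrite size_rcons /iterD foldr_rcons; exact.
case/lastP: vs => [|vs v] y; first by move=> _; exact: df.
by rewrite size_rcons ltnS /iterD foldr_rcons; apply: dDf.
Qed.

Lemma diff_onW n U f : diff_on n.+1 U f -> diff_on n U f.
Proof. by move=> df vs y /leqW; apply: df. Qed.

Lemma differentiable_near_eq f g x : (\forall y \near x, f y = g y) ->
  differentiable f x -> differentiable g x.
Proof.
move=> fg /diff_locallyP[dc df].
have fgx : f x = g x by apply: nbhs_singleton fg.
have E : g \o shift x = cst (g x) + 'd f x +o_ 0 id.
  apply/eqaddoP => e e0; move/eqaddoP: df => /(_ e e0) df.
  have fg0 : \forall h \near 0, f (h + x) = g (h + x).
    by move: fg; rewrite (near_shift 0) /=; apply: filterS => h; rewrite subr0.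
  near=> h.
  have -> : (g \o shift x - (cst (g x) + 'd f x)) h =
            (f \o shift x - (cst (f x) + 'd f x)) h.
    by rewrite /= -fgx !fctE /= ; congr (_ - _); apply/esym; near: h.
  by near: h.
have dE := diff_unique dc E.
by apply/diff_locallyP; rewrite dE.
Unshelve. all: by end_near. Qed.

Lemma diff_on_eq n U f g : open U -> (forall y, U y -> f y = g y) ->
  diff_on n U f -> diff_on n U g.
Proof.
move=> oU; elim: n f g => [|n IH] f g fg.
  move/diff_on0 => df; apply/diff_on0 => y Uy.
  apply: differentiable_near_eq (df y Uy).
  by apply: filterS fg _; apply: open_nbhs_nbhs.
move/diff_onS => [df dDf]; apply/diff_onS; split=> [y Uy|v].
  apply: differentiable_near_eq (df y Uy).
  by apply: filterS fg _; apply: open_nbhs_nbhs.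
apply: IH (dDf v) => y Uy; apply: near_eq_derive.
by apply: filterS fg _; apply: open_nbhs_nbhs.
Qed.

Lemma diff_onD n U f g : open U -> diff_on n U f -> diff_on n U g ->
  diff_on n U (f + g).
Proof.
move=> oU; elim: n f g => [|n IH] f g.
  move=> /diff_on0 df /diff_on0 dg; apply/diff_on0 => y Uy.
  by apply: differentiableD; [exact: df|exact: dg].
move=> /diff_onS[df dDf] /diff_onS[dg dDg]; apply/diff_onS; split=> [y Uy|v].
  by apply: differentiableD; [exact: df|exact: dg].
apply: (@diff_on_eq _ _ ('D_v f + 'D_v g)) => //; last exact: IH.
move=> y Uy; rewrite deriveD //; apply: diff_derivable; [exact: df|exact: dg].
Qed.

Lemma diff_on_cst n U (w : W) : open U -> diff_on n U (cst w).
Proof.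
move=> oU; elim: n w => [|n IH] w.
  by apply/diff_on0 => y _; exact: differentiable_cst.
apply/diff_onS; split=> [y _|v]; first exact: differentiable_cst.
by apply: (diff_on_eq oU _ (IH 0)) => y _; rewrite derive_cst.
Qed.

Lemma diff_on_sum n U (I : finType) (F : I -> V -> W) : open U ->
  (forall i, diff_on n U (F i)) -> diff_on n U (\sum_i F i).
Proof.
move=> oU dF; elim/big_ind: _ => // [|f g].
  exact: diff_on_cst.
exact: diff_onD.
Qed.

Lemma smooth_atP f x : smooth_at f x <->
  exists2 U, open_nbhs x U & forall n, diff_on n U f.
Proof.
split=> [|[U xU dU]].
  rewrite /smooth_at => H.
  have : nbhs x [set y | forall vs, differentiable (iterD vs f) y] by [].
  rewrite nbhsE => -[U xU UP]; exists U => // n vs y _ Uy; exact: UP.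
apply: filterS (open_nbhs_nbhs xU) => y Uy vs; exact: (dU (size vs)).
Qed.

End Smooth.

Section SmoothScale.
Context {R : realType} {V W : normedModType R}.

Lemma scale_is_bilinear : bilinear_for
    (GRing.Scale.Law.clone _ _ *:%R _) (GRing.Scale.Law.clone _ _ *:%R _)
    (fun (k : R) (w : W) => k *: w).
Proof.
split=> [w|k] a x y /=; first by rewrite scalerDl scalerA.
by rewrite scalerDr !scalerA mulrC.
Qed.

Lemma diff_scale (k : V -> R) (f : V -> W) y :
  differentiable k y -> differentiable f y ->
  differentiable (fun z => k z *: f z) y /\
  forall v, 'D_v (fun z => k z *: f z) y = k y *: 'D_v f y + 'D_v k y *: f y.
Proof.
move=> dk df.
pose B := bilinear_isBilinear.Build R R W W _ _ _ scale_is_bilinear.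
pose S : {bilinear R -> W -> W} := HB.pack (fun (k : R) (w : W) => k *: w) B.
have cS : continuous (fun p : R * W => S p.1 p.2).
  by move=> p; exact: scale_continuous.
have dS := differentiable_bilin (k y, f y) cS.
have dp := differentiable_pair dk df.
have E : (fun z => k z *: f z) = (fun p : R * W => S p.1 p.2) \o
    (fun z => (k z, f z)).
  by [].
split; first by rewrite E; apply: differentiable_comp.
move=> v; rewrite deriveE; last by rewrite E; apply: differentiable_comp.
rewrite E diff_comp //= diff_pair //=.
have -> := diff_bilin (k y, f y) cS.
by rewrite /= !deriveE.
Qed.

Lemma diff_onZ n (U : set V) (k : V -> R) (f : V -> W) : open U ->
  diff_on n U k -> diff_on n U f -> diff_on n U (fun z => k z *: f z).
Proof.
move=> oU; elim: n k f => [|n IH] k f.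
  move=> /diff_on0 dk /diff_on0 df; apply/diff_on0 => y Uy.
  by have [] := diff_scale (dk y Uy) (df y Uy).
move=> dk df; move: (dk) (df) => /diff_onS[dk' dDk] /diff_onS[df' dDf].
apply/diff_onS; split=> [y Uy|v].
  by have [] := diff_scale (dk' y Uy) (df' y Uy).
apply: (@diff_on_eq _ _ _ _ _
  ((fun z => k z *: 'D_v f z) + (fun z => 'D_v k z *: f z))) => //.
  by move=> y Uy; have [_ ->] := diff_scale (dk' y Uy) (df' y Uy).
by apply: diff_onD => //; apply: IH => //; exact: diff_onW.
Qed.

Lemma diff_on_coord n m (U : set V) (f : V -> 'rV[R]_m) i : open U ->
  diff_on n U f -> diff_on n U (fun z => f z 0 i).
Proof.
move=> oU.
have dc (g : V -> 'rV[R]_m) y : differentiable g y ->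
    differentiable (fun z => g z 0 i : R) y.
  move=> dg; rewrite (_ : (fun z => _) = (fun N : 'rV[R]_m => N 0 i : R) \o g) //.
  by apply: differentiable_comp => //; exact: differentiable_coord.
elim: n f => [|n IH] f.
  by move=> /diff_on0 df; apply/diff_on0 => y Uy; apply/dc/df.
move=> /diff_onS[df dDf]; apply/diff_onS; split=> [y Uy|v].
  by apply/dc/df.
apply: (@diff_on_eq _ _ _ _ _ (fun z => 'D_v f z 0 i)) => //; last exact: IH.
by move=> y Uy; rewrite derive_mx ?mxE //; apply/diff_derivable/df.
Qed.

End SmoothScale.

Section SmoothComp.
Context {R : realType} {V W : normedModType R} {m : nat}.

Lemma diff_on_comp n (U : set V) (O : set 'rV[R]_m) (phi : V -> 'rV[R]_m)
    (f : 'rV[R]_m -> W) : open U -> open O -> (forall y, U y -> O (phi y)) ->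
  diff_on n U phi -> diff_on n O f -> diff_on n U (f \o phi).
Proof.
move=> oU oO UO; elim: n f => [|n IH] f.
  move=> /diff_on0 dphi /diff_on0 df; apply/diff_on0 => y Uy.
  by apply: differentiable_comp; [exact: dphi|exact/df/UO].
move=> dphi'; move: (dphi') => /diff_onS[dphi dDphi] /diff_onS[df dDf].
apply/diff_onS; split=> [y Uy|v].
  by apply: differentiable_comp; [exact: dphi|exact/df/UO].
apply: (@diff_on_eq _ _ _ _ _ (\sum_(i < m)
  (fun z => 'D_v phi z 0 i *: ('D_(delta_mx 0 i) f \o phi) z))) => //.
  move=> y Uy; have dfy : differentiable f (phi y) by exact/df/UO.
  have dpy := dphi y Uy.
  rewrite deriveE; last exact: differentiable_comp.
  rewrite diff_comp //= -(deriveE v dpy).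
  rewrite {1}(row_sum_delta ('D_v phi y)) linear_sum fct_sumE.
  apply: eq_bigr => i _.
  by rewrite linearZ /= (deriveE _ dfy).
apply: (@diff_on_sum _ _ _ n U 'I_m (fun i z =>
  'D_v phi z 0 i *: ('D_(delta_mx 0 i) f \o phi) z)) => // i.
apply: diff_onZ => //; first exact: diff_on_coord.
by apply: IH => //; exact: diff_onW.
Qed.

Lemma smooth_at_comp (phi : V -> 'rV[R]_m) (f : 'rV[R]_m -> W) x :
  smooth_at phi x -> smooth_at f (phi x) -> smooth_at (f \o phi) x.
Proof.
move=> /smooth_atP[U [oU Ux] dphi] /smooth_atP[Z oO df]; apply/smooth_atP.
have cphi : {for x, continuous phi}.
  by apply: differentiable_continuous; exact: (dphi 0%N [::]).
have : nbhs x (U `&` phi @^-1` Z).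
  by apply: filterI; [exact: open_nbhs_nbhs|apply: cphi; exact: open_nbhs_nbhs].
rewrite nbhsE => -[U' [oU' U'x] sU'].
exists U' => // n; apply: (@diff_on_comp _ _ Z) => //; first by case: oO.
  by move=> y /sU'[].
by move=> vs y sz /sU'[Uy _]; exact: dphi sz Uy.
Qed.

End SmoothComp.

Lemma smooth_at_id {R : realType} {V : normedModType R} (x : V) :
  smooth_at id x.
Proof.
apply/smooth_atP; exists setT; first by split => //; exact: openT.
case=> [|n]; first by apply/diff_on0.
apply/diff_onS; split=> // v.
apply: (@diff_on_eq _ _ _ _ _ (cst v)); [exact: openT| |exact/diff_on_cst/openT].
by move=> y _; rewrite derive_id.
Qed.

Section Minkowski.
Context {R : realType}.
Local Notation R2 := 'rV[R]_2.
Local Notation R3 := 'rV[R]_3.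

Definition mink (a b : R3) : R :=
  a 0 0 * b 0 0 + a 0 1 * b 0 1 - a 0 2 * b 0 2.

Definition mcross (a b : R3) : R3 :=
  \row_j [:: a 0 1 * b 0 2 - a 0 2 * b 0 1;
             a 0 2 * b 0 0 - a 0 0 * b 0 2;
             a 0 1 * b 0 0 - a 0 0 * b 0 1]`_j.

Lemma row3E (v : R3) j : v 0 j = [:: v 0 0; v 0 1; v 0 2]`_j.
Proof. by case: j => -[|[|[|//]]] p /=; congr (v _ _); apply/val_inj. Qed.

Lemma mcrossP (a b c : R3) :
  mink (mcross a b) c = \det (\matrix_(i < 3) [:: a; b; c]`_i).
Proof.
rewrite /mink !mxE /=.
move: (row3E a) (row3E b) (row3E c).
move: (a 0 0) (a 0 1) (a 0 2) (b 0 0) (b 0 1) (b 0 2) 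
  (c 0 0) (c 0 1) (c 0 2) => a0 a1 a2 b0 b1 b2 c0 c1 c2 Ha Hb Hc.
have -> : \matrix_(i < 3) [:: a; b; c]`_i = \matrix_(i < 3, j < 3)
    (nth [::] [:: [:: a0; a1; a2]; [:: b0; b1; b2]; [:: c0; c1; c2]] i)`_j.
  by apply/matrixP => -[[|[|[|//]]] p] j; rewrite !mxE /= ?Ha ?Hb ?Hc.
rewrite (expand_det_row _ ord0) !big_ord_recl big_ord0 /cofactor.
have det2 (B : 'M[R]_2) : \det B =
    B ord0 ord0 * B (lift ord0 ord0) (lift ord0 ord0)
    - B ord0 (lift ord0 ord0) * B (lift ord0 ord0) ord0.
  rewrite (expand_det_row _ ord0) !big_ord_recl big_ord0 /cofactor.
  rewrite !det_mx11 !mxE /=.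
  have -> : lift (lift ord0 ord0) 0 = ord0 :> 'I_2 by apply/val_inj.
  have -> : lift ord0 0 = lift ord0 ord0 :> 'I_2 by apply/val_inj.
  by ring.
rewrite !det2 !mxE /=.
by ring.
Qed.

Definition eu : R2 := delta_mx 0 0.
Definition ev : R2 := delta_mx 0 1.

Section Curves.
Variable x : R2 -> R3.
Let xu := 'D_eu x.
Let xv := 'D_ev x.
Let xuu := 'D_eu xu.
Let xuv := 'D_ev xu.
Let xvv := 'D_ev xv.

Definition ffE (u : R2) := mink (xu u) (xu u).
Definition ffF (u : R2) := mink (xu u) (xv u).
Definition ffG (u : R2) := mink (xv u) (xv u).
Definition ffl (u : R2) := mink (mcross (xu u) (xv u)) (xuu u).
Definition ffm (u : R2) := mink (mcross (xu u) (xv u)) (xuv u).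
Definition ffn (u : R2) := mink (mcross (xu u) (xv u)) (xvv u).

Definition delta (u : R2) : R := ffF u ^+ 2 - ffE u * ffG u.
Definition tdelta (u : R2) : R :=
  (ffE u * ffn u - ffG u * ffl u) ^+ 2
  - 4 * (ffF u * ffn u - ffG u * ffm u) * (ffE u * ffm u - ffF u * ffl u).
Definition Hbar (u : R2) : R :=
  ffl u * ffG u - 2 * ffm u * ffF u + ffn u * ffE u.

(* The three curves are subsets of the parameter plane. *)
Definition LD : set R2 := [set u | delta u = 0].
Definition LPL : set R2 := [set u | tdelta u = 0].
Definition MCNC : set R2 := [set u | Hbar u = 0].
End Curves.

Definition regular_at (g : R2 -> R) (q : R2) : Prop :=
  exists v, 'd g q v != 0.

Definition regular_param (g : R2 -> R) (q : R2) (gamma : R -> R2) : Prop :=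
  [/\ smooth_at gamma 0, gamma 0 = q, 'D_1 gamma 0 != 0
    & \forall s \near 0, g (gamma s) = 0].

(* m(g1 = 0, g2 = 0 : q) = k; independent of the choice of gamma. *)
Definition contact_eq (g1 g2 : R2 -> R) (q : R2) (k : nat) : Prop :=
  regular_at g1 q /\ exists2 gamma, regular_param g1 q gamma &
    (forall j, (j < k)%N -> derive1n j (g2 \o gamma) 0 = 0) /\
    derive1n k (g2 \o gamma) 0 != 0.

(* m(g1 = 0, g2 = 0 : q) > k, infinite order included. *)
Definition contact_gt (g1 g2 : R2 -> R) (q : R2) (k : nat) : Prop :=
  regular_at g1 q /\ exists2 gamma, regular_param g1 q gamma &
    forall j, (j <= k)%N -> derive1n j (g2 \o gamma) 0 = 0.

Definition ordinary_tangency (g1 g2 : R2 -> R) (q : R2) : Prop :=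
  regular_at g2 q /\ contact_eq g1 g2 q 2.

Definition transversal (g1 g2 : R2 -> R) (q : R2) : Prop :=
  forall a b : R, (forall v, a * 'd g1 q v + b * 'd g2 q v = 0) ->
  a = 0 /\ b = 0.

(* In both configurations the MCNC has to be a regular curve at 0, so that it
   is not reduced to a point and has two sides. The side of the LD (resp. of
   the MCNC) on which a point lies is read off the sign of delta (resp. of
   Hbar). *)
Definition opposite_sides (x : R2 -> R3) : Prop :=
  regular_at (Hbar x) 0 /\ exists s : bool,
  \forall u \near (0 : R2), u != 0 ->
    (LPL x u -> 0 < (-1) ^+ s * delta x u) /\
    (MCNC x u -> (-1) ^+ s * delta x u < 0).

(* "The LPL lies between the LD and the MCNC": it lies on the side of the LD
   that contains the MCNC, and on the side of the MCNC that contains the LD. *)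
Definition same_side (x : R2 -> R3) : Prop :=
  regular_at (Hbar x) 0 /\ exists s s' : bool,
  \forall u \near (0 : R2), u != 0 ->
    [/\ MCNC x u -> 0 < (-1) ^+ s * delta x u,
        LD x u -> 0 < (-1) ^+ s' * Hbar x u &
        LPL x u -> 0 < (-1) ^+ s * delta x u /\ 0 < (-1) ^+ s' * Hbar x u].

Definition intersections (x : R2 -> R3) : set R2 :=
  (LD x `&` LPL x) `|` (LD x `&` MCNC x) `|` (LPL x `&` MCNC x).

Definition two_tangencies (x : R2 -> R3) (U : set R2) : Prop :=
  exists q1 q2, [/\ q1 != q2,
    LD x `&` MCNC x `&` U = [set q1; q2],
    intersections x `&` U `<=` [set q1; q2] &
    forall q, [set q1; q2] q -> [/\ transversal (delta x) (Hbar x) q,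
      LPL x q & ordinary_tangency (delta x) (tdelta x) q]].

Definition pairwise_disjoint (x : R2 -> R3) (U : set R2) : Prop :=
  intersections x `&` U = set0.

(* Germ version of the deformation: the description holds in every small
   enough neighbourhood U of 0, for all t <> 0 small with respect to U. *)
Definition splits (X : R -> R2 -> R3) : Prop :=
  exists s : bool, exists2 U0 : set R2, nbhs (0 : R2) U0 &
  forall U : set R2, nbhs (0 : R2) U -> U `<=` U0 ->
  exists2 e : R, 0 < e & forall t : R, 0 < t -> t < e ->
    two_tangencies (X ((-1) ^+ s * t)) U /\
    pairwise_disjoint (X (- ((-1) ^+ s * t))) U.

Definition diffeo_germ (phi : R2 -> R2) : Prop :=
  [/\ smooth_at phi 0, phi 0 = 0 &
    exists psi : R2 -> R2, [/\ smooth_at psi 0, psi 0 = 0,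
      \forall u \near (0 : R2), psi (phi u) = u &
      \forall u \near (0 : R2), phi (psi u) = u]].

(* Equality of the germs at 0 of x and y up to a diffeomorphism germ of the
   source; the diffeomorphism germ id accounts for equality of germs. *)
Definition reparam (x y : R2 -> R3) : Prop :=
  exists2 phi, diffeo_germ phi & \forall u \near (0 : R2), x u = y (phi u).

Lemma smooth_at_continuous (V W : normedModType R) (f : V -> W) y :
  smooth_at f y -> {for y, continuous f}.
Proof.
move=> /nbhs_singleton /(_ [::]); exact: differentiable_continuous.
Qed.

Lemma near_comp0 (phi : R2 -> R2) (P : set R2) : smooth_at phi 0 ->
  phi 0 = 0 -> (\forall u \near (0 : R2), P u) ->
  \forall u \near (0 : R2), P (phi u).
Proof.
move=> /smooth_at_continuous cphi phi0 nP.
by apply: (cphi P); rewrite phi0.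
Qed.

Lemma reparam_refl x : reparam x x.
Proof.
exists id; last by apply: filterE.
split=> //; first exact: smooth_at_id.
by exists id; split=> //; [exact: smooth_at_id|exact: filterE|exact: filterE].
Qed.

Lemma reparam_sym x y : reparam x y -> reparam y x.
Proof.
move=> [phi [sphi phi0 [psi [spsi psi0 psiK phiK]]] xy].
exists psi; first by split=> //; exists phi.
have := near_comp0 spsi psi0 xy; apply: filterS2 phiK => u phiK ->.
by rewrite phiK.
Qed.

Lemma reparam_trans y x z : reparam x y -> reparam y z -> reparam x z.
Proof.
move=> [phi [sphi phi0 [psi [spsi psi0 psiK phiK]]] xy].
move=> [phi' [sphi' phi0' [psi' [spsi' psi0' psiK' phiK']]] yz].
exists (phi' \o phi); last first.
  by apply: filterS2 xy (near_comp0 sphi phi0 yz) => u /= -> ->.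
split; [by apply: smooth_at_comp; rewrite ?phi0|by rewrite /= phi0|].
exists (psi \o psi'); split.
- by apply: smooth_at_comp; rewrite ?psi0'.
- by rewrite /= psi0'.
- by apply: filterS2 psiK (near_comp0 sphi phi0 psiK') => u /= + ->.
- by apply: filterS2 phiK' (near_comp0 spsi' psi0' phiK) => u /= + ->.
Qed.

End Minkowski.

Section Germs.
Variable R : realType.
Local Notation R2 := 'rV[R]_2.
Local Notation R3 := 'rV[R]_3.

Definition local_params : set (R2 -> R3) :=
  [set x | smooth_at x 0 /\ forall v, 'd x 0 v = 0 -> v = 0].

(* The Whitney topology on germs of maps at 0: its basic open sets are the
   {f | j^k f (0) \in O} for k : nat and O open in the space of k-jets. A germ
   is given by any of its representatives; its base point is x 0. *)
Definition param : Type :=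
  initial_topology (fun x : local_params => jet 0 (\val x)).
HB.instance Definition _ := Topological.on param.

Definition fun_of_param (x : param) : R2 -> R3 := \val (x : local_params).

Definition reparamb : rel param :=
  fun x y => `[< reparam (fun_of_param x) (fun_of_param y) >].

Lemma reparamb_refl : reflexive reparamb.
Proof. by move=> x; apply/asboolP/reparam_refl. Qed.

Lemma reparamb_sym : symmetric reparamb.
Proof. by move=> x y; apply/asboolP/asboolP => /reparam_sym. Qed.

Lemma reparamb_trans : transitive reparamb.
Proof.
by move=> y x z /asboolP xy /asboolP yz; apply/asboolP/(reparam_trans xy).
Qed.

Canonical reparam_equiv := EquivRel reparamb
  reparamb_refl reparamb_sym reparamb_trans.

Definition surface_germ : Type := quotient_topology {eq_quot reparam_equiv}.
HB.instance Definition _ := Topological.on surface_germ.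
HB.instance Definition _ := Quotient.on surface_germ.

Definition on_germ (C : (R2 -> R3) -> Prop) : set surface_germ :=
  [set M | forall x : param, \pi_surface_germ x = M -> C (fun_of_param x)].

Definition G6 : set surface_germ := on_germ (fun x =>
  [/\ LD x 0, regular_at (delta x) 0, regular_at (tdelta x) 0
    & contact_gt (delta x) (tdelta x) 0 2]).

(* The graph of f over the i-th coordinate plane (the one where the i-th
   coordinate vanishes), the point a of this plane being the origin of the
   domain of f. *)
Definition graph (i : 'I_3) (a : R2) (f : R2 -> R) : R2 -> R3 :=
  fun u => \row_j (if unlift i j is Some k then (a + u) 0 k else f u).

Definition monge (M : surface_germ) (i : 'I_3) (a : R2) (f : R2 -> R) : Prop :=
  smooth_at f 0 /\ exists2 x : param, \pi_surface_germ x = M &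
    \forall u \near (0 : R2), fun_of_param x u = graph i a f u.

Definition deformations : set (R2 * R -> R) :=
  [set h | smooth_at h 0 /\ \forall u \near (0 : R2), h (u, 0) = 0].

Definition deformation : Type :=
  initial_topology (fun h : deformations => jet 0 (\val h)).
HB.instance Definition _ := Topological.on deformation.

Definition fun_of_deformation (h : deformation) : R2 * R -> R :=
  \val (h : deformations).

Definition deform (i : 'I_3) (a : R2) (f : R2 -> R) (h : deformation) (t : R) :
    R2 -> R3 :=
  graph i a (fun u => f u + fun_of_deformation h (u, t)).

End Germs.

(* "For generic points of A, P holds": the set of points of A satisfying P is
   open and dense in A for the induced topology. *)
Definition generic_in (T : topologicalType) (A P : set T) : Prop :=
  (exists2 O, open O & A `&` P = A `&` O) /\ A `<=` closure (A `&` P).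

(* Main.v *)
(* Write K = l n - m^2. The identity tdelta = Hbar^2 + 4 delta K governs the
   three curves. At a point of G6 it gives Hbar = 0, K <> 0 and
   d Hbar = r d delta for some r, and if Hbar vanishes to order k along the LD
   then tdelta vanishes there to order 2 k; so the contact orders are 4 and 2 as
   soon as the second derivative n of Hbar along the LD is nonzero. When also
   r <> 0, writing Hbar = r delta + (terms of order 2) shows that the sign of
   n r K decides between the two configurations. The condition n r <> 0 is open
   in the jets and invariant under reparametrization; it is dense because adding
   a suitable cubic to the parametrization shifts r, and adding the fourth power
   of a linear form shifts n without changing r.
   For a family, delta = Hbar = 0 defines a curve in the (u, t)-space, on which t
   has a nondegenerate critical point provided that n <> 0 and
   d/dt (Hbar - r delta) <> 0: for one sign of t there are two intersection
   points, for the other none. At such a point d delta and d Hbar are independent,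
   and as K <> 0 the identity yields an ordinary tangency of the LD and the LPL.
   The condition on d/dt is open and dense: it is reached by adding t l(u)^2, with
   l a linear form, to the family. *)

From HB Require Import structures.
Require Import Defs.
From mathcomp Require Import all_boot all_order all_algebra.
From mathcomp Require Import generic_quotient.
From mathcomp Require Import all_classical all_reals all_analysis.
From mathcomp Require Import ring lra.
Import Order.TTheory GRing.Theory Num.Theory.
Import numFieldNormedType.Exports.
Local Open Scope classical_set_scope.
Local Open Scope ring_scope.

Set Implicit Arguments.
Unset Strict Implicit.
Unset Printing Implicit Defensive.
(* ssrnat has an iterD, too. *)
Local Notation iterD := Defs.iterD.

(** * Smooth germs and their jets *)

Section SmoothGerms.
Context {R : realType} {V : normedModType R}.
Implicit Types (f g : V -> R) (x : V).

(** A germ is a class modulo reparametrization and the curves carry no preferred parameter, so every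
    condition is stated on jets at 0. Derivatives along the LD are replaced by the bracket
    [pb eu ev (delta x)], which differentiates along the level curves of [delta x]: it is continuous
    in the jet and, at the base point, transforms by a power of the Jacobian. The sign deciding the
    configuration acquires the Jacobian to the power 14, which is even, so it belongs to the germ.
    Normal forms are avoided in the perturbations too. Adding P e with P vanishing to order k + 2
    preserves [delta] up to order k and alters [Hbar], up to order k, by a multiple of G P_uu - 2 F
    P_uv + E P_vv with E, F, G frozen at 0. On powers of a linear form this operator acts through a
    quadratic form, of rank one at a point of G6; two independent linear forms where it is nonzero
    supply the perturbations of surfaces and of families. The forms are set up on a normed space
    with two chosen directions, to serve both a surface in the plane and a family in the (u,
    t)-space. *)

Lemma smooth_near (W : normedModType R) (f : V -> W) x :
  smooth_at f x -> \forall y \near x, smooth_at f y.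
Proof. exact: near_join. Qed.

Lemma smooth_diff (W : normedModType R) (f : V -> W) x :
  smooth_at f x -> differentiable f x.
Proof. by move=> /nbhs_singleton/(_ [::]). Qed.

Lemma smooth_derivable (W : normedModType R) (f : V -> W) x v :
  smooth_at f x -> derivable f x v.
Proof. by move=> /smooth_diff; exact: diff_derivable. Qed.

Lemma smooth_eq (W : normedModType R) (f g : V -> W) x :
  (\forall y \near x, f y = g y) -> smooth_at f x -> smooth_at g x.
Proof.
move=> fg /smooth_atP[U xU dU].
have : nbhs x (U `&` [set y | f y = g y]).
  by apply: filterI => //; exact: open_nbhs_nbhs.
rewrite nbhsE => -[U' [oU' U'x] sU']; apply/smooth_atP; exists U' => // n.
apply: (@diff_on_eq _ _ _ _ _ f) => //; first by move=> y /sU'[].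
by move=> vs y sz /sU'[Uy _]; exact: dU sz Uy.
Qed.

Lemma smooth_derive (W : normedModType R) (f : V -> W) x v :
  smooth_at f x -> smooth_at ('D_v f) x.
Proof.
move=> /smooth_atP[U xU dU]; apply/smooth_atP; exists U => // n.
by have /diff_onS[_] := dU n.+1.
Qed.

Lemma iterD_near (W : normedModType R) (f g : V -> W) x vs :
  (\forall y \near x, f y = g y) -> \forall y \near x, iterD vs f y = iterD vs g y.
Proof.
move=> fg; elim: vs => //= v vs IH.
by apply: filterS (near_join IH) => y; apply: near_eq_derive.
Qed.

Lemma iterD_eq (W : normedModType R) (f g : V -> W) x vs :
  (\forall y \near x, f y = g y) -> iterD vs f x = iterD vs g x.
Proof. by move=> fg; exact: nbhs_singleton (iterD_near vs fg). Qed.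

Lemma iterD_rcons (W : normedModType R) (f : V -> W) vs v :
  iterD (rcons vs v) f = iterD vs ('D_v f).
Proof. by rewrite /iterD foldr_rcons. Qed.

Lemma derive_near (W : normedModType R) (f g : V -> W) x v :
  (\forall y \near x, f y = g y) -> 'D_v f x = 'D_v g x.
Proof. exact: (iterD_eq [:: v]). Qed.

Lemma smooth_cst (W : normedModType R) (w : W) x : smooth_at (fun=> w) x.
Proof.
apply/smooth_atP; exists setT; first by split=> //; exact: openT.
by move=> n; exact/diff_on_cst/openT.
Qed.

Lemma smooth_bin (W W' Z : normedModType R) (F : (V -> W) -> (V -> W') -> V -> Z)
    (f : V -> W) (g : V -> W') x :
  (forall n U, open U -> diff_on n U f -> diff_on n U g -> diff_on n U (F f g)) ->
  smooth_at f x -> smooth_at g x -> smooth_at (F f g) x.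
Proof.
move=> dF /smooth_atP[U [oU Ux] dU] /smooth_atP[U' [oU' Ux'] dU'].
apply/smooth_atP; exists (U `&` U'); first by split=> //; exact: openI.
move=> n; apply: dF; first exact: openI.
- by move=> vs y sz [Uy _]; exact: dU sz Uy.
- by move=> vs y sz [_ Uy]; exact: dU' sz Uy.
Qed.

Lemma smoothD (W : normedModType R) (f g : V -> W) x :
  smooth_at f x -> smooth_at g x -> smooth_at (fun z => f z + g z) x.
Proof.
move=> sf sg; apply: (smooth_bin (F := fun (f g : V -> W) z => f z + g z)) sf sg.
by move=> n U oU df dg; exact: diff_onD.
Qed.

Lemma smoothZ (W : normedModType R) (k : V -> R) (f : V -> W) x :
  smooth_at k x -> smooth_at f x -> smooth_at (fun z => k z *: f z) x.
Proof.
move=> sk sf.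
apply: (smooth_bin (F := fun (k : V -> R) (g : V -> W) z => k z *: g z)) sk sf.
by move=> n U oU df dg; exact: diff_onZ.
Qed.

Lemma smoothM f g x :
  smooth_at f x -> smooth_at g x -> smooth_at (fun z => f z * g z) x.
Proof. exact: smoothZ. Qed.

Lemma smoothN f x : smooth_at f x -> smooth_at (fun z => - f z) x.
Proof.
move=> sf; apply: (@smooth_eq _ (fun z => -1 * f z)).
  by apply: filterE => y; rewrite mulN1r.
by apply: smoothM => //; exact: smooth_cst.
Qed.

Lemma smoothB f g x :
  smooth_at f x -> smooth_at g x -> smooth_at (fun z => f z - g z) x.
Proof. by move=> sf sg; apply: smoothD => //; exact: smoothN. Qed.

Lemma smoothX f n x : smooth_at f x -> smooth_at (fun z => f z ^+ n) x.
Proof.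
move=> sf; elim: n => [|n IH]; first exact: smooth_cst.
apply: (@smooth_eq _ (fun z => f z * f z ^+ n)); last exact: smoothM.
by apply: filterE => y; rewrite exprS.
Qed.

Lemma diff_onV n (U : set V) f : open U -> (forall y, U y -> f y != 0) ->
  diff_on n U f -> diff_on n U (fun z => (f z)^-1).
Proof.
move=> oU f0; elim: n => [|n IH].
  move=> /diff_on0 df; apply/diff_on0 => y Uy.
  by apply: differentiableV; [exact: df|exact: f0].
move=> df; move: (df) => /diff_onS[df' dDf].
apply/diff_onS; split=> [y Uy|v].
  by apply: differentiableV; [exact: df'|exact: f0].
have IHf := IH (diff_onW df).
apply: (@diff_on_eq _ _ _ _ _
  (fun z => (-1 * 'D_v f z) * ((f z)^-1 * (f z)^-1))) => //.
  move=> y Uy; rewrite deriveV; [|exact: f0|exact/diff_derivable/df'].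
  by rewrite /GRing.scale /= expr2 invfM mulN1r !mulNr mulrC.
apply: diff_onZ => //; last by apply: diff_onZ.
by apply: diff_onZ => //; exact: diff_on_cst.
Qed.

Lemma smoothV f x : smooth_at f x -> f x != 0 ->
  smooth_at (fun z => (f z)^-1) x.
Proof.
move=> sf f0; have cf := smooth_at_continuous sf.
have n0 : nbhs (f x) [set r : R | r != 0].
  by apply: open_nbhs_nbhs; split=> //; exact: open_neq.
have {}n0 : nbhs x [set y | f y != 0] by exact: cf _ n0.
move: sf => /smooth_atP[U xU dU].
have : nbhs x (U `&` [set y | f y != 0]).
  by apply: filterI => //; exact: open_nbhs_nbhs.
rewrite nbhsE => -[U' [oU' Ux'] sU'].
apply/smooth_atP; exists U' => // n; apply: diff_onV => //.
  by move=> y /sU'[].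
by move=> vs y sz /sU'[Uy _]; exact: dU sz Uy.
Qed.

Lemma smooth_coord m (f : V -> 'rV[R]_m) i x :
  smooth_at f x -> smooth_at (fun z => f z 0 i) x.
Proof.
move=> /smooth_atP[U [oU Ux] dU]; apply/smooth_atP; exists U => // n.
exact: diff_on_coord.
Qed.

Lemma smooth_sum (W : normedModType R) (I : Type) (r : seq I) (F : I -> V -> W) x :
  (forall i, smooth_at (F i) x) -> smooth_at (fun z => \sum_(i <- r) F i z) x.
Proof.
move=> sF; elim: r => [|i r IH].
  apply: smooth_eq (smooth_cst 0 x).
  by apply: filterE => y; rewrite big_nil.
apply: smooth_eq (smoothD (sF i) IH).
by apply: filterE => y; rewrite big_cons.
Qed.

Lemma smooth_row m (f : V -> 'rV[R]_m) x :
  (forall i, smooth_at (fun z => f z 0 i) x) -> smooth_at f x.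
Proof.
move=> sf; apply: (@smooth_eq _ (fun z => \sum_i f z 0 i *: delta_mx 0 i)).
  by apply: filterE => y; rewrite -row_sum_delta.
by apply: smooth_sum => i; apply: smoothZ => //; exact: smooth_cst.
Qed.

Lemma DD f g x v : smooth_at f x -> smooth_at g x ->
  'D_v (fun z => f z + g z) x = 'D_v f x + 'D_v g x.
Proof. by move=> sf sg; rewrite deriveD //; exact: smooth_derivable. Qed.

Lemma DB f g x v : smooth_at f x -> smooth_at g x ->
  'D_v (fun z => f z - g z) x = 'D_v f x - 'D_v g x.
Proof. by move=> sf sg; rewrite deriveB //; exact: smooth_derivable. Qed.

Lemma DM f g x v : smooth_at f x -> smooth_at g x ->
  'D_v (fun z => f z * g z) x = 'D_v f x * g x + f x * 'D_v g x.
Proof.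
move=> sf sg; rewrite deriveM; [|exact: smooth_derivable..].
by rewrite /GRing.scale /= addrC mulrC.
Qed.

Lemma DMl c f x v : smooth_at f x ->
  'D_v (fun z => c * f z) x = c * 'D_v f x.
Proof.
move=> sf; rewrite DM //; last exact: smooth_cst.
by rewrite derive_cst mul0r add0r.
Qed.

Lemma DN f x v : smooth_at f x -> 'D_v (fun z => - f z) x = - 'D_v f x.
Proof. by move=> sf; rewrite deriveN //; exact: smooth_derivable. Qed.

Lemma Dcoord m (f : V -> 'rV[R]_m) i x v : smooth_at f x ->
  'D_v f x 0 i = 'D_v (fun z => f z 0 i) x.
Proof. by move=> sf; rewrite derive_mx ?mxE //; exact: smooth_derivable. Qed.

Lemma Dlin (f : V -> R) x (a b : R) v w : differentiable f x ->
  'D_(a *: v + b *: w) f x = a * 'D_v f x + b * 'D_w f x.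
Proof. by move=> df; rewrite !deriveE // linearD !linearZ. Qed.

End SmoothGerms.

Section Affine.
Context {R : realType} {V V' W : normedModType R}.

(** The two difference quotients coincide term by term, so the identity holds for every [f]. It
    serves for adapted frames, time slices and projections of the (u, t)-space. *)
Lemma derive_affine (f : V -> W) (A : V' -> V) (L : V' -> V) v :
  (forall z h, A (h *: v + z) = h *: L v + A z) ->
  'D_v (f \o A) = 'D_(L v) f \o A.
Proof.
move=> AL; apply/funext => z; rewrite /derive /=.
suff -> : (fun h : R => h^-1 *: ((f \o A \o shift z) (h *: v) - f (A z))) =
          (fun h => h^-1 *: ((f \o shift (A z)) (h *: L v) - f (A z))) by [].
by apply/funext => h /=; rewrite AL.
Qed.

Lemma derive_affineE (f : V -> W) (A : V' -> V) (L : V' -> V) v z :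
  (forall v z h, A (h *: v + z) = h *: L v + A z) ->
  'D_v (f \o A) z = 'D_(L v) f (A z).
Proof. by move=> AL; have := congr1 (@^~ z) (derive_affine f (AL v)). Qed.

Lemma iterD_affine (f : V -> W) (A : V' -> V) (L : V' -> V) vs :
  (forall v z h, A (h *: v + z) = h *: L v + A z) ->
  iterD vs (f \o A) = iterD (map L vs) f \o A.
Proof. by move=> AL; elim: vs => //= v vs ->; rewrite (derive_affine _ (AL v)). Qed.

Lemma smooth_affine (f : V -> W) (A : V' -> V) (L : V' -> V) x :
  (forall v z h, A (h *: v + z) = h *: L v + A z) ->
  (forall z, differentiable A z) ->
  smooth_at f (A x) -> smooth_at (f \o A) x.
Proof.
move=> AL dA sf; have cA : {for x, continuous A}.
  exact: differentiable_continuous.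
have dfA : \forall y \near x, forall vs, differentiable (iterD vs f) (A y).
  exact: (cA _ sf).
apply: filterS dfA => y dy vs.
rewrite (iterD_affine _ _ AL); exact: differentiable_comp (dA y) (dy _).
Qed.

End Affine.

(** * Order of vanishing at the origin and congruence of germs *)

Section Flat.
Context {R : realType} {V : normedModType R}.
Implicit Types (f g : V -> R) (i j n : nat).

(** Membership of the germ in the n-th power of the ideal of germs vanishing at 0, expressed by
    derivatives rather than by a factorization. *)
Definition flat n f :=
  smooth_at f 0 /\ forall vs, (size vs < n)%N -> iterD vs f 0 = 0.

Lemma flat_smooth n f : flat n f -> smooth_at f 0. Proof. by case. Qed.

Lemma flat0 f : smooth_at f 0 -> flat 0 f. Proof. by []. Qed.

Lemma flat_eq n f g : (\forall z \near (0 : V), f z = g z) -> flat n f -> flat n g.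
Proof.
move=> fg [sf ff]; split; first exact: smooth_eq fg sf.
by move=> vs /ff; rewrite (iterD_eq vs fg).
Qed.

Lemma flat_ext n f g : (forall z, f z = g z) -> flat n f -> flat n g.
Proof. by move=> /funext ->. Qed.

Lemma flatW n m f : (m <= n)%N -> flat n f -> flat m f.
Proof. by move=> mn [sf ff]; split=> // vs sz; apply: ff; exact: leq_trans mn. Qed.

Lemma flatS n f : flat n.+1 f <->
  [/\ smooth_at f 0, f 0 = 0 & forall v, flat n ('D_v f)].
Proof.
split=> [[sf ff]|[sf f0 ff]].
  split=> // [|v]; first exact: (ff [::]).
  split; first exact: smooth_derive.
  by move=> vs sz; rewrite -iterD_rcons; apply: ff; rewrite size_rcons.
split=> // vs; case/lastP: vs => [//|vs v]; rewrite size_rcons ltnS iterD_rcons.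
by have [_] := ff v; apply.
Qed.

Lemma flat1 f : smooth_at f 0 -> f 0 = 0 -> flat 1 f.
Proof. by move=> sf f0; apply/flatS; split=> // v; exact/flat0/smooth_derive. Qed.

Lemma flatD n f g : flat n f -> flat n g -> flat n (fun z => f z + g z).
Proof.
elim: n f g => [|n IH] f g; first by move=> [sf _] [sg _]; exact/flat0/smoothD.
move=> /flatS[sf f0 ff] /flatS[sg g0 fg]; apply/flatS; split=> [||v].
- exact: smoothD.
- by rewrite f0 g0 addr0.
apply: flat_eq (IH _ _ (ff v) (fg v)).
by near=> z; rewrite DD //; near: z; exact: smooth_near.
Unshelve. all: by end_near. Qed.

Lemma DM_near f g v : smooth_at f 0 -> smooth_at g 0 ->
  \forall z \near (0 : V),
    'D_v f z * g z + f z * 'D_v g z = 'D_v (fun z => f z * g z) z.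
Proof.
move=> sf sg; near=> z; rewrite DM //; near: z; exact: smooth_near.
Unshelve. all: by end_near. Qed.

Lemma flatMr n f g : flat n f -> smooth_at g 0 -> flat n (fun z => f z * g z).
Proof.
elim: n f g => [|n IH] f g; first by move=> [sf _] sg; exact/flat0/smoothM.
move=> ff' sg; have /flatS[sf f0 ff] := ff'; apply/flatS; split=> [||v].
- exact: smoothM.
- by rewrite f0 mul0r.
apply: flat_eq (DM_near v sf sg) _; apply: flatD; first exact: IH.
by apply: IH (smooth_derive _ sg); exact: flatW ff'.
Qed.

Lemma flatMl n f g : smooth_at f 0 -> flat n g -> flat n (fun z => f z * g z).
Proof.
by move=> sf fg; apply: flat_ext (flatMr fg sf) => z; rewrite mulrC.
Qed.

(** Induction on [i + j]: by the Leibniz rule, each term of a derivative of the product loses one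
    order in one factor only. *)
Lemma flatM i j f g : flat i f -> flat j g -> flat (i + j) (fun z => f z * g z).
Proof.
elim: {i j}(i + j)%N {1 3}i {1 3}j (erefl (i + j)%N) f g => [|n IH] [|i] [|j] //=.
- by move=> _ f g [sf _] [sg _]; exact/flat0/smoothM.
- by rewrite add0n => <- f g [sf _]; exact: flatMl.
- by rewrite addn0 => <- f g ff [sg _]; exact: flatMr.
rewrite addSn => -[ijn] f g ff' fg'.
have /flatS[sf f0 ff] := ff'; have /flatS[sg g0 fg] := fg'.
apply/flatS; split=> [||v]; [exact: smoothM|by rewrite f0 mul0r|].
apply: flat_eq (DM_near v sf sg) _; apply: flatD.
  exact: (IH i j.+1).
by apply: (IH i.+1 j) => //; rewrite addSn -addnS.
Qed.

Lemma flatN n f : flat n f -> flat n (fun z => - f z).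
Proof.
move=> ff; have s1 : smooth_at (fun _ : V => -1 : R) 0 by exact: smooth_cst.
by apply: flat_ext (flatMl s1 ff) => z; rewrite mulN1r.
Qed.

Lemma flatB n f g : flat n f -> flat n g -> flat n (fun z => f z - g z).
Proof. by move=> ff fg; apply: flatD => //; exact: flatN. Qed.

Lemma flat_D n f v : flat n.+1 f -> flat n ('D_v f).
Proof. by move=> /flatS[]. Qed.

Lemma flat_val n f : flat n.+1 f -> f 0 = 0. Proof. by move=> /flatS[]. Qed.

Lemma flat_Dval n f v : flat n.+2 f -> 'D_v f 0 = 0.
Proof. by move=> /(flat_D v)/flat_val. Qed.

Lemma flatX n f : flat 1 f -> flat n (fun z => f z ^+ n).
Proof.
move=> ff; elim: n => [|n IH]; first exact/flat0/smooth_cst.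
by have := flatM ff IH; apply: flat_ext => z; rewrite exprS.
Qed.

(** Smoothness of both sides is part of the relation, which makes it compatible with products and,
    at the cost of one order, with derivatives. *)
Definition cong n f g :=
  [/\ smooth_at f 0, smooth_at g 0 & flat n (fun z => f z - g z)].

Lemma flat_zero n : flat n (fun _ : V => 0 : R).
Proof.
elim: n => [|n IH]; first exact/flat0/smooth_cst.
apply/flatS; split=> [||v] //; first exact: smooth_cst.
by apply: flat_ext IH => z; rewrite derive_cst.
Qed.

Lemma cong_refl n f : smooth_at f 0 -> cong n f f.
Proof.
by move=> sf; split=> //; apply: flat_ext (flat_zero n) => z; rewrite subrr.
Qed.

Lemma cong_eq n f g : smooth_at g 0 ->
  (\forall z \near (0 : V), f z = g z) -> cong n f g.
Proof.
move=> sg fg; have gf : \forall z \near (0 : V), g z = f z.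
  by apply: filterS fg => z ->.
have [_ _ gg] := cong_refl n sg; split=> //; first exact: smooth_eq gf sg.
by apply: flat_eq gg; apply: filterS fg => z ->.
Qed.

Lemma cong_trans n g f h : cong n f g -> cong n g h -> cong n f h.
Proof.
move=> [sf sg fg] [_ sh gh]; split=> //.
by apply: flat_ext (flatD fg gh) => z; ring.
Qed.

Lemma congW m n f g : (m <= n)%N -> cong n f g -> cong m f g.
Proof. by move=> mn [sf sg /(flatW mn) fg]. Qed.

Lemma congD n f g f' g' : cong n f g -> cong n f' g' ->
  cong n (fun z => f z + f' z) (fun z => g z + g' z).
Proof.
move=> [sf sg fg] [sf' sg' fg']; split; [exact: smoothD..|].
by apply: flat_ext (flatD fg fg') => z; ring.
Qed.

Lemma congN n f g : cong n f g -> cong n (fun z => - f z) (fun z => - g z).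
Proof.
move=> [sf sg fg]; split; [exact: smoothN..|].
by apply: flat_ext (flatN fg) => z; ring.
Qed.

Lemma congB n f g f' g' : cong n f g -> cong n f' g' ->
  cong n (fun z => f z - f' z) (fun z => g z - g' z).
Proof. by move=> fg fg'; apply: congD => //; exact: congN. Qed.

Lemma congM n f g f' g' : cong n f g -> cong n f' g' ->
  cong n (fun z => f z * f' z) (fun z => g z * g' z).
Proof.
move=> [sf sg fg] [sf' sg' fg']; split; [exact: smoothM..|].
by apply: flat_ext (flatD (flatMr fg sf') (flatMl sg fg')) => z; ring.
Qed.

Lemma congX n f g k : cong n f g ->
  cong n (fun z => f z ^+ k) (fun z => g z ^+ k).
Proof.
move=> [sf sg fg]; elim: k => [|k IH]; first exact/cong_refl/smooth_cst.
rewrite (_ : (fun z => f z ^+ _) = fun z => f z * f z ^+ k); last first.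
  by apply/funext => z; rewrite exprS.
rewrite (_ : (fun z => g z ^+ k.+1) = fun z => g z * g z ^+ k); last first.
  by apply/funext => z; rewrite exprS.
exact: congM.
Qed.

Lemma cong_D n f g v : cong n.+1 f g -> cong n ('D_v f) ('D_v g).
Proof.
move=> [sf sg /(flat_D v) fg]; split; [exact: smooth_derive..|].
apply: flat_eq fg; near=> z; rewrite DB //; near: z; exact: smooth_near.
Unshelve. all: by end_near. Qed.

Lemma cong_val n f g : cong n.+1 f g -> f 0 = g 0.
Proof. by move=> [_ _ /flat_val/eqP]; rewrite subr_eq0 => /eqP. Qed.

Lemma cong_Dval n f g v : cong n.+2 f g -> 'D_v f 0 = 'D_v g 0.
Proof. by move=> /(cong_D v)/cong_val. Qed.

Lemma flat_cong n f g h : smooth_at f 0 -> flat n h ->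
  (forall z, g z = f z + h z) -> cong n g f.
Proof.
move=> sf fh gE; split=> //.
  by rewrite (funext gE); apply: smoothD => //; exact: flat_smooth fh.
by apply: flat_ext fh => z; rewrite gE; ring.
Qed.

End Flat.

(** * Fundamental forms *)

Section Forms.
Context {R : realType} {V : normedModType R}.
Local Notation R3 := 'rV[R]_3.
Implicit Types (f g h : V -> R) (x : V -> R3) (a b : V) (p : V).

(** Jacobian determinant in the directions [a] and [b]. As a derivation acting on [g] it is the
    Hamiltonian field of [f] in the plane of [a] and [b], tangent to the level sets of [f]. *)
Definition pb a b f g : V -> R :=
  fun z => 'D_a f z * 'D_b g z - 'D_b f z * 'D_a g z.

Definition formE a x z := mink ('D_a x z) ('D_a x z).
Definition formF a b x z := mink ('D_a x z) ('D_b x z).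
Definition formL a b x z := mink (mcross ('D_a x z) ('D_b x z)) ('D_a ('D_a x) z).
Definition formM a b x z := mink (mcross ('D_a x z) ('D_b x z)) ('D_b ('D_a x) z).
Definition formN a b x z := mink (mcross ('D_a x z) ('D_b x z)) ('D_b ('D_b x) z).
Definition disc a b x z := formF a b x z ^+ 2 - formE a x z * formE b x z.
Definition hbar a b x z := formL a b x z * formE b x z
  - 2 * formM a b x z * formF a b x z + formN a b x z * formE a x z.
Definition gauss a b x z := formL a b x z * formN a b x z - formM a b x z ^+ 2.

Definition tdisc a b x z :=
  (formE a x z * formN a b x z - formE b x z * formL a b x z) ^+ 2
  - 4 * (formF a b x z * formN a b x z - formE b x z * formM a b x z)
    * (formE a x z * formM a b x z - formF a b x z * formL a b x z).

Lemma tdiscE a b x z : tdisc a b x z =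
  hbar a b x z ^+ 2 + 4 * disc a b x z * gauss a b x z.
Proof.
rewrite /tdisc /hbar /disc /gauss.
move: (formE a x z) (formE b x z) (formF a b x z) => E G F.
by move: (formL a b x z) (formM a b x z) (formN a b x z) => l m n; ring.
Qed.

Lemma smooth_mink p x y : smooth_at x p -> smooth_at y p ->
  smooth_at (fun z => mink (x z) (y z)) p.
Proof.
by move=> sx sy; apply: smoothB; [apply: smoothD|]; apply: smoothM;
   exact: smooth_coord.
Qed.

Lemma mcross0 (u v : R3) : mcross u v 0 0 = u 0 1 * v 0 2 - u 0 2 * v 0 1.
Proof. by rewrite mxE. Qed.
Lemma mcross1 (u v : R3) : mcross u v 0 1 = u 0 2 * v 0 0 - u 0 0 * v 0 2.
Proof. by rewrite mxE. Qed.
Lemma mcross2 (u v : R3) : mcross u v 0 2 = u 0 1 * v 0 0 - u 0 0 * v 0 1.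
Proof. by rewrite mxE. Qed.

Lemma ord3P (P : 'I_3 -> Prop) : P 0 -> P 1 -> P 2 -> forall i, P i.
Proof.
move=> P0 P1 P2 [[|[|[|//]]] lti].
- by rewrite (_ : Ordinal _ = 0) //; exact: val_inj.
- by rewrite (_ : Ordinal _ = 1) //; exact: val_inj.
- by rewrite (_ : Ordinal _ = 2) //; exact: val_inj.
Qed.

Lemma smooth_mcross p x y : smooth_at x p -> smooth_at y p ->
  smooth_at (fun z => mcross (x z) (y z)) p.
Proof.
move=> sx sy; apply: smooth_row; apply: ord3P.
- under eq_fun do rewrite mcross0.
  by apply: smoothB; apply: smoothM; exact: smooth_coord.
- under eq_fun do rewrite mcross1.
  by apply: smoothB; apply: smoothM; exact: smooth_coord.
- under eq_fun do rewrite mcross2.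
  by apply: smoothB; apply: smoothM; exact: smooth_coord.
Qed.

Section Smooth.
Variables (a b p : V) (x : V -> R3).
Hypothesis sx : smooth_at x p.

Lemma smooth_formE : smooth_at (formE a x) p.
Proof. by apply: smooth_mink; exact: smooth_derive. Qed.
Lemma smooth_formF : smooth_at (formF a b x) p.
Proof. by apply: smooth_mink; exact: smooth_derive. Qed.
Lemma smooth_formL : smooth_at (formL a b x) p.
Proof. by apply: smooth_mink; [apply: smooth_mcross|]; do ?exact: smooth_derive; do 2 apply: smooth_derive. Qed.
Lemma smooth_formM : smooth_at (formM a b x) p.
Proof. by apply: smooth_mink; [apply: smooth_mcross|]; do ?exact: smooth_derive; do 2 apply: smooth_derive. Qed.
Lemma smooth_formN : smooth_at (formN a b x) p.
Proof. by apply: smooth_mink; [apply: smooth_mcross|]; do ?exact: smooth_derive; do 2 apply: smooth_derive. Qed.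
End Smooth.

Lemma smooth_disc a b p x : smooth_at x p -> smooth_at (disc a b x) p.
Proof.
move=> sx; apply: smoothB; first exact/smoothX/smooth_formF.
by apply: smoothM; exact: smooth_formE.
Qed.

Lemma smooth_hbar a b p x : smooth_at x p -> smooth_at (hbar a b x) p.
Proof.
move=> sx; apply: smoothD; last first.
  by apply: smoothM; [exact: smooth_formN|exact: smooth_formE].
apply: smoothB; first by apply: smoothM; [exact: smooth_formL|exact: smooth_formE].
apply: smoothM; last exact: smooth_formF.
by apply: smoothM; [exact: smooth_cst|exact: smooth_formM].
Qed.

Lemma smooth_gauss a b p x : smooth_at x p -> smooth_at (gauss a b x) p.
Proof.
move=> sx; apply: smoothB; last exact/smoothX/smooth_formM.
by apply: smoothM; [exact: smooth_formL|exact: smooth_formN].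
Qed.

Lemma smooth_pb a b f g p : smooth_at f p -> smooth_at g p ->
  smooth_at (pb a b f g) p.
Proof. by move=> sf sg; apply: smoothB; apply: smoothM; exact: smooth_derive. Qed.

Lemma near_derive1 (W : normedModType R) (f g : V -> W) p v :
  (\forall z \near p, f z = g z) -> \forall z \near p, 'D_v f z = 'D_v g z.
Proof. exact: (iterD_near [:: v]). Qed.

Lemma forms_near a b x y p : (\forall z \near p, x z = y z) ->
  \forall z \near p, [/\ disc a b x z = disc a b y z, hbar a b x z = hbar a b y z,
    gauss a b x z = gauss a b y z & tdisc a b x z = tdisc a b y z].
Proof.
move=> xy.
have da := near_derive1 a xy; have db := near_derive1 b xy.
have daa := near_derive1 a da; have dba := near_derive1 b da.
have dbb := near_derive1 b db.
apply: filterS (filterI da (filterI db (filterI daa (filterI dba dbb)))).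
move=> z [/= ea [eb [eaa [eba ebb]]]].
have eE : formE a x z = formE a y z := congr1 (fun u => mink u u) ea.
have eF : formF a b x z = formF a b y z := congr2 mink ea eb.
have eG : formE b x z = formE b y z := congr1 (fun u => mink u u) eb.
have eL : formL a b x z = formL a b y z := congr2 mink (congr2 mcross ea eb) eaa.
have eM : formM a b x z = formM a b y z := congr2 mink (congr2 mcross ea eb) eba.
have eN : formN a b x z = formN a b y z := congr2 mink (congr2 mcross ea eb) ebb.
move: eE eF eG eL eM eN; clear; rewrite /disc /hbar /gauss /tdisc.
by move=> -> -> -> -> -> ->; split; reflexivity.
Qed.

Lemma pb_near a b f f' g g' p : (\forall z \near p, f z = f' z) ->
  (\forall z \near p, g z = g' z) ->
  \forall z \near p, pb a b f g z = pb a b f' g' z.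
Proof.
move=> ff gg; have fa := near_derive1 a ff; have fb := near_derive1 b ff.
have ga := near_derive1 a gg; have gb := near_derive1 b gg.
apply: filterS (filterI (filterI fa fb) (filterI ga gb)) => z [[ea eb] [ea' eb']].
by rewrite /pb ea eb ea' eb'; clear; reflexivity.
Qed.

Lemma cong_pb a b n f f' g g' : cong n.+1 f f' -> cong n.+1 g g' ->
  cong n (pb a b f g) (pb a b f' g').
Proof. by move=> ff gg; apply: congB; apply: congM; exact: cong_D. Qed.

Definition cong3 n (x y : V -> R3) := forall i, cong n (fun z => x z 0 i) (fun z => y z 0 i).

Lemma cong_mink n x y x' y' : cong3 n x x' -> cong3 n y y' ->
  cong n (fun z => mink (x z) (y z)) (fun z => mink (x' z) (y' z)).
Proof.
by move=> xx yy; apply: congB; [apply: congD|]; apply: congM.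
Qed.

Lemma cong_mcross n (x y x' y' : V -> R3) : cong3 n x x' -> cong3 n y y' ->
  cong3 n (fun z => mcross (x z) (y z)) (fun z => mcross (x' z) (y' z)).
Proof.
have mc (u v : V -> R3) i :
    (fun z => mcross (u z) (v z) 0 i) = (fun z => [:: u z 0 1 * v z 0 2 - u z 0 2 * v z 0 1;
      u z 0 2 * v z 0 0 - u z 0 0 * v z 0 2; u z 0 1 * v z 0 0 - u z 0 0 * v z 0 1]`_i).
  by apply/funext => z; rewrite mxE.
move=> xx yy i; rewrite !mc; elim/ord3P: i => /=.
- exact: congB (congM (xx 1) (yy 2)) (congM (xx 2) (yy 1)).
- exact: congB (congM (xx 2) (yy 0)) (congM (xx 0) (yy 2)).
- exact: congB (congM (xx 1) (yy 0)) (congM (xx 0) (yy 1)).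
Qed.

End Forms.

(** * Effect on the forms of a perturbation in a constant direction *)

Section Perturbation.
Context {R : realType} {V : normedModType R}.
Local Notation R3 := 'rV[R]_3.
Implicit Types (f g h P : V -> R) (x : V -> R3) (a b : V) (p : V) (e : R3).

(** The error is the product of [f - f 0], of order 1, and [g], of order [k]. *)
Lemma cong_freeze k (f : V -> R) (g : V -> R) : smooth_at f 0 -> flat k g ->
  cong k.+1 (fun z => f z * g z) (fun z => f 0 * g z).
Proof.
move=> sf fg; have sg := flat_smooth fg.
have s0 : smooth_at (fun _ : V => f 0) 0 by exact: smooth_cst.
split; [exact: smoothM..|].
have f1 : flat 1 (fun z => f z - f 0).
  by apply: flat1; [exact: smoothB|rewrite subrr].
by apply: flat_ext (flatM f1 fg) => z; ring.
Qed.

Lemma cong_hbar k (L M N E F G K A B C : V -> R) :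
  smooth_at L 0 -> smooth_at M 0 -> smooth_at N 0 ->
  smooth_at E 0 -> smooth_at F 0 -> smooth_at G 0 -> smooth_at K 0 ->
  flat k A -> flat k B -> flat k C ->
  cong k.+1 (fun z => (L z + K z * A z) * G z - 2 * (M z + K z * B z) * F z
                      + (N z + K z * C z) * E z)
    (fun z => L z * G z - 2 * M z * F z + N z * E z
              + K 0 * (G 0 * A z - 2 * F 0 * B z + E 0 * C z)).
Proof.
move=> sL sM sN sE sF sG sK fA fB fC.
have s2 : smooth_at (fun _ : V => 2 : R) 0 by exact: smooth_cst.
have sh : smooth_at (fun z => L z * G z - 2 * M z * F z + N z * E z) 0.
  apply: smoothD; last exact: smoothM.
  by apply: smoothB; apply: smoothM => //; exact: smoothM.
have dA := cong_freeze (smoothM sK sG) fA.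
have dB := cong_freeze (smoothM s2 (smoothM sK sF)) fB.
have dC := cong_freeze (smoothM sK sE) fC.
have [s1 s3 fl] := congD (cong_refl k.+1 sh) (congD (congB dA dB) dC).
split.
- by apply: smooth_eq s1; apply: filterE => z; ring.
- by apply: smooth_eq s3; apply: filterE => z; ring.
- by apply: flat_ext fl => z; ring.
Qed.

Definition bump (W : normedModType R) (x : V -> W) P (e : W) : V -> W :=
  fun z => x z + P z *: e.

Lemma smooth_bump (W : normedModType R) (x : V -> W) P (e : W) p :
  smooth_at x p -> smooth_at P p -> smooth_at (bump x P e) p.
Proof.
by move=> sx sP; apply: smoothD => //; apply: smoothZ => //; exact: smooth_cst.
Qed.

Lemma D_bump (W : normedModType R) (x : V -> W) P (e : W) a p : smooth_at x p -> smooth_at P p ->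
  'D_a (bump x P e) p = bump ('D_a x) ('D_a P) e p.
Proof.
move=> sx sP; have sPe : smooth_at (fun z => P z *: e) p.
  by apply: smoothZ => //; exact: smooth_cst.
rewrite deriveD; [|exact: smooth_derivable..]; congr (_ + _).
have de : differentiable (fun _ : V => e) p by exact: differentiable_cst.
have [_ ->] := diff_scale (smooth_diff sP) de.
by rewrite derive_cst scaler0 add0r.
Qed.

Lemma D_bump_near (W : normedModType R) (x : V -> W) P (e : W) a p : smooth_at x p -> smooth_at P p ->
  \forall z \near p, 'D_a (bump x P e) z = bump ('D_a x) ('D_a P) e z.
Proof.
move=> sx sP; near=> z; apply: D_bump; near: z; exact: smooth_near.
Unshelve. all: by end_near. Qed.

Lemma D2_bump_near (W : normedModType R) (x : V -> W) P (e : W) a b p : smooth_at x p -> smooth_at P p ->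
  \forall z \near p,
    'D_b ('D_a (bump x P e)) z = bump ('D_b ('D_a x)) ('D_b ('D_a P)) e z.
Proof.
move=> sx sP; have := near_derive1 b (D_bump_near e a sx sP).
apply: filterS2 (D_bump_near e b (smooth_derive a sx) (smooth_derive a sP)).
by move=> z <-.
Qed.

Lemma cong3_near n x y : smooth_at y 0 ->
  (\forall z \near (0 : V), x z = y z) -> cong3 n x y.
Proof.
move=> sy xy i; apply: cong_eq; first exact: smooth_coord.
by apply: filterS xy => z ->.
Qed.

Lemma cong3_trans n (x y z : V -> R3) : cong3 n x y -> cong3 n y z -> cong3 n x z.
Proof. by move=> xy yz i; exact: cong_trans (xy i) (yz i). Qed.

Lemma cong3_bump n x P e : smooth_at x 0 -> flat n P -> cong3 n (bump x P e) x.
Proof.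
move=> sx fP i; apply: (flat_cong (h := fun z => P z * e 0 i)).
- exact: smooth_coord.
- by apply: flatMr => //; exact: smooth_cst.
- by move=> z; rewrite !mxE.
Qed.

Lemma mink_bump (c w e : R3) (r : R) : mink c (w + r *: e) = mink c w + mink c e * r.
Proof. by rewrite /mink !mxE; ring. Qed.

Variables (a b : V) (x : V -> R3) (P : V -> R) (e : R3) (k : nat).
Hypotheses (sx : smooth_at x 0) (fP : flat k.+2 P).
Let sP : smooth_at P 0 := flat_smooth fP.
Let cross z := mcross ('D_a x z) ('D_b x z).

Let cD v : cong3 k.+1 ('D_v (bump x P e)) ('D_v x).
Proof.
apply: (cong3_trans (y := bump ('D_v x) ('D_v P) e)).
  apply: cong3_near; last exact: D_bump_near.
  by apply: smooth_bump; exact: smooth_derive.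
by apply: cong3_bump; [exact: smooth_derive|exact: flat_D].
Qed.

Let cD2 n v w :
  cong3 n ('D_w ('D_v (bump x P e))) (bump ('D_w ('D_v x)) ('D_w ('D_v P)) e).
Proof.
apply: cong3_near; last exact: D2_bump_near.
by apply: smooth_bump; apply: smooth_derive; exact: smooth_derive.
Qed.

Let cform v w (y : V -> R3) : cong3 k.+1 ('D_w ('D_v (bump x P e))) y ->
  cong k.+1 (fun z => mink (mcross ('D_a (bump x P e) z) ('D_b (bump x P e) z))
                           ('D_w ('D_v (bump x P e)) z))
            (fun z => mink (cross z) (y z)).
Proof. by move=> cy; apply: cong_mink => //; apply: cong_mcross; exact: cD. Qed.

Let cform2 v w :
  cong k.+1 (fun z => mink (mcross ('D_a (bump x P e) z) ('D_b (bump x P e) z))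
                           ('D_w ('D_v (bump x P e)) z))
  (fun z => mink (cross z) ('D_w ('D_v x) z) + mink (cross z) e * 'D_w ('D_v P) z).
Proof.
apply: cong_trans (cform (@cD2 _ v w)) _.
rewrite (funext (fun z => mink_bump _ _ _ _)); apply: cong_refl.
have sc : smooth_at cross 0 by apply: smooth_mcross; exact: smooth_derive.
apply: smoothD; first by apply: smooth_mink => //; do 2 apply: smooth_derive.
apply: smoothM; last by do 2 apply: smooth_derive.
by apply: smooth_mink => //; exact: smooth_cst.
Qed.

Let cformE v : cong k.+1 (formE v (bump x P e)) (formE v x).
Proof. by apply: cong_mink; exact: cD. Qed.

Let cformF : cong k.+1 (formF a b (bump x P e)) (formF a b x).
Proof. by apply: cong_mink; exact: cD. Qed.

Lemma bump_disc : cong k.+1 (disc a b (bump x P e)) (disc a b x).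
Proof.
by apply: congB; [exact: congX cformF|apply: congM; exact: cformE].
Qed.

(** The combination l G - 2 m F + n E of [hbar], read as a second order operator whose coefficients
    E, F, G are constants. *)
Definition d2form E F G P z := G * 'D_a ('D_a P) z - 2 * F * 'D_b ('D_a P) z
  + E * 'D_b ('D_b P) z.

Let flat2 v w : flat k ('D_w ('D_v P)).
Proof. by do 2 apply: flat_D. Qed.

(** The first derivatives of [P] vanish to order [k.+1], so E, F, G and the normal [cross] are
    unchanged at the order considered. The second derivatives vanish only to order [k]; they enter
    l, m, n with the factor <cross, e>, and all their coefficients may then be frozen at 0. *)
Lemma bump_hbar : cong k.+1 (hbar a b (bump x P e)) (fun z => hbar a b x z +
  mink (cross 0) e * d2form (formE a x 0) (formF a b x 0) (formE b x 0) P z).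
Proof.
have sc : smooth_at cross 0 by apply: smooth_mcross; exact: smooth_derive.
pose K z := mink (cross z) e.
have sK : smooth_at K 0 by apply: smooth_mink => //; exact: smooth_cst.
have c1 : cong k.+1 (formL a b (bump x P e))
  (fun z => formL a b x z + K z * 'D_a ('D_a P) z) := cform2 a a.
have c2 : cong k.+1 (formM a b (bump x P e))
  (fun z => formM a b x z + K z * 'D_b ('D_a P) z) := cform2 a b.
have c3 : cong k.+1 (formN a b (bump x P e))
  (fun z => formN a b x z + K z * 'D_b ('D_b P) z) := cform2 b b.
have s2 : smooth_at (fun _ : V => 2 : R) 0 by exact: smooth_cst.
apply: cong_trans (congD (congB (congM c1 (cformE b))
  (congM (congM (cong_refl k.+1 s2) c2) cformF)) (congM c3 (cformE a))) _.
exact: (cong_hbar (smooth_formL a b sx) (smooth_formM a b sx) (smooth_formN a b sx)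
  (smooth_formE a sx) (smooth_formF a b sx) (smooth_formE b sx) sK
  (flat2 a a) (flat2 a b) (flat2 b b)).
Qed.

Lemma bump_gauss : cong k (gauss a b (bump x P e)) (gauss a b x).
Proof.
have c v w : cong k (fun z => mink (mcross ('D_a (bump x P e) z) ('D_b (bump x P e) z))
    ('D_w ('D_v (bump x P e)) z)) (fun z => mink (cross z) ('D_w ('D_v x) z)).
  apply: cong_trans (congW (leqnSn k) (cform2 v w)) _.
  have sc : smooth_at cross 0 by apply: smooth_mcross; exact: smooth_derive.
  apply: (flat_cong (h := fun z => mink (cross z) e * 'D_w ('D_v P) z)) => //.
    by apply: smooth_mink => //; do 2 apply: smooth_derive.
  by apply: flatMl (flat2 v w); apply: smooth_mink => //; exact: smooth_cst.
exact: congB (congM (c a a) (c b b)) (congX 2 (c a b)).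
Qed.

End Perturbation.

Lemma linear_pack (R : realType) (V W : normedModType R) (f : V -> W) :
  linear f -> exists g : {linear V -> W}, forall v, g v = f v.
Proof.
move=> lf; pose B := GRing.isLinear.Build R V W _ f lf.
by exists (HB.pack f B : {linear V -> W}).
Qed.

(** * The implicit function theorem *)

Section ImplicitFunction.
Context {R : realType} {W : normedModType R}.
Implicit Types (G F : W * R -> R) (Y : W -> R) (w v : W).

Lemma nbhs_box (P : set (W * R)) : nbhs (0 : W * R) P ->
  exists2 r : R, 0 < r & forall w y, `|w| < r -> `|y| < r -> P (w, y).
Proof.
case=> -[Q1 Q2] [/= /nbhs_norm0P[r1 r10 H1] /nbhs_norm0P[r2 r20 H2]] QP.
exists (Num.min r1 r2); first by rewrite lt_min r10.
by move=> w y; rewrite !lt_min => /andP[w1 _] /andP[_ y2]; apply: QP; split; [exact: H1|exact: H2].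
Qed.

Lemma near_graph (P : set (W * R)) Y w : {for w, continuous Y} ->
  nbhs (w, Y w) P -> \forall z \near w, P (z, Y z).
Proof.
move=> cY [[Q1 Q2] [/= n1 n2] QP].
by apply: filterS2 n1 (cY _ n2) => z z1 z2; apply: QP.
Qed.

Lemma diff_graph Y w : differentiable Y w ->
  differentiable (fun z => (z, Y z)) w.
Proof. by move=> dY; exact: differentiable_pair. Qed.

Lemma derive_graph F Y w v : differentiable Y w -> differentiable F (w, Y w) ->
  'D_v (fun z => F (z, Y z)) w =
  'D_(v, 0) F (w, Y w) + 'D_v Y w * 'D_(0, 1) F (w, Y w).
Proof.
move=> dY dF; have dp := diff_graph dY.
rewrite (_ : (fun z => F _) = F \o (fun z => (z, Y z))) //.
rewrite deriveE; last exact: differentiable_comp.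
have did : 'd (fun z : W => z) w v = v by rewrite diff_val.
rewrite diff_comp //= diff_pair //= !deriveE // did.
have -> : (v, 'd Y w v) = (v, 0) + 'd Y w v *: (0, 1) :> W * R.
  apply: injective_projections => /=; first by rewrite scaler0 addr0.
  by rewrite add0r [RHS]mulr1.
by rewrite linearD linearZ.
Qed.

Lemma diff_on_graph n (U : set W) (O : set (W * R)) F Y :
  open U -> open O -> (forall w, U w -> O (w, Y w)) ->
  diff_on n U Y -> diff_on n O F -> diff_on n U (fun w => F (w, Y w)).
Proof.
move=> oU oO UO; elim: n F => [|n IH] F.
  move=> /diff_on0 dY /diff_on0 dF; apply/diff_on0 => y Uy.
  apply: (@differentiable_comp _ _ _ _ (fun w => (w, Y w)) F).
    exact/diff_graph/dY.
  exact/dF/UO.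
move=> dY'; move: (dY') => /diff_onS[dY dDY] /diff_onS[dF dDF].
apply/diff_onS; split=> [y Uy|v].
  apply: (@differentiable_comp _ _ _ _ (fun w => (w, Y w)) F).
    exact/diff_graph/dY.
  exact/dF/UO.
apply: (@diff_on_eq _ _ _ _ _ ((fun w => 'D_(v, 0) F (w, Y w)) +
    (fun w => 'D_v Y w *: ('D_(0, 1) F (w, Y w) : R)))) => //.
  by move=> y Uy; rewrite derive_graph //; [exact: dY|exact/dF/UO].
apply: diff_onD => //; first by apply: IH (dDF _); exact: diff_onW.
by apply: diff_onZ => //; apply: IH (dDF _); exact: diff_onW.
Qed.

Lemma smooth_graph F Y w : smooth_at Y w -> smooth_at F (w, Y w) ->
  smooth_at (fun z => F (z, Y z)) w.
Proof.
move=> /smooth_atP[U [oU Uw] dY]; move=> /smooth_atP[Z [oZ Zw] dF].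
have cY : {for w, continuous Y}.
  by apply: differentiable_continuous; exact: (dY 0%N [::]).
have : nbhs w (U `&` [set z | Z (z, Y z)]).
  apply: filterI; first exact: open_nbhs_nbhs.
  by apply: near_graph => //; exact: open_nbhs_nbhs.
rewrite nbhsE => -[U' [oU' U'x] sU']; apply/smooth_atP; exists U' => // n.
apply: (@diff_on_graph _ _ Z) => //; first by move=> z /sU'[].
by move=> vs y sz /sU'[Uy _]; exact: dY sz Uy.
Qed.

Lemma incr_fiber G w (r : R) :
  (forall y, `|y| < r -> differentiable G (w, y) /\ 0 < 'D_(0, 1) G (w, y)) ->
  (forall y z, `|y| < r -> `|z| < r -> y < z -> G (w, y) < G (w, z)) /\
  (forall a b, `|a| < r -> `|b| < r -> {within `[a, b], continuous (fun y => G (w, y))}).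
Proof.
move=> H; have dA z : differentiable (fun y : R => (w, y)) z.
  by apply: differentiable_pair => //; exact: differentiable_cst.
have df (y : R) : `|y| < r -> is_derive y (1 : R) (fun y => G (w, y) : R) ('D_(0, 1) G (w, y)).
  move=> yr; have [dG _] := H y yr.
  have dGA : differentiable (G \o (fun y : R => (w, y))) y.
    exact: differentiable_comp.
  split; first exact: diff_derivable.
  have AL (z h : R) : (w, h *: 1 + z) = h *: (0, 1) + (w, z) :> W * R.
    by apply: injective_projections => //=; rewrite scaler0 add0r.
  exact: (congr1 (fun f => f y)
    (derive_affine G (A := fun y : R => (w, y)) (L := fun y => (0, y)) (v := 1) AL)).
have itv a b y : `|a| < r -> `|b| < r -> y \in `[a, b] -> `|y| < r.
  rewrite !ltr_norml in_itv /= => /andP[ra _] /andP[_ br] /andP[ay yb].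
  by rewrite (lt_le_trans ra ay) (le_lt_trans yb br).
have cw a b : `|a| < r -> `|b| < r -> {within `[a, b], continuous (fun y => G (w, y))}.
  move=> ar br; apply: derivable_within_continuous => y yab.
  by have [] := df y (itv _ _ _ ar br yab).
split=> // y z yr zr yz.
have [c cyz E] : exists2 c, c \in `]y, z[%R &
    G (w, z) - G (w, y) = 'D_(0, 1) G (w, c) * (z - y).
  apply: (@MVT _ (fun y => G (w, y)) (fun c => 'D_(0, 1) G (w, c))) => //.
    move=> c cyz; apply: df; apply: itv yr zr _.
    by move: cyz; rewrite !in_itv /= => /andP[/ltW-> /ltW->].
  exact: cw.
rewrite -subr_gt0 E mulr_gt0 ?subr_gt0 //.
have [] // := H c; apply: itv yr zr _.
by move: cyz; rewrite !in_itv /= => /andP[/ltW-> /ltW->].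
Qed.

(** On each fibre [G] is strictly increasing in [y], and the change of sign between [- c] and [c]
    persists for [w] near 0; this gives exactly one zero, without any contraction argument. *)
Lemma implicit_continuous G (r : R) : 0 < r -> G 0 = 0 ->
  (forall w y, `|w| < r -> `|y| < r ->
    differentiable G (w, y) /\ 0 < 'D_(0, 1) G (w, y)) ->
  exists Y r1, [/\ 0 < r1, r1 <= r, Y 0 = 0 &
    forall w, `|w| < r1 -> [/\ `|Y w| < r, {for w, continuous Y}
      & forall y, `|y| < r -> G (w, y) = 0 <-> y = Y w]].
Proof.
move=> r0 G0 H.
have inc w (wr : `|w| < r) := incr_fiber (fun y => H w y wr).
have cG w y (wr : `|w| < r) (yr : `|y| < r) : {for w, continuous (fun z => G (z, y))}.
  apply: differentiable_continuous.
  apply: (@differentiable_comp _ _ _ _ (fun z => (z, y)) G).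
    by apply: differentiable_pair => //; exact: differentiable_cst.
  by have [] := H w y wr yr.
have nG (b : bool) w y : `|w| < r -> `|y| < r -> 0 < (-1) ^+ b * G (w, y) ->
    \forall z \near w, 0 < (-1) ^+ b * G (z, y).
  move=> wr yr; case: b => /=; rewrite ?expr1 ?expr0 ?mul1r ?mulN1r ?oppr_gt0 => Gp.
    apply: filterS (cvgr_lt _ (cG w y wr yr) 0 Gp) => z /=.
    by rewrite mulN1r oppr_gt0.
  by apply: filterS (cvgr_gt _ (cG w y wr yr) 0 Gp) => z /=; rewrite mul1r.
have nr : `|0 : W| < r by rewrite normr0.
have [inc0 _] := inc 0 nr.
pose c := r / 2; have c0 : 0 < c by rewrite divr_gt0.
have cr : c < r by rewrite /c ltr_pdivrMr // mulr_natr mulr2n ltrDl.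
have ncr : `|c| < r by rewrite gtr0_norm.
have nNcr : `|- c| < r by rewrite normrN.
have Gc : 0 < (-1) ^+ false * G (0, c).
  by rewrite mul1r -G0; apply: inc0; rewrite ?normr0.
have GNc : 0 < (-1) ^+ true * G (0, - c).
  by rewrite mulN1r oppr_gt0 -G0; apply: inc0; rewrite ?normr0 ?oppr_lt0.
have : \forall z \near (0 : W),
    0 < (-1) ^+ false * G (z, c) /\ 0 < (-1) ^+ true * G (z, - c).
  by apply: filterI; exact: nG.
move=> /nbhs_norm0P[r2 /= r20 Hr2].
pose r1 := Num.min r r2.
pose Y w := xget 0 [set y | `|y| < r /\ G (w, y) = 0].
have YP w : `|w| < r1 -> `|Y w| < r /\ G (w, Y w) = 0.
  rewrite lt_min => /andP[wr wr2]; have [incw cw] := inc w wr.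
  have [/=] := Hr2 w wr2; rewrite mul1r expr1 mulN1r oppr_gt0 => Gwc GwNc.
  have [|||y yc Gy] := @IVT R (fun y => G (w, y)) (- c) c 0.
  - by rewrite ge0_cp // ltW.
  - exact: cw.
  - by rewrite ge_min le_max (ltW Gwc) (ltW GwNc) orbT.
  have yr : `|y| < r.
    apply: le_lt_trans ncr; rewrite (gtr0_norm c0) ler_norml.
    by move: yc; rewrite in_itv.
  by apply: (@xgetPex _ 0 [set y | `|y| < r /\ G (w, y) = 0]); exists y.
have r1r : r1 <= r by rewrite ge_min lexx.
have Yu w y : `|w| < r1 -> `|y| < r -> G (w, y) = 0 <-> y = Y w.
  move=> wr1 yr; have [Yr GY] := YP w wr1; split=> [Gy|-> //].
  have [incw _] := inc w (lt_le_trans wr1 r1r).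
  case: (ltgtP y (Y w)) => // yY.
    by have := incw _ _ yr Yr yY; rewrite Gy GY ltxx.
  by have := incw _ _ Yr yr yY; rewrite Gy GY ltxx.
have r10 : 0 < r1 by rewrite lt_min r0.
exists Y, r1; split=> //.
  by apply/esym; apply/Yu; rewrite ?normr0.
move=> w wr1; have [Yr GY] := YP w wr1; split=> //; last by move=> y; exact: Yu.
have wr := lt_le_trans wr1 r1r; have [incw _] := inc w wr.
apply/cvgrPdist_lt => e e0.
(* Continuity at [w]: [G] is negative at [Y w - d] and positive at [Y w + d], which persists for [z]
   near [w] and traps [Y z] in between. The second bound on [d] keeps both points in the domain. *)
pose d := Num.min (e / 2) ((r - `|Y w|) / 2).
have d0 : 0 < d by rewrite lt_min !divr_gt0 // subr_gt0.
have de : d < e.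
  by rewrite gt_min ltr_pdivrMr // mulr_natr mulr2n ltrDl e0.
have dr : `|Y w| + d < r.
  rewrite -ltrBrDl gt_min; apply/orP; right.
  by rewrite ltr_pdivrMr // mulr_natr mulr2n ltrDl subr_gt0.
have Ydr : `|Y w + d| < r by apply: le_lt_trans dr; rewrite (le_trans (ler_normD _ _)) // (gtr0_norm d0).
have YNdr : `|Y w - d| < r by apply: le_lt_trans dr; rewrite (le_trans (ler_normB _ _)) // (gtr0_norm d0).
have G1 : 0 < (-1) ^+ false * G (w, Y w + d).
  by rewrite mul1r -GY; apply: incw => //; rewrite ltrDl.
have G2 : 0 < (-1) ^+ true * G (w, Y w - d).
  by rewrite mulN1r oppr_gt0 -GY; apply: incw => //; rewrite ltrBlDr ltrDl.
have nw : \forall z \near w, `|z| < r1.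
  exact: (cvgr_lt _ (@norm_continuous _ W w) r1 wr1).
apply: filterS (filterI nw (filterI (nG _ _ _ wr Ydr G1) (nG _ _ _ wr YNdr G2))).
move=> z [zr1 [/=]]; rewrite mul1r expr1 mulN1r oppr_gt0 => Gz1 Gz2.
have [Yzr GYz] := YP z zr1; have [incz _] := inc z (lt_le_trans zr1 r1r).
apply: lt_trans de; rewrite distrC ltr_distl; apply/andP; split.
  rewrite ltNge; apply/negP => YzY.
  have : G (z, Y z) <= G (z, Y w - d).
    move: YzY; rewrite le_eqVlt => /orP[/eqP->|yy]; first exact: lexx.
    exact: ltW (incz _ _ Yzr YNdr yy).
  by rewrite GYz leNgt Gz2.
rewrite ltNge; apply/negP => YzY.
have : G (z, Y w + d) <= G (z, Y z).
  move: YzY; rewrite le_eqVlt => /orP[/eqP->|yy]; first exact: lexx.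
  exact: ltW (incz _ _ Ydr Yzr yy).
by rewrite GYz leNgt Gz1.
Qed.

Lemma implicit_diff G Y w : {for w, continuous Y} ->
  (\forall z \near w, G (z, Y z) = 0) -> differentiable G (w, Y w) ->
  'D_(0, 1) G (w, Y w) != 0 -> differentiable Y w /\
  forall v, 'D_v Y w = - 'D_(v, 0) G (w, Y w) / 'D_(0, 1) G (w, Y w).
Proof.
move=> cY GY dG D0; set p := (w, Y w); set d := 'D_(0, 1) G p in D0 *.
pose L : W -> R := fun v => - d^-1 * 'd G p (v, 0).
have Llin : linear L.
  move=> k u v; rewrite /L.
  have -> : (k *: u + v, 0) = k *: (u, 0) + (v, 0) :> W * R.
    by apply: injective_projections => //=; rewrite scaler0 addr0.
  by rewrite linearP /= /GRing.scale /=; ring.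
have [LL LLE] := linear_pack Llin.
have cdG : continuous ('d G p) by exact: diff_continuous.
have [M M0 HM] := linear_lipschitz cdG.
have cL : continuous LL.
  move=> v; apply/cvgrPdist_lt => e e0.
  have c0 : 0 < `|d^-1| * M by rewrite mulr_gt0 // normr_gt0 invr_eq0.
  have : \forall z \near v, `|v - z| < e / (`|d^-1| * M).
    by apply: cvgr_dist_lt; [exact: cvg_id|rewrite divr_gt0].
  apply: filterS => z; rewrite ltr_pdivlMr // => vz.
  rewrite -linearB LLE /L normrM normrN; apply: le_lt_trans vz.
  rewrite [X in _ <= X]mulrC -mulrA ler_wpM2l //.
  apply: le_trans (HM _) _; rewrite prod_normE /= normr0 ler_wpM2l ?(ltW M0) //.
  by rewrite ge_max lexx normr_ge0.
have [_ dGo] := (@diff_locallyP _ _ _ p G).1 dG.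
have main : Y \o shift w = cst (Y w) + LL +o_ 0 id.
  apply/eqaddoP => e e0.
  pose C := `|d^-1| * M; have C0 : 0 < C by rewrite mulr_gt0 // normr_gt0 invr_eq0.
  (* The bound 1 / 2 serves to absorb: [|K h| <= (|h| + |K h|) / 2 + C * |h|] yields
     [|K h| <= (2 * C + 1) * |h|]. The other bound then brings the error below [e * |h|]. *)
  pose eta := Num.min (1 / 2) (e / (2 * C + 1)).
  have C1 : 0 < 2 * C + 1 by rewrite addr_gt0 // mulr_gt0.
  have eta0 : 0 < eta by rewrite lt_min !divr_gt0.
  have etae : eta * (2 * C + 1) <= e by rewrite -ler_pdivlMr // ge_min lexx orbT.
  have eta2 : eta <= 1 / 2 by rewrite ge_min lexx.
  have ed : 0 < eta * `|d| by rewrite mulr_gt0 // normr_gt0.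
  move/eqaddoP: dGo => /(_ _ ed) nG.
  pose K h := Y (h + w) - Y w.
  have cK : {for 0, continuous K}.
    apply: continuousB; last exact: cst_continuous.
    apply: continuous_comp; last by rewrite add0r.
    by apply: continuousD; [exact: cvg_id|exact: cst_continuous].
  have K0 : K 0 = 0 by rewrite /K add0r subrr.
  have nG' : \forall h \near (0 : W),
      `|(G \o shift p - (cst (G p) + 'd G p)) (h, K h)| <= eta * `|d| * `|(h, K h)|.
    have nG0 : nbhs (0, K 0) [set q : W * R |
        `|(G \o shift p - (cst (G p) + 'd G p)) q| <= eta * `|d| * `|q|].
      by rewrite K0; exact: nG.
    exact: (near_graph cK nG0).
  have nY : \forall h \near (0 : W), G (h + w, Y (h + w)) = 0.
    have cs : {for 0, continuous (fun h => h + w)}.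
      by apply: continuousD; [exact: cvg_id|exact: cst_continuous].
    have GY0 : nbhs (0 + w) [set z | G (z, Y z) = 0] by rewrite add0r.
    exact: (cs _ GY0).
  apply: filterS2 nG' nY => h.
  have Gp : G p = 0 by exact: nbhs_singleton GY.
  have -> : (G \o shift p - (cst (G p) + 'd G p)) (h, K h) =
      G (h + w, Y (h + w)) - 'd G p (h, K h).
    by rewrite !fctE /= Gp add0r /K; congr (G (_, _) - _); rewrite /= subrK.
  move=> H E; move: H; rewrite E sub0r normrN.
  have -> : 'd G p (h, K h) = d * (K h - LL h).
    have -> : (h, K h) = (h, 0) + K h *: (0, 1) :> W * R.
      apply: injective_projections => /=; first by rewrite scaler0 addr0.
      by rewrite add0r [RHS]mulr1.
    have dd : 'd G p (0, 1) = d by rewrite /d deriveE.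
    rewrite LLE linearD linearZ /= dd /L; move: ('d G p (h, 0)) => a.
    by rewrite /GRing.scale /= mulrBr mulrA mulrN mulfV //; ring.
  rewrite normrM mulrAC [X in _ <= X]mulrC ler_pM2l ?normr_gt0 // prod_normE /=.
  rewrite !fctE /= opprD addrA -/(K h).
  set u := K h - LL h => Hu.
  have Lh : `|LL h| <= C * `|h|.
    rewrite LLE /L normrM normrN /C -mulrA ler_wpM2l //.
    apply: le_trans (HM _) _; rewrite prod_normE /= normr0 ler_wpM2l ?(ltW M0) //.
    by rewrite ge_max lexx normr_ge0.
  have Ku : `|K h| <= `|u| + `|LL h| by rewrite -{1}(subrK (LL h) (K h)) ler_normD.
  have h0 := normr_ge0 h; have K0' := normr_ge0 (K h); have u0 := normr_ge0 u.
  have m1 : Num.max `|h| `|K h| <= (2 * C + 1) * `|h|.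
    rewrite ge_max; apply/andP; split.
      by rewrite mulrDl mul1r ler_wpDl // mulr_ge0 // mulr_ge0 // ltW.
    have : Num.max `|h| `|K h| <= `|h| + `|K h| by rewrite ge_max; lra.
    have : 0 <= Num.max `|h| `|K h| by rewrite le_max h0.
    by move: (Num.max _ _) Hu => m Hu m0 mh; nra.
  by apply: (le_trans Hu); apply: le_trans (_ : eta * ((2 * C + 1) * `|h|) <= _);
     [rewrite ler_wpM2l // ltW|rewrite mulrA ler_wpM2r].
have dE := diff_unique cL main.
have dY : differentiable Y w by apply/diff_locallyP; rewrite dE.
split=> // v; rewrite deriveE // dE LLE /L -deriveE //.
by rewrite mulNr mulrC mulNr.
Qed.

Lemma implicit_function_pos G : smooth_at G 0 -> G 0 = 0 -> 0 < 'D_(0, 1) G 0 ->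
  exists Y, [/\ Y 0 = 0, smooth_at Y 0,
    \forall p \near (0 : W * R), G p = 0 <-> p.2 = Y p.1 &
    \forall w \near (0 : W), forall v,
      'D_v Y w = - 'D_(v, 0) G (w, Y w) / 'D_(0, 1) G (w, Y w)].
Proof.
move=> sG G0 D0; pose g := 'D_(0, 1) G.
have cg : {for 0, continuous g} by exact/smooth_at_continuous/smooth_derive.
have n0 : \forall p \near (0 : W * R), smooth_at G p /\ 0 < g p.
  by apply: filterS2 (smooth_near sG) (cvgr_gt _ cg 0 D0).
have [r r0 Hr] := nbhs_box n0.
have H w y : `|w| < r -> `|y| < r ->
    differentiable G (w, y) /\ 0 < 'D_(0, 1) G (w, y).
  by move=> wr yr; have [sGp gp] := Hr w y wr yr; split=> //; exact: smooth_diff.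
have [Y [r1 [r10 r1r Y0 HY]]] := implicit_continuous r0 G0 H.
pose U := [set w : W | `|w| < r1].
have oU : open U.
  rewrite /U (_ : mkset _ = (@Num.norm _ W) @^-1` [set y | y < r1]) //.
  by apply: open_comp => [w _|]; [exact: norm_continuous|exact: open_lt].
have nU w : U w -> nbhs w U by move=> Uw; exact: open_nbhs_nbhs.
have YZ w : U w -> [/\ smooth_at G (w, Y w), 0 < g (w, Y w) & {for w, continuous Y}].
  move=> Uw; have [Yr cY _] := HY w Uw.
  by have [] := Hr w (Y w) (lt_le_trans Uw r1r) Yr.
have GY w : U w -> G (w, Y w) = 0.
  by move=> Uw; have [Yr _ Yu] := HY w Uw; apply/(Yu _ Yr).
have dY w : U w -> differentiable Y w /\
    forall v, 'D_v Y w = - 'D_(v, 0) G (w, Y w) / g (w, Y w).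
  move=> Uw; have [sGw gw cY] := YZ w Uw.
  apply: implicit_diff => //; [|exact: smooth_diff|by rewrite gt_eqF].
  by apply: filterS (nU _ Uw); exact: GY.
have sY : smooth_at Y 0.
  pose B := [set p : W * R | smooth_at G p /\ 0 < g p].
  pose O := B°; have oO : open O by exact: open_interior.
  have dG n : diff_on n O G.
    by move=> vs y _ /interior_subset[+ _] => /nbhs_singleton; exact.
  have UO w : U w -> O (w, Y w).
    move=> Uw; have [sGw gw _] := YZ w Uw.
    have cgw : {for (w, Y w), continuous g}.
      exact/smooth_at_continuous/smooth_derive.
    by apply: filterS2 (smooth_near sGw) (cvgr_gt _ cgw 0 gw).
  apply/smooth_atP; exists U; first by split=> //; rewrite /U /= normr0.
  (* Bootstrap: the derivative of [Y] is a quotient of derivatives of [G] taken along the graph of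
     [Y], hence it is as often differentiable as [Y] is already known to be. *)
  elim=> [|n IH]; first by apply/diff_on0 => y /dY[].
  apply/diff_onS; split=> [y /dY[]//|v].
  apply: (@diff_on_eq _ _ _ _ _ (fun w => - 'D_(v, 0) G (w, Y w) / g (w, Y w))) => //.
    by move=> y /dY[_ ->].
  apply: (@diff_on_graph n U O (fun p => - 'D_(v, 0) G p / g p) Y) => //.
  have dD u : diff_on n O ('D_u G) by have /diff_onS[_] := dG n.+1.
  apply: (@diff_on_eq _ _ _ _ _ (fun p => - 1 *: ('D_(v, 0) G p : R) *: ((g p)^-1 : R))) => //.
    by move=> p _; rewrite /GRing.scale /= mulN1r.
  apply: diff_onZ => //; last first.
    apply: diff_onV; [exact: oO| |exact: dD].
    by move=> p /interior_subset[_ gp]; rewrite gt_eqF.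
  by apply: diff_onZ => //; exact: diff_on_cst.
have U0 : U 0 by rewrite /U /= normr0.
exists Y; split=> //.
- apply/nbhs_ballP; exists r1 => //= -[w y] [/= bw byy].
  move: bw byy; rewrite -!ball_normE /= !sub0r !normrN => bw byy.
  by have [_ _] := HY w bw; apply; exact: lt_le_trans byy r1r.
- by apply: filterS (nU _ U0) => w /dY[].
Qed.

Lemma implicit_function G : smooth_at G 0 -> G 0 = 0 -> 'D_(0, 1) G 0 != 0 ->
  exists Y, [/\ Y 0 = 0, smooth_at Y 0,
    \forall p \near (0 : W * R), G p = 0 <-> p.2 = Y p.1 &
    \forall w \near (0 : W), forall v,
      'D_v Y w = - 'D_(v, 0) G (w, Y w) / 'D_(0, 1) G (w, Y w)].
Proof.
move=> sG G0; rewrite neq_lt => /orP[D0|]; last exact: implicit_function_pos.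
have sNG : smooth_at (fun p => - G p) 0 by exact: smoothN.
have DG u : \forall p \near (0 : W * R), 'D_u (fun p => - G p) p = - 'D_u G p.
  by apply: filterS (smooth_near sG) => p; exact: DN.
have [||Y [Y0 sY nY DY]] := implicit_function_pos sNG.
- by rewrite G0 oppr0.
- by rewrite (nbhs_singleton (DG _)) oppr_gt0.
exists Y; split=> //.
  by apply: filterS nY => p <-; split=> [->|/eqP]; rewrite ?oppr0 // oppr_eq0 => /eqP.
have cY := smooth_at_continuous sY.
have nD : \forall w \near (0 : W), smooth_at G (w, Y w).
  have nG0 : nbhs (0, Y 0) [set p | smooth_at G p] by rewrite Y0; exact: smooth_near sG.
  exact: (near_graph cY nG0).
apply: filterS2 DY nD => w DY sGw v.
by rewrite DY !DN // opprK invrN mulrN mulNr.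
Qed.

End ImplicitFunction.

(** * Contact of plane curves *)

Section Line.
Context {R : realType}.
Implicit Types (f g h : R -> R).

Lemma derive1n_iterD (V : normedModType R) (f : R -> V) n :
  derive1n n f = iterD (nseq n (1 : R)) f.
Proof.
elim: n => [//|n IH]; apply/funext => s.
by rewrite derive1nS derive1E IH.
Qed.

(** On the line ['D_v] is [v] times ['D_1], so derivatives in arbitrary directions reduce to the
    iterated derivatives that define the order of contact. *)
Lemma flat_derive1n f n : smooth_at f 0 ->
  flat n f <-> forall j, (j < n)%N -> derive1n j f 0 = 0.
Proof.
move=> sf; split=> [[_ ff] j jn|ff].
  by rewrite derive1n_iterD; apply: ff; rewrite size_nseq.
elim: n f sf ff => [|n IH] f sf ff; first exact: flat0.
apply/flatS; split=> // [|v]; first exact: (ff 0%N).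
have fD : flat n ('D_1 f).
  apply: IH => [|j jn]; first exact: smooth_derive.
  rewrite derive1n_iterD -iterD_rcons.
  have <- : nseq j.+1 (1 : R) = rcons (nseq j 1) 1 by elim: (j) => //= m <-.
  by rewrite -derive1n_iterD; exact: ff.
have sv : smooth_at (fun _ : R => v) 0 by exact: smooth_cst.
apply: flat_eq (flatMl sv fD); apply: filterS (smooth_near sf) => s sfs.
rewrite !deriveE; [|exact: smooth_diff..].
by rewrite -{2}[v]mulr1 [X in _ = 'd f s X]/(v *: 1) linearZ.
Qed.

Lemma near_sign f : smooth_at f 0 -> f 0 = 0 -> 0 < 'D_1 f 0 ->
  \forall s \near (0 : R), s != 0 -> 0 < s * f s.
Proof.
move=> sf f0 df; have df0 : derivable f 0 (1 : R) by exact: smooth_derivable.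
have n1 : \forall s \near (0 : R)^', 0 < s^-1 *: ((f \o shift 0) (s *: 1) - f 0).
  exact: (cvgr_gt _ df0 0 df).
have {}n1 : \forall s \near (0 : R), s != 0 ->
    0 < s^-1 *: ((f \o shift 0) (s *: 1) - f 0).
  by move: n1; rewrite near_withinE.
apply: filterS n1 => s /= H s0.
have := H s0; rewrite f0 addr0 subr0 => Hs.
have -> : s * f s = s ^+ 2 * (s^-1 *: f (s *: 1)).
  by rewrite /GRing.scale /= mulr1; field.
by rewrite mulr_gt0 // exprn_even_gt0.
Qed.

Lemma near_bowl f : smooth_at f 0 -> f 0 = 0 -> 'D_1 f 0 = 0 ->
  0 < 'D_1 ('D_1 f) 0 -> \forall s \near (0 : R), s != 0 -> 0 < f s.
Proof.
move=> sf f0 f1 f2; have sDf := smooth_derive (1 : R) sf.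
have n1 : \forall s \near (0 : R), smooth_at f s /\ (s != 0 -> 0 < s * 'D_1 f s).
  by apply: filterS2 (smooth_near sf) (near_sign sDf f1 f2).
move/nbhs_norm0P: n1 => [r /= r0 Hr].
apply/nbhs_norm0P; exists r => //= s sr s0.
have dr (c : R) : `|c| <= `|s| -> is_derive c (1 : R) f ('D_1 f c).
  move=> cs; apply: DeriveDef => //; apply: smooth_derivable.
  by have [] := Hr c (le_lt_trans cs sr).
have cw (a b : R) : (forall c, a <= c <= b -> `|c| <= `|s|) -> {within `[a, b], continuous f}.
  move=> H; apply: derivable_within_continuous => c; rewrite in_itv /= => /H/dr [] //.
case: (ltgtP s 0) s0 => // ss _.
- have cs c : s <= c <= 0 -> `|c| <= `|s|.
    by case/andP=> sc c0; rewrite !ler0_norm ?lerN2 // ltW.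
  have [||c /[!in_itv]/= /andP[sc c0] E] := @MVT _ f ('D_1 f) s 0 ss.
  + by move=> x /[!in_itv]/= /andP[sx x0]; apply/dr/cs; rewrite !ltW.
  + exact: cw.
  have cc : s <= c <= 0 by rewrite !ltW.
  have [_ dc] := Hr c (le_lt_trans (cs c cc) sr).
  have := dc (ltr0_neq0 c0); rewrite nmulr_rgt0 // => dc0.
  by move: E; rewrite f0 !sub0r => E; nra.
- have cs c : 0 <= c <= s -> `|c| <= `|s|.
    by case/andP=> c0 sc; rewrite !ger0_norm // ltW.
  have [||c /[!in_itv]/= /andP[c0 sc] E] := @MVT _ f ('D_1 f) 0 s ss.
  + by move=> x /[!in_itv]/= /andP[sx x0]; apply/dr/cs; rewrite !ltW.
  + exact: cw.
  have cc : 0 <= c <= s by rewrite !ltW.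
  have [_ dc] := Hr c (le_lt_trans (cs c cc) sr).
  have := dc (lt0r_neq0 c0); rewrite pmulr_rgt0 // => dc0.
  by move: E; rewrite f0 !subr0 => ->; rewrite mulr_gt0.
Qed.

End Line.

Section Plane.
Context {R : realType}.
Local Notation R2 := 'rV[R]_2.
Implicit Types (f g h : R2 -> R) (q u v : R2) (gamma : R -> R2).

Lemma ord2P (P : 'I_2 -> Prop) : P 0 -> P 1 -> forall i, P i.
Proof.
move=> P0 P1 [[|[|//]] lti].
- by rewrite (_ : Ordinal _ = 0) //; exact: val_inj.
- by rewrite (_ : Ordinal _ = 1) //; exact: val_inj.
Qed.

Lemma eu_0 : eu 0 0 = 1 :> R. Proof. by rewrite mxE. Qed.
Lemma eu_1 : eu 0 1 = 0 :> R. Proof. by rewrite mxE. Qed.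
Lemma ev_0 : ev 0 0 = 0 :> R. Proof. by rewrite mxE. Qed.
Lemma ev_1 : ev 0 1 = 1 :> R. Proof. by rewrite mxE. Qed.
Definition euvE := (eu_0, eu_1, ev_0, ev_1).

Lemma row2E u : u = u 0 0 *: eu + u 0 1 *: ev.
Proof.
by apply/rowP; apply: ord2P; rewrite !mxE /= ?mulr1 ?mulr0 ?addr0 ?add0r.
Qed.

Lemma derive_row2 (W : normedModType R) (f : R2 -> W) q v : differentiable f q ->
  'D_v f q = v 0 0 *: 'D_eu f q + v 0 1 *: 'D_ev f q.
Proof. by move=> df; rewrite !deriveE // {1}(row2E v) linearD !linearZ. Qed.

Lemma regularP f q : differentiable f q ->
  regular_at f q <-> ~ ('D_eu f q = 0 /\ 'D_ev f q = 0).
Proof.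
move=> df; split=> [[v]|H].
  rewrite -deriveE // derive_row2 // => + [eu_0' ev_0'].
  by rewrite eu_0' ev_0' !scaler0 addr0 eqxx.
have [E|E] := eqVneq ('D_eu f q) 0; last by exists eu; rewrite -deriveE.
have [F|F] := eqVneq ('D_ev f q) 0; last by exists ev; rewrite -deriveE.
by case: H.
Qed.

Definition grad2 f q := 'D_eu f q ^+ 2 + 'D_ev f q ^+ 2.

Lemma grad2_gt0 f q : smooth_at f q -> regular_at f q -> 0 < grad2 f q.
Proof.
move=> /smooth_diff df /(regularP df) H; rewrite lt0r addr_ge0 ?sqr_ge0 // andbT.
apply/negP; rewrite paddr_eq0 ?sqr_ge0 // !sqrf_eq0 => /andP[/eqP a /eqP b].
exact: H.
Qed.

Lemma derive_curve (f : R2 -> R) gamma s : smooth_at f (gamma s) ->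
  smooth_at gamma s -> 'D_1 (f \o gamma) s =
  'D_1 gamma s 0 0 * 'D_eu f (gamma s) + 'D_1 gamma s 0 1 * 'D_ev f (gamma s).
Proof.
move=> /smooth_diff df /smooth_diff dg.
rewrite deriveE; last exact: differentiable_comp.
by rewrite diff_comp //= -(deriveE _ dg) -deriveE // derive_row2.
Qed.

(* Along the zero set of g, the derivation f |-> pb g f is a multiple of the
   derivation along any parametrization. *)
Lemma param_pb g q gamma : smooth_at g q -> regular_at g q ->
  regular_param g q gamma -> exists2 k : R -> R, smooth_at k 0 /\ k 0 != 0 &
  forall f, smooth_at f q -> \forall s \near (0 : R),
    'D_1 (f \o gamma) s = k s * pb eu ev g f (gamma s).
Proof.
move=> sg rg [sgam gam0 dgam gz].
have g2 := grad2_gt0 sg rg.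
have sgu : smooth_at ('D_eu g \o gamma) 0.
  by apply: smooth_at_comp => //; rewrite gam0; exact: smooth_derive.
have sgv : smooth_at ('D_ev g \o gamma) 0.
  by apply: smooth_at_comp => //; rewrite gam0; exact: smooth_derive.
have s0 i : smooth_at (fun s => 'D_1 gamma s 0 i) 0.
  by apply: smooth_coord; exact: smooth_derive.
pose N s := grad2 g (gamma s).
have sN : smooth_at N 0 by exact: (smoothD (smoothX 2 sgu) (smoothX 2 sgv)).
have N0 : N 0 != 0 by rewrite /N gam0 gt_eqF.
(* The velocity is orthogonal to the gradient of [g], hence equals [k] times the gradient turned by
   a right angle; [k] is the corresponding orthogonal projection. *)
pose k s := ('D_1 gamma s 0 1 * 'D_eu g (gamma s) -
  'D_1 gamma s 0 0 * 'D_ev g (gamma s)) * (N s)^-1.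
have sk : smooth_at k 0.
  apply: smoothM; last exact: smoothV.
  exact: (smoothB (smoothM (s0 1) sgu) (smoothM (s0 0) sgv)).
have near_sm f : smooth_at f q -> \forall s \near (0 : R), smooth_at f (gamma s).
  move=> sf; apply: (smooth_at_continuous sgam).
  by rewrite gam0; exact: smooth_near sf.
have gE : \forall s \near (0 : R), [/\ 'D_1 gamma s 0 0 = - (k s * 'D_ev g (gamma s)),
   'D_1 gamma s 0 1 = k s * 'D_eu g (gamma s) & True].
  have Ng : \forall s \near (0 : R), N s != 0.
    have cN := smooth_at_continuous sN.
    have n0 : nbhs (N 0) [set r : R | r != 0].
      by apply: open_nbhs_nbhs; split=> //; exact: open_neq.
    exact: (cN _ n0).
  have dz : \forall s \near (0 : R), 'D_1 (g \o gamma) s = 0.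
    have gz' : \forall s \near (0 : R), (g \o gamma) s = cst 0 s by apply: filterS gz.
    by apply: filterS (near_derive1 (1 : R) gz') => s ->; rewrite derive_cst.
  apply: filterS (filterI Ng (filterI dz (filterI (near_sm _ sg) (smooth_near sgam)))).
  move=> s [Ns [+ [sgs sgams]]]; rewrite derive_curve //.
  rewrite /k; move: Ns; rewrite /N /grad2.
  move: ('D_1 gamma s 0 0) ('D_1 gamma s 0 1) => a b.
  move: ('D_eu g (gamma s)) ('D_ev g (gamma s)) => A B Ns E; split=> //.
  - rewrite -[LHS](mulfK Ns).
    have -> : a * (A ^+ 2 + B ^+ 2) = A * (a * A + b * B) + B * (a * B - b * A) by ring.
    by rewrite E mulr0 add0r; move: (_^-1) => I; ring.
  - rewrite -[LHS](mulfK Ns).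
    have -> : b * (A ^+ 2 + B ^+ 2) = B * (a * A + b * B) + A * (b * A - a * B) by ring.
    by rewrite E mulr0 add0r; move: (_^-1) => I; ring.
exists k; last first.
  move=> f sf; apply: filterS (filterI gE (filterI (near_sm _ sf) (smooth_near sgam))).
  move=> s [[a b _] [sfs sgams]]; rewrite derive_curve // a b /pb.
  move: ('D_eu f (gamma s)) ('D_ev f (gamma s)) ('D_eu g (gamma s)) ('D_ev g (gamma s)) (k s).
  by move=> A B C D E; ring.
split=> //; apply/eqP => k0; move/eqP: dgam; apply.
have [a b _] := nbhs_singleton gE.
by rewrite (row2E ('D_1 gamma 0)) a b k0 !mul0r oppr0 !scale0r addr0.
Qed.

End Plane.

Section Projections.
Context {R : realType} {V W : normedModType R}.

Lemma diff_fst (z : V * W) : differentiable fst z.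
Proof.
have lf : linear (fst : V * W -> V) by [].
have [g gE] := linear_pack lf.
have <- : g = fst :> (V * W -> V) by apply/funext.
by apply: linear_differentiable; rewrite (funext gE) => u; exact: cvg_fst.
Qed.

Lemma diff_snd (z : V * W) : differentiable snd z.
Proof.
have lf : linear (snd : V * W -> W) by [].
have [g gE] := linear_pack lf.
have <- : g = snd :> (V * W -> W) by apply/funext.
by apply: linear_differentiable; rewrite (funext gE) => u; exact: cvg_snd.
Qed.

End Projections.

Section Curves.
Context {R : realType}.
Local Notation R2 := 'rV[R]_2.
Implicit Types (f g h : R2 -> R) (q u v : R2) (gamma : R -> R2).

Lemma affine_comb (W : normedModType R) (q tau n : W) (v z : R * R) (h : R) :
  q + ((h *: v + z).1 *: tau + (h *: v + z).2 *: n) =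
  h *: (v.1 *: tau + v.2 *: n) + (q + (z.1 *: tau + z.2 *: n)).
Proof.
case: v z => [a b] [c e] /=.
rewrite -[h *: a]/(h * a) -[h *: b]/(h * b) !scalerDl scalerDr !scalerA.
by rewrite addrACA [RHS]addrCA.
Qed.

(** The first derivative along [gamma] is [k * pb g f]. When it is differentiated again at a zero of
    [pb g f], the term with the derivative of [k] drops out. *)
Lemma param_order g f q gamma : smooth_at g q -> regular_at g q ->
  smooth_at f q -> regular_param g q gamma ->
  exists2 k : R, k != 0 & [/\ smooth_at (f \o gamma) 0, (f \o gamma) 0 = f q,
    'D_1 (f \o gamma) 0 = k * pb eu ev g f q &
    pb eu ev g f q = 0 ->
    'D_1 ('D_1 (f \o gamma)) 0 = k ^+ 2 * pb eu ev g (pb eu ev g f) q].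
Proof.
move=> sg rg sf rp; have [sgam gam0 _ _] := rp.
have [k [sk k0] kE] := param_pb sg rg rp.
have sfg : smooth_at (f \o gamma) 0 by apply: smooth_at_comp => //; rewrite gam0.
have sp : smooth_at (pb eu ev g f) q by exact: smooth_pb.
exists (k 0) => //; split=> //; first by rewrite /= gam0.
  by rewrite (nbhs_singleton (kE f sf)) gam0.
move=> p0; rewrite (derive_near (1 : R) (kE f sf)).
have spg : smooth_at (pb eu ev g f \o gamma) 0.
  by apply: smooth_at_comp => //; rewrite gam0.
rewrite (DM _ sk spg) /= gam0 p0 mulr0 add0r (nbhs_singleton (kE _ sp)) gam0.
by rewrite expr2 mulrA.
Qed.

(** The second clause says that [gamma] sweeps out the whole zero set near [q]: a property of the
    points of the curve may be checked along [gamma]. *)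
Lemma curve_exists g q : smooth_at g q -> g q = 0 -> regular_at g q ->
  exists2 gamma, regular_param g q gamma & forall P : set R2,
    (\forall s \near (0 : R), s != 0 -> P (gamma s)) ->
    \forall u \near q, u != q -> g u = 0 -> P u.
Proof.
move=> sg gq rg.
have [A EA] : exists A, 'D_eu g q = A by exists ('D_eu g q).
have [B EB] : exists B, 'D_ev g q = B by exists ('D_ev g q).
have m0 : 0 < A ^+ 2 + B ^+ 2 by rewrite -EA -EB; exact: grad2_gt0.
set m := A ^+ 2 + B ^+ 2 in m0.
(* [n] is the gradient and [tau] its rotation, both of squared length [m]; the equation is solved
   for the coordinate along [n], and coordinates are inner products divided by [m]. *)
pose tau : R2 := - B *: eu + A *: ev; pose n : R2 := A *: eu + B *: ev.
pose aff (p : R * R) : R2 := q + (p.1 *: tau + p.2 *: n).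
pose lin (p : R * R) : R2 := p.1 *: tau + p.2 *: n.
have affL (v z : R * R) (h : R) : aff (h *: v + z) = h *: lin v + aff z.
  exact: affine_comb.
have daff z : differentiable aff z.
  apply: differentiableD; first exact: differentiable_cst.
  apply: differentiableD; apply: differentiableZl.
    exact: diff_fst.
  exact: diff_snd.
have aff0 : aff 0 = q.
  by rewrite -[LHS]/(q + ((0 : R) *: tau + (0 : R) *: n)) !scale0r !addr0.
have sG : smooth_at (g \o aff) 0 by apply: (smooth_affine affL daff); rewrite aff0.
have DG (v : R * R) : 'D_v (g \o aff) 0 = 'D_(lin v) g q.
  by have := derive_affineE g v 0 affL; rewrite aff0.
have sgd := smooth_diff sg.
have Dn : 'D_(0, 1) (g \o aff) 0 = m.
  rewrite DG /lin /= scale0r add0r scale1r Dlin // EA EB /m !expr2 //.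
have Dt : 'D_(1, 0) (g \o aff) 0 = 0.
  by rewrite DG /lin /= scale0r addr0 scale1r Dlin // EA EB mulNr mulrC addNr.
have [||Y [Y0 sY nY DY]] := implicit_function sG.
- by rewrite /= aff0.
- by rewrite Dn gt_eqF.
have DY0 : 'D_1 Y 0 = 0.
  by rewrite (nbhs_singleton DY) Y0 Dt oppr0 mul0r.
pose gamma s := aff (s, Y s).
have gammaE s : gamma s = q + (s *: tau + Y s *: n) by [].
have sgamma : smooth_at gamma 0.
  apply: smoothD; first exact: smooth_cst.
  apply: smoothD; apply: smoothZ => //; try exact: smooth_cst.
  exact: smooth_at_id.
have rp : regular_param g q gamma.
  split=> //.
  - by rewrite gammaE Y0 !scale0r !addr0.
  - rewrite (_ : 'D_1 gamma 0 = tau).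
      apply/eqP => /rowP tau0; move: (tau0 0) (tau0 1).
      rewrite !mxE /= !mulr0 !mulr1 addr0 add0r => /eqP; rewrite oppr_eq0 => /eqP b0 a0.
      by move: m0; rewrite /m a0 b0 expr0n addr0 ltxx.
    rewrite (_ : gamma = bump (bump (fun=> q) id tau) Y n); last first.
      by apply/funext => s; rewrite gammaE /bump addrA.
    have sid : smooth_at (id : R -> R) 0 by exact: smooth_at_id.
    have sq : smooth_at (fun _ : R => q) 0 by exact: smooth_cst.
    rewrite D_bump //; last exact: smooth_bump.
    by rewrite /bump DY0 scale0r addr0 D_bump // /bump derive_cst derive_id add0r scale1r.
  - have cY := smooth_at_continuous sY.
    have nY0 : nbhs (0, Y 0) [set p : R * R | (g \o aff) p = 0 <-> p.2 = Y p.1].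
      by rewrite Y0.
    by apply: filterS (near_graph cY nY0) => s /= H; apply/H.
exists gamma => // P nP.
pose sc (w : R2) (u : R2) : R := ((u - q) 0 0 * w 0 0 + (u - q) 0 1 * w 0 1) / m.
have csc w : {for q, continuous (sc w)}.
  have sd : smooth_at (fun u : R2 => u - q) q.
    by apply: smoothD; [exact: smooth_at_id|exact: smooth_cst].
  apply: smooth_at_continuous; apply: smoothM; last exact: smooth_cst.
  by apply: smoothD; apply: smoothM; [exact: smooth_coord|exact: smooth_cst|
    exact: smooth_coord|exact: smooth_cst].
pose c (u : R2) : R * R := (sc tau u, sc n u).
have c0 : c q = 0.
  by rewrite /c /sc subrr !mxE !mul0r addr0 mul0r.
have m0' : m != 0 by rewrite gt_eqF.
have cE u : u = aff (c u).
  apply/rowP; apply: ord2P; rewrite /aff /c /sc /= !mxE /= /m.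
    by move: m0'; rewrite /m; move: (u 0 0) (u 0 1) (q 0 0) (q 0 1) => *; field.
  by move: m0'; rewrite /m; move: (u 0 0) (u 0 1) (q 0 0) (q 0 1) => *; field.
have sc0 w : sc w q = 0 by rewrite /sc subrr !mxE !mul0r addr0 mul0r.
have nY' : \forall u \near q, g u = 0 -> sc n u = Y (sc tau u).
  case: nY => -[Q1 Q2] [/= n1 n2] QP.
  have N1 : \forall u \near q, Q1 (sc tau u) by apply: csc; rewrite sc0.
  have N2 : \forall u \near q, Q2 (sc n u) by apply: csc; rewrite sc0.
  apply: filterS2 N1 N2 => u q1 q2 gu.
  by apply/(QP (sc tau u, sc n u) (conj q1 q2)); rewrite /= -cE.
have nP' : \forall u \near q, sc tau u != 0 -> P (gamma (sc tau u)).
  have nP0 : nbhs (sc tau q) [set s | s != 0 -> P (gamma s)] by rewrite sc0.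
  exact: (csc tau _ nP0).
apply: filterS2 nY' nP' => u Hu HP uq gu; have Yu := Hu gu.
have Eu : u = gamma (sc tau u) by rewrite {1}(cE u) /gamma /c Yu.
rewrite Eu; apply: HP; apply: contraNneq uq => st0.
by rewrite (cE u) /c Yu st0 Y0 aff0.
Qed.

End Curves.

(** * Derivatives of a square at a zero *)

Section Square.
Context {R : realType}.

Lemma near_derive_trans (f g h : R -> R) : (\forall s \near (0 : R), f s = g s) ->
  (\forall s \near (0 : R), 'D_1 g s = h s) ->
  \forall s \near (0 : R), 'D_1 f s = h s.
Proof. by move=> /(near_derive1 (1 : R)) fg; apply: filterS2 fg => s; exact: eq_trans. Qed.

Section Abstract.
Variables F F1 F2 F3 F4 : R -> R.
Hypotheses (sF : forall s, smooth_at F s -> [/\ smooth_at F1 s, smooth_at F2 s & smooth_at F3 s]).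
Hypotheses (E1 : forall s, 'D_1 F s = F1 s) (E2 : forall s, 'D_1 F1 s = F2 s).
Hypotheses (E3 : forall s, 'D_1 F2 s = F3 s) (E4 : forall s, 'D_1 F3 s = F4 s).

Local Notation Q1 := (fun s => 2 * (F s * F1 s)).
Local Notation Q2 := (fun s => 2 * (F1 s * F1 s + F s * F2 s)).
Local Notation Q3 := (fun s => 2 * (3 * (F1 s * F2 s) + F s * F3 s)).
Local Notation Q4 := (fun s => 2 * (3 * (F2 s * F2 s) + 4 * (F1 s * F3 s) + F s * F4 s)).

Lemma square_derive s : smooth_at F s ->
  [/\ 'D_1 (fun s => F s ^+ 2) s = Q1 s, 'D_1 Q1 s = Q2 s,
      'D_1 Q2 s = Q3 s & 'D_1 Q3 s = Q4 s].
Proof.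
move=> s0; have [s1 s2 s3] := sF s0; split.
- rewrite (_ : (fun s => F s ^+ 2) = fun s => F s * F s); last first.
    by apply/funext => z; rewrite expr2.
  by rewrite DM // E1; move: (F s) (F1 s) => a b; ring.
- by rewrite DMl ?DM // ?E1 ?E2 //; exact: smoothM.
- rewrite DMl; last by apply: smoothD; exact: smoothM.
  rewrite DD; [|exact: smoothM..]; rewrite !DM // E1 E2 E3.
  by move: (F s) (F1 s) (F2 s) (F3 s) => a b c d; ring.
have c3 : smooth_at (fun _ : R => 3 : R) s by exact: smooth_cst.
rewrite DMl; last by apply: smoothD; repeat apply: smoothM.
rewrite DD; [|by repeat apply: smoothM|exact: smoothM].
rewrite DMl ?DM // ?E1 ?E2 ?E3 ?E4; last exact: smoothM.
by move: (F s) (F1 s) (F2 s) (F3 s) (F4 s) => a b c d e; ring.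
Qed.
End Abstract.

Variable F : R -> R.
Hypothesis sF : smooth_at F 0.
Local Notation F1 := ('D_1 F).
Local Notation F2 := ('D_1 F1).
Local Notation F3 := ('D_1 F2).
Local Notation F4 := ('D_1 F3).
Let Q (s : R) := F s ^+ 2.
Let Q1 s := 2 * (F s * F1 s).
Let Q2 s := 2 * (F1 s * F1 s + F s * F2 s).
Let Q3 s := 2 * (3 * (F1 s * F2 s) + F s * F3 s).
Let Q4 s := 2 * (3 * (F2 s * F2 s) + 4 * (F1 s * F3 s) + F s * F4 s).

Let sD s : smooth_at F s -> [/\ smooth_at F1 s, smooth_at F2 s & smooth_at F3 s].
Proof. by move=> sFs; split; do ?apply: smooth_derive. Qed.

Let near_Q : \forall s \near (0 : R), [/\ 'D_1 Q s = Q1 s, 'D_1 Q1 s = Q2 s,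
  'D_1 Q2 s = Q3 s & 'D_1 Q3 s = Q4 s].
Proof.
apply: filterS (smooth_near sF) => s.
exact: (square_derive sD (fun=> erefl) (fun=> erefl) (fun=> erefl) (fun=> erefl)).
Qed.

Let N1 : \forall s \near (0 : R), 'D_1 Q s = Q1 s.
Proof. by apply: filterS near_Q => s []. Qed.

Let N2 : \forall s \near (0 : R), 'D_1 ('D_1 Q) s = Q2 s.
Proof. by apply: near_derive_trans N1 _; apply: filterS near_Q => s []. Qed.

Let N3 : \forall s \near (0 : R), 'D_1 ('D_1 ('D_1 Q)) s = Q3 s.
Proof. by apply: near_derive_trans N2 _; apply: filterS near_Q => s []. Qed.

Let N4 : \forall s \near (0 : R), 'D_1 ('D_1 ('D_1 ('D_1 Q))) s = Q4 s.
Proof. by apply: near_derive_trans N3 _; apply: filterS near_Q => s []. Qed.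

Lemma square_d2 : 'D_1 ('D_1 Q) 0 = 2 * (F1 0 ^+ 2 + F 0 * F2 0).
Proof. exact: (nbhs_singleton N2). Qed.

Lemma square_d4 : F 0 = 0 -> F1 0 = 0 ->
  'D_1 ('D_1 ('D_1 ('D_1 Q))) 0 = 6 * F2 0 ^+ 2.
Proof.
have H (a b c : R) : 2 * (3 * (a * a) + 4 * (0 * b) + 0 * c) = 6 * a ^+ 2 by ring.
by move=> f0 f1; apply: (eq_trans (nbhs_singleton N4)); rewrite /Q4 f0 f1; exact: H.
Qed.

End Square.

(** * Contact orders read off the relation t = h^2 + 4 d K *)

Section Contact.
Context {R : realType}.
Local Notation R2 := 'rV[R]_2.
Local Notation X := (pb eu ev).
Variables (d h K t : R2 -> R) (q : R2).
Hypotheses (sd : smooth_at d q) (sh : smooth_at h q) (sK : smooth_at K q).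
Hypothesis tE : forall u, t u = h u ^+ 2 + 4 * d u * K u.

Let D2E (f : R -> R) : derive1n 2 f 0 = 'D_1 ('D_1 f) 0.
Proof. by rewrite derive1n_iterD. Qed.

Let D1E (f : R -> R) : derive1n 1 f 0 = 'D_1 f 0.
Proof. by rewrite derive1n_iterD. Qed.

Let D4E (f : R -> R) : derive1n 4 f 0 = 'D_1 ('D_1 ('D_1 ('D_1 f))) 0.
Proof. by rewrite derive1n_iterD. Qed.

Let t_param gamma : regular_param d q gamma ->
  \forall s \near (0 : R), (t \o gamma) s = (h \o gamma) s ^+ 2.
Proof.
move=> [_ _ _ dz]; apply: filterS dz => s /= ds.
by rewrite tE ds mulr0 mul0r addr0.
Qed.

Let derive1n_near (f g : R -> R) n : (\forall s \near (0 : R), f s = g s) ->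
  derive1n n f 0 = derive1n n g 0.
Proof. by move=> fg; rewrite !derive1n_iterD; exact: iterD_eq. Qed.

(** Along d = 0 the function [t] is the square of [h]. Its value forces h = 0, and its second
    derivative is then twice the square of the derivative of [h]. *)
Lemma contact_gt_pb : contact_gt d t q 2 -> h q = 0 /\ X d h q = 0.
Proof.
move=> [rd [gamma rp H]]; have tg := t_param rp.
have [k k0 [sF F0 F1 _]] := param_order sd rd sh rp.
have h0 : h q = 0.
  by have := H 0%N isT; rewrite (derive1n_near 0 tg) /= -/((h \o gamma) 0) F0 => /eqP; rewrite sqrf_eq0 => /eqP.
split=> //; have := H 2%N isT.
rewrite (derive1n_near 2 tg) D2E square_d2 // F0 h0 mul0r addr0 F1 => /eqP.
by rewrite mulf_eq0 pnatr_eq0 /= sqrf_eq0 mulf_eq0 (negbTE k0) /= => /eqP.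
Qed.

Lemma pb_contact_gt : regular_at d q -> d q = 0 -> h q = 0 -> X d h q = 0 ->
  contact_gt d t q 2.
Proof.
move=> rd d0 h0 p0; split=> //; have [gamma rp _] := curve_exists sd d0 rd.
exists gamma => //; have tg := t_param rp.
have [k k0 [sF F0 F1 _]] := param_order sd rd sh rp.
have fF : flat 2 (h \o gamma).
  apply/flat_derive1n => // -[|[|//]] _; first by rewrite -[LHS]/((h \o gamma) 0) F0.
  by rewrite D1E F1 p0 mulr0.
have fF4 : flat 4 (fun s => (h \o gamma) s ^+ 2).
  by apply: flat_ext (flatM fF fF) => s; rewrite expr2.
move=> j j2; rewrite (derive1n_near j tg).
by move/flat_derive1n : (fF4); apply; [exact: flat_smooth fF4|exact: leq_ltn_trans j2 _].
Qed.

Lemma pb_contact_eq : regular_at d q -> d q = 0 -> h q = 0 -> X d h q = 0 ->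
  X d (X d h) q != 0 -> contact_eq d t q 4 /\ contact_eq d h q 2.
Proof.
move=> rd d0 h0 p0 pp; have [gamma rp _] := curve_exists sd d0 rd.
have tg := t_param rp; have [k k0 [sF F0 F1 F2]] := param_order sd rd sh rp.
have fF : flat 2 (h \o gamma).
  apply/flat_derive1n => // -[|[|//]] _; first by rewrite -[LHS]/((h \o gamma) 0) F0.
  by rewrite D1E F1 p0 mulr0.
have fF4 : flat 4 (fun s => (h \o gamma) s ^+ 2).
  by apply: flat_ext (flatM fF fF) => s; rewrite expr2.
have F2n : 'D_1 ('D_1 (h \o gamma)) 0 != 0.
  by rewrite F2 // mulf_neq0 // expf_neq0.
split; (split; first exact: rd); exists gamma; try exact: rp; split.
- move=> j j4; rewrite (derive1n_near j tg).
  by move/flat_derive1n : (fF4); apply; [exact: flat_smooth fF4|].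
- have F0' : (h \o gamma) 0 = 0 by rewrite F0.
  have F1' : 'D_1 (h \o gamma) 0 = 0 by rewrite F1 p0 mulr0.
  rewrite (derive1n_near 4 tg) D4E (square_d4 sF F0' F1').
  by rewrite mulf_neq0 ?pnatr_eq0 // expf_neq0.
- by move/flat_derive1n : (fF); apply.
- by rewrite D2E.
Qed.

Lemma contact_eq_pb : h q = 0 -> contact_eq d h q 2 ->
  X d h q = 0 /\ X d (X d h) q != 0.
Proof.
move=> h0 [rd [gamma rp [H0 H2]]].
have [k k0 [sF F0 F1 F2]] := param_order sd rd sh rp.
have p0 : X d h q = 0.
  have := H0 1%N isT; rewrite D1E F1 => /eqP.
  by rewrite mulf_eq0 (negbTE k0) /= => /eqP.
split=> //; move: H2; rewrite D2E F2 //.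
by apply: contraNneq => ->; rewrite mulr0.
Qed.

Lemma t_gradient v : d q = 0 -> h q = 0 -> 'D_v t q = 4 * K q * 'D_v d q.
Proof.
move=> d0 h0; rewrite (_ : t = fun u => h u * h u + 4 * (d u * K u)); last first.
  by apply/funext => u; rewrite tE expr2 mulrA.
rewrite DD; [|exact: smoothM|apply: smoothM; [exact: smooth_cst|exact: smoothM]].
rewrite DMl ?DM //; last exact: smoothM.
by rewrite d0 h0; move: ('D_v h q) ('D_v d q) ('D_v K q) (K q) => a b c e; ring.
Qed.

Lemma smooth_t : smooth_at t q.
Proof.
rewrite (_ : t = fun u => h u * h u + 4 * (d u * K u)); last first.
  by apply/funext => u; rewrite tE expr2 mulrA.
apply: smoothD; first exact: smoothM.
by apply: smoothM; [exact: smooth_cst|exact: smoothM].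
Qed.

Lemma regular_t : regular_at d q -> d q = 0 -> h q = 0 ->
  regular_at t q <-> K q != 0.
Proof.
move=> rd d0 h0; have dt := smooth_diff smooth_t; have dd := smooth_diff sd.
rewrite regularP // !t_gradient //; split=> [H|K0].
  by apply: contra_notN H => /eqP ->; rewrite mulr0 !mul0r.
move/(regularP dd): rd => H [/eqP + /eqP]; rewrite !mulf_eq0 pnatr_eq0 (negbTE K0) /=.
by move=> /eqP a /eqP b; exact: H.
Qed.

(** Meant for the intersection points on a deformed surface: there [h] has a simple zero along d =
    0, so [t], equal to h^2 on that curve, has a double one. *)
Lemma pb_tangency : d q = 0 -> h q = 0 -> K q != 0 -> X d h q != 0 ->
  [/\ Defs.transversal d h q, t q = 0 & ordinary_tangency d t q].
Proof.
move=> d0 h0 K0 p0; have dd := smooth_diff sd; have dh := smooth_diff sh.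
have rd : regular_at d q.
  by apply/regularP => // -[a b]; move: p0; rewrite /pb a b !mul0r subrr eqxx.
split.
- move=> a b H.
  have E v : a * 'D_v d q + b * 'D_v h q = 0.
    apply: (eq_trans _ (H v)).
    exact: (congr2 (fun s t : R => a * s + b * t) (deriveE v dd) (deriveE v dh)).
  have := E eu; have := E ev.
  move: p0; rewrite /pb; move: ('D_eu d q) ('D_ev d q) ('D_eu h q) ('D_ev h q).
  move=> A B C D p0 E2 E1; split; apply: (mulIf p0).
    transitivity (D * (a * A + b * C) - C * (a * B + b * D)); first by ring.
    by rewrite E1 E2; ring.
  transitivity (A * (a * B + b * D) - B * (a * A + b * C)); first by ring.
  by rewrite E1 E2; ring.
- by rewrite tE d0 h0; ring.
split; first exact/regular_t.
split=> //; have [gamma rp _] := curve_exists sd d0 rd.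
have tg := t_param rp; have [k k0 [sF F0 F1 F2]] := param_order sd rd sh rp.
exists gamma => //; split.
- have fF : flat 1 (h \o gamma) by apply: flat1; rewrite ?F0.
  have fF4 : flat 2 (fun s => (h \o gamma) s ^+ 2).
    by apply: flat_ext (flatM fF fF) => s; rewrite expr2.
  move=> j j4; rewrite (derive1n_near j tg).
  by move/flat_derive1n : (fF4); apply; [exact: flat_smooth fF4|].
- rewrite (derive1n_near 2 tg) D2E square_d2 // F0 h0 mul0r addr0 F1.
  by rewrite mulf_neq0 ?pnatr_eq0 // expf_neq0 // mulf_neq0.
Qed.

End Contact.

(** * The two configurations *)

Section Sides.
Context {R : realType}.
Local Notation R2 := 'rV[R]_2.
Local Notation X := (pb eu ev).
Implicit Types (d g h L : R2 -> R).

Lemma D_det (A B C D : R2 -> R) v z : smooth_at A z -> smooth_at B z ->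
  smooth_at C z -> smooth_at D z ->
  'D_v (fun z => A z * B z - C z * D z) z =
  ('D_v A z * B z + A z * 'D_v B z) - ('D_v C z * D z + C z * 'D_v D z).
Proof. by move=> sA sB sC sD; rewrite DB ?DM //; exact: smoothM. Qed.

Lemma D_lincomb (f g : R2 -> R) (r : R) v z : smooth_at f z -> smooth_at g z ->
  'D_v (fun u => f u - r * g u) z = 'D_v f z - r * 'D_v g z.
Proof.
move=> sf sg; rewrite DB ?DMl //.
by apply: smoothM => //; exact: smooth_cst.
Qed.

Lemma pb_lincomb d (f : R2 -> R) (r : R) z : smooth_at f z -> smooth_at d z ->
  X d (fun u => f u - r * d u) z = X d f z.
Proof.
move=> sf sd; rewrite /pb !D_lincomb //.
move: ('D_eu d z) ('D_ev d z) ('D_eu f z) ('D_ev f z) => A B C D; ring.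
Qed.

Lemma pb2_flat g L : smooth_at g 0 -> flat 2 L -> X g (X g L) 0 =
  'D_eu g 0 * ('D_eu g 0 * 'D_ev ('D_ev L) 0 - 'D_ev g 0 * 'D_ev ('D_eu L) 0) -
  'D_ev g 0 * ('D_eu g 0 * 'D_eu ('D_ev L) 0 - 'D_ev g 0 * 'D_eu ('D_eu L) 0).
Proof.
move=> sg fL; have sL := flat_smooth fL.
have su := smooth_derive eu sg; have sv := smooth_derive ev sg.
have sLu := smooth_derive eu sL; have sLv := smooth_derive ev sL.
have L0 v : 'D_v L 0 = 0 by exact: flat_Dval fL.
have DX v : 'D_v (X g L) 0 = 'D_eu g 0 * 'D_v ('D_ev L) 0 - 'D_ev g 0 * 'D_v ('D_eu L) 0.
  apply: (eq_trans (D_det v su sLv sv sLu)); rewrite (L0 eu) (L0 ev).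
  have H (a b c d e f : R) : a * 0 + c * d - (b * 0 + e * f) = c * d - e * f by ring.
  exact: H.
exact: (congr2 (fun p q => 'D_eu g 0 * p - 'D_ev g 0 * q) (DX ev) (DX eu)).
Qed.

(** The curve g = 0 has the tangent of d = 0, and [L] has vanishing 1-jet, so its second derivative
    along g = 0 is that along d = 0 up to a positive factor, here [(k * mu) ^+ 2]. The LD, the MCNC
    and the LPL will all play the part of [g]. *)
Lemma zero_side d g L (mu : R) : smooth_at d 0 -> smooth_at g 0 -> flat 2 L ->
  regular_at g 0 -> g 0 = 0 ->
  'D_eu g 0 = mu * 'D_eu d 0 -> 'D_ev g 0 = mu * 'D_ev d 0 ->
  X d (X d L) 0 != 0 ->
  \forall u \near (0 : R2), u != 0 -> g u = 0 -> 0 < X d (X d L) 0 * L u.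
Proof.
move=> sd sg fL rg g0 gu gv n0; have sL := flat_smooth fL.
have L0 v : 'D_v L 0 = 0 by exact: flat_Dval fL.
have [gamma rp H] := curve_exists sg g0 rg.
apply: (H [set u | 0 < X d (X d L) 0 * L u]).
have [k k0 [sF F0 F1 F2]] := param_order sg rg sL rp.
set n := X d (X d L) 0 in n0 *.
have p0 : X g L 0 = 0 by rewrite /pb !L0 !mulr0 subrr.
have mu0 : mu != 0.
  apply/eqP => mu0; move/(regularP (smooth_diff sg)): rg; apply.
  by rewrite gu gv mu0 !mul0r.
have XX : X g (X g L) 0 = mu ^+ 2 * n.
  rewrite /n !pb2_flat // gu gv.
  have H' (a b p1 p2 p3 p4 : R) :
    mu * a * (mu * a * p1 - mu * b * p2) - mu * b * (mu * a * p3 - mu * b * p4) =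
    mu ^+ 2 * (a * (a * p1 - b * p2) - b * (a * p3 - b * p4)) by ring.
  exact: H'.
pose F s := n * (L \o gamma) s.
have sF' : smooth_at F 0 by apply: smoothM => //; exact: smooth_cst.
have DF : \forall s \near (0 : R), 'D_1 F s = n * 'D_1 (L \o gamma) s.
  by apply: filterS (smooth_near sF) => s sFs; rewrite /F DMl.
have := near_bowl sF'; apply.
- by rewrite /F F0 (flat_val fL) mulr0.
- by rewrite (nbhs_singleton DF) F1 p0 !mulr0.
rewrite (derive_near (1 : R) DF) DMl ?F2 // ?XX; last exact: smooth_derive.
have -> : n * (k ^+ 2 * (mu ^+ 2 * n)) = (n * k * mu) ^+ 2 by ring.
by rewrite exprn_even_gt0 //= !mulf_neq0.
Qed.

End Sides.

(** On the LPL, h^2 = - 4 d k gives the side of the LD. For the side of the MCNC, 4 k^2 (h - r d) =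
    h (4 k^2 + r k h) - r k (h^2 + 4 d k), where the last term vanishes and the factor of [h] is
    positive near the base point. *)
Lemma lpl_arith (R : realType) (k0 k h d r n : R) : 0 < k0 * k ->
  0 < 4 * k ^+ 2 + r * k * h -> h ^+ 2 + 4 * d * k = 0 -> 0 < n * (h - r * d) ->
  k0 * d < 0 /\ 0 < n * h.
Proof.
move=> KK F4 E nLu.
have k00 : k0 != 0 by apply: contraTneq KK => ->; rewrite mul0r ltxx.
have k1 : k != 0 by apply: contraTneq KK => ->; rewrite mulr0 ltxx.
have kd : k * d <= 0 by have := sqr_ge0 h; lra.
have d00 : d != 0.
  apply: contraTneq nLu => d00; move: E; rewrite d00 mulr0 mul0r addr0 => /eqP.
  by rewrite sqrf_eq0 => /eqP->; rewrite mulr0 subrr mulr0 ltxx.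
have kd0 : k * d < 0 by rewrite lt_neqAle kd mulf_neq0.
split.
  have : 0 < (k0 * k) * (k * d * -1) by rewrite mulr_gt0 //; lra.
  have -> : (k0 * k) * (k * d * -1) = - (k ^+ 2 * (k0 * d)) by ring.
  by rewrite oppr_gt0 pmulr_rlt0 // exprn_even_gt0.
have : 0 < (4 * k ^+ 2) * (n * (h - r * d)).
  by rewrite mulr_gt0 // mulr_gt0 // exprn_even_gt0.
have -> : (4 * k ^+ 2) * (n * (h - r * d)) =
    n * h * (4 * k ^+ 2 + r * k * h) - n * r * k * (h ^+ 2 + 4 * d * k) by ring.
by rewrite E mulr0 subr0 pmulr_lgt0.
Qed.

Lemma lpl_arith0 (R : realType) (k r h : R) : h = 0 -> k != 0 ->
  0 < 4 * k ^+ 2 + r * k * h.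
Proof. by move=> -> k0; rewrite mulr0 addr0 mulr_gt0 // exprn_even_gt0. Qed.

(** [(-1) ^+ (0 < k)] is the sign opposite to that of [k], so it makes [d] positive exactly when k d
    < 0, as on the LPL. On the MCNC [d] has the sign opposite to that of n r, whence the criterion
    on n r k. *)
Lemma opposite_arith (R : realType) (k n r d : R) (P Q : Prop) : n * r * k < 0 ->
  (P -> n * r * d < 0) -> (Q -> k * d < 0) ->
  (Q -> 0 < (-1) ^+ (0 < k)%R * d) /\ (P -> (-1) ^+ (0 < k)%R * d < 0).
Proof.
move=> neg H2 H3.
split=> [/H3|/H2] {H2 H3}; case: (ltgtP 0 k) neg => [k0|k0|<-]; rewrite ?mulr0 ?ltxx //;
  rewrite ?expr1 ?expr0 ?mulN1r ?mul1r.
- by rewrite pmulr_llt0 // => _ ; rewrite pmulr_rlt0 // oppr_gt0.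
- by rewrite nmulr_llt0 // => _ ; rewrite nmulr_rlt0.
- by rewrite pmulr_llt0 // => nr; rewrite nmulr_rlt0 // oppr_lt0.
- by rewrite nmulr_llt0 // => nr; rewrite pmulr_rlt0.
Qed.

Lemma same_arith (R : realType) (k n r d h : R) (P Q S : Prop) : 0 < n * r * k ->
  n != 0 -> (S -> 0 < n * h) -> (P -> n * r * d < 0) ->
  (Q -> k * d < 0 /\ 0 < n * h) ->
  [/\ P -> 0 < (-1) ^+ (0 < k)%R * d, S -> 0 < (-1) ^+ (n < 0)%R * h &
    Q -> 0 < (-1) ^+ (0 < k)%R * d /\ 0 < (-1) ^+ (n < 0)%R * h].
Proof.
move=> pos n00 H1 H2 H3.
have Hn : 0 < n * h -> 0 < (-1) ^+ (n < 0)%R * h.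
  case: (ltgtP n 0) n00 => // nn _; rewrite ?expr1 ?expr0 ?mulN1r ?mul1r.
    by rewrite nmulr_rgt0 // oppr_gt0.
  by rewrite pmulr_rgt0.
have Hk : k * d < 0 -> 0 < (-1) ^+ (0 < k)%R * d.
  case: (ltgtP 0 k) pos => [k0|k0|<-]; rewrite ?mulr0 ?ltxx // ?expr1 ?expr0 ?mulN1r ?mul1r => _.
    by rewrite pmulr_rlt0 // oppr_gt0.
  by rewrite nmulr_rlt0.
split=> [/H2 nrd|/H1 /Hn //|/H3[/Hk ? /Hn ?] //].
apply: Hk; have : 0 < (n * r * k) * (- (n * r * d)) by rewrite mulr_gt0 // oppr_gt0.
have -> : (n * r * k) * (- (n * r * d)) = - ((n * r) ^+ 2 * (k * d)) by ring.
rewrite oppr_gt0 pmulr_rlt0 // exprn_even_gt0 //=.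
by apply: contraTneq pos => ->; rewrite mul0r ltxx.
Qed.

Section Configuration.
Context {R : realType}.
Local Notation R2 := 'rV[R]_2.
Local Notation R3 := 'rV[R]_3.
Local Notation X := (pb eu ev).
Implicit Types (x : R2 -> R3).

Definition gaussc x : R2 -> R := gauss eu ev x.

Lemma smooth_delta x q : smooth_at x q -> smooth_at (delta x) q.
Proof. exact: smooth_disc. Qed.
Lemma smooth_Hbar x q : smooth_at x q -> smooth_at (Hbar x) q.
Proof. exact: smooth_hbar. Qed.
Lemma smooth_gaussc x q : smooth_at x q -> smooth_at (gaussc x) q.
Proof. exact: smooth_gauss. Qed.
Lemma tdeltaE x u : tdelta x u = Hbar x u ^+ 2 + 4 * delta x u * gaussc x u.
Proof. exact: tdiscE. Qed.

(** The conditions defining [G6], on the jet at 0: the regularity of the LPL has become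
    [gaussc x 0 != 0], and the contact order the two equations on [Hbar]. *)
Definition tangent_at x := [/\ delta x 0 = 0, regular_at (delta x) 0, Hbar x 0 = 0,
  X (delta x) (Hbar x) 0 = 0 & gaussc x 0 != 0].

(* Up to a nonzero factor, the second derivative of Hbar along the LD. *)
Definition tangency x : R := X (delta x) (X (delta x) (Hbar x)) 0.

(* The factor r in d Hbar = r d delta at 0. *)
Definition ratio x : R :=
  ('D_eu (Hbar x) 0 * 'D_eu (delta x) 0 + 'D_ev (Hbar x) 0 * 'D_ev (delta x) 0)
  / grad2 (delta x) 0.

Lemma tangent_atP x : smooth_at x 0 ->
  [/\ LD x 0, regular_at (delta x) 0, regular_at (tdelta x) 0
    & contact_gt (delta x) (tdelta x) 0 2] <-> tangent_at x.
Proof.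
move=> sx; have sd := smooth_delta sx; have sh := smooth_Hbar sx.
have sK := smooth_gaussc sx; have tE := tdeltaE x.
split=> [[d0 rd rt ct]|[d0 rd h0 p0 K0]].
  have [h0 p0] := contact_gt_pb sd sh tE ct.
  have K0 := (regular_t sd sh sK tE rd d0 h0).1 rt.
  exact: And5 d0 rd h0 p0 K0.
have rt := (regular_t sd sh sK tE rd d0 h0).2 K0.
exact: And4 d0 rd rt (pb_contact_gt sd sh tE rd d0 h0 p0).
Qed.

Section Ratio.
Variable x : R2 -> R3.
Hypotheses (sx : smooth_at x 0) (Ax : tangent_at x).
Let sd := smooth_delta sx.
Let sh := smooth_Hbar sx.

Lemma ratioE : 'D_eu (Hbar x) 0 = ratio x * 'D_eu (delta x) 0 /\
  'D_ev (Hbar x) 0 = ratio x * 'D_ev (delta x) 0.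
Proof.
have [d0 rd h0 + K0] := Ax; have := grad2_gt0 sd rd.
rewrite /ratio /grad2 /pb; move: ('D_eu (delta x) 0) ('D_ev (delta x) 0).
move: ('D_eu (Hbar x) 0) ('D_ev (Hbar x) 0) => a b A B m0 p0.
have m1 : A ^+ 2 + B ^+ 2 != 0 by rewrite gt_eqF.
split; rewrite mulrAC; apply: (mulIf m1); rewrite divfK //.
  have -> : (a * A + b * B) * A = a * (A ^+ 2 + B ^+ 2) + B * (A * b - B * a) by ring.
  by rewrite p0 mulr0 addr0.
have -> : (a * A + b * B) * B = b * (A ^+ 2 + B ^+ 2) - A * (A * b - B * a) by ring.
by rewrite p0 mulr0 subr0.
Qed.

Lemma ratio_neq0 : regular_at (Hbar x) 0 <-> ratio x != 0.
Proof.
have H (a b r : R) : ~ (a = 0 /\ b = 0) -> (~ (r * a = 0 /\ r * b = 0) <-> r != 0).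
  move=> ab; split=> [rab|r0 [/eqP + /eqP]].
    by apply: contra_notN rab => /eqP->; rewrite !mul0r.
  by rewrite !mulf_eq0 (negbTE r0) /= => /eqP a0 /eqP b0; exact: ab.
have [Eu Ev] := ratioE; have [_ rd _ _ _] := Ax.
have rd' := (regularP (smooth_diff sd)).1 rd.
apply: (iff_trans (regularP (smooth_diff sh))); rewrite Eu Ev; exact: H.
Qed.

Let L u := Hbar x u - ratio x * delta x u.

Let fL : flat 2 L.
Proof.
have [d0 rd h0 p0 K0] := Ax; have [Eu Ev] := ratioE.
have s1 : smooth_at (fun u => ratio x * delta x u) 0.
  by apply: smoothM => //; exact: smooth_cst.
have sL : smooth_at L 0 by exact: smoothB.
apply/flatS; split=> // [|v]; first by rewrite /L d0 h0 mulr0 subrr.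
apply: flat1; first exact: smooth_derive.
have DLu : 'D_eu L 0 = 0 by apply: (eq_trans (D_lincomb _ _ sh sd)); rewrite Eu subrr.
have DLv : 'D_ev L 0 = 0 by apply: (eq_trans (D_lincomb _ _ sh sd)); rewrite Ev subrr.
apply: (eq_trans (derive_row2 v (smooth_diff sL))).
by rewrite DLu DLv !scaler0 addr0.
Qed.

Let XL : X (delta x) (X (delta x) L) 0 = tangency x.
Proof.
have H : \forall u \near (0 : R2), X (delta x) L u = X (delta x) (Hbar x) u.
  apply: filterS (smooth_near sx) => u su.
  have su' := smooth_delta su; have sh' := smooth_Hbar su.
  exact: pb_lincomb.
have dd : \forall u \near (0 : R2), delta x u = delta x u by exact: filterE.
exact: (nbhs_singleton (pb_near eu ev dd H)).
Qed.

Hypothesis n0 : tangency x != 0.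

(** Away from 0, Hbar - r delta has the sign of [tangency x] on each of the three curves. It is Hbar
    on the LD and - r delta on the MCNC; on the LPL the quadratic relation between delta and Hbar
    does the rest. *)
Lemma sides : ratio x != 0 -> \forall u \near (0 : R2), u != 0 ->
  [/\ LD x u -> 0 < tangency x * Hbar x u,
      MCNC x u -> tangency x * ratio x * delta x u < 0
    & LPL x u -> gaussc x 0 * delta x u < 0 /\ 0 < tangency x * Hbar x u].
Proof.
move=> r0; have [d0 rd h0 p0 K0] := Ax; have [Eu Ev] := ratioE.
have sK := smooth_gaussc sx; have tE := tdeltaE x.
have rh : regular_at (Hbar x) 0 by exact/ratio_neq0.
have rt : regular_at (tdelta x) 0 := (regular_t sd sh sK tE rd d0 h0).2 K0.
have st : smooth_at (tdelta x) 0 := smooth_t sd sh sK tE.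
have nL : X (delta x) (X (delta x) L) 0 != 0 by rewrite XL.
have D1 v : 'D_v (delta x) 0 = 1 * 'D_v (delta x) 0 by rewrite mul1r.
have Dt v : 'D_v (tdelta x) 0 = 4 * gaussc x 0 * 'D_v (delta x) 0.
  exact: (t_gradient sd sh sK tE v d0 h0).
have t0 : tdelta x 0 = 0 by rewrite tE d0 h0; ring.
have H1 := zero_side sd sd fL rd d0 (D1 _) (D1 _) nL.
have H2 := zero_side sd sh fL rh h0 Eu Ev nL.
have H3 := zero_side sd st fL rt t0 (Dt _) (Dt _) nL.
rewrite XL in H1 H2 H3; clear Eu Ev D1 Dt nL p0 rd rh rt st t0.
have nK : \forall u \near (0 : R2), 0 < gaussc x 0 * gaussc x u.
  have sKK : smooth_at (fun u => gaussc x 0 * gaussc x u) 0.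
    exact: smoothM (smooth_cst _ _) sK.
  have KK : 0 < gaussc x 0 * gaussc x 0 by rewrite -expr2 exprn_even_gt0.
  exact: (cvgr_gt _ (smooth_at_continuous sKK) 0 KK).
have n4 : \forall u \near (0 : R2), 0 < 4 * gaussc x u ^+ 2 + ratio x * gaussc x u * Hbar x u.
  have sF : smooth_at (fun u => 4 * gaussc x u ^+ 2 + ratio x * gaussc x u * Hbar x u) 0.
    apply: smoothD; first exact: smoothM (smooth_cst _ _) (smoothX 2 sK).
    exact: smoothM (smoothM (smooth_cst _ _) sK) sh.
  have F0 : 0 < 4 * gaussc x 0 ^+ 2 + ratio x * gaussc x 0 * Hbar x 0.
    exact: lpl_arith0 h0 K0.
  exact: (cvgr_gt _ (smooth_at_continuous sF) 0 F0).
apply: filterS (filterI H1 (filterI H2 (filterI H3 (filterI nK n4)))).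
move=> u [L1 [L2 [L3 [KK F4]]]] u0; split.
- move=> du; have := L1 u0 du; rewrite /L; move: du; rewrite /LD /= => ->.
  by rewrite mulr0 subr0.
- move=> hu; have := L2 u0 hu; rewrite /L; move: hu; rewrite /MCNC /= => ->.
  by rewrite sub0r mulrN oppr_gt0 mulrA.
move=> tu; have E : Hbar x u ^+ 2 + 4 * delta x u * gaussc x u = 0 by rewrite -tE.
exact: lpl_arith KK F4 E (L3 u0 tu).
Qed.

Lemma opposite_sidesP : tangency x * ratio x * gaussc x 0 < 0 -> opposite_sides x.
Proof.
move=> neg; have r0 : ratio x != 0.
  by apply: contraTneq neg => ->; rewrite mulr0 mul0r ltxx.
split; first exact/ratio_neq0.
exists (0 < gaussc x 0); apply: filterS (sides r0) => u H u0.
have [_ H2 H3] := H u0.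
exact: opposite_arith neg H2 (fun Hu => (H3 Hu).1).
Qed.

Lemma same_sideP : 0 < tangency x * ratio x * gaussc x 0 -> same_side x.
Proof.
move=> pos; have r0 : ratio x != 0.
  by apply: contraTneq pos => ->; rewrite mulr0 mul0r ltxx.
split; first exact/ratio_neq0.
exists (0 < gaussc x 0), (tangency x < 0); apply: filterS (sides r0) => u H u0.
have [H1 H2 H3] := H u0.
exact: same_arith pos n0 H1 H2 H3.
Qed.

End Ratio.

End Configuration.

(** * Invariance under reparametrization *)

Section Schwarz.
Context {R : realType} {V : normedModType R}.
Implicit Types (f : V -> R) (q a b : V).

Lemma derive_line f q a (s : R) : differentiable f (q + s *: a) ->
  is_derive s (1 : R) (fun s : R => f (q + s *: a)) ('D_a f (q + s *: a)).
Proof.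
move=> df; have AL (v z h : R) : q + (h *: v + z) *: a = h *: (v *: a) + (q + z *: a).
  by rewrite scalerDl -[h *: v]/(h * v) -scalerA addrCA.
have dA (z : R) : differentiable (fun s : R => q + s *: a) z.
  apply: differentiableD; first exact: differentiable_cst.
  exact: differentiableZl.
have dfA : differentiable (f \o (fun s : R => q + s *: a)) s.
  exact: differentiable_comp.
apply: DeriveDef; first exact: diff_derivable.
have := derive_affineE f (1 : R) s AL; rewrite scale1r; exact.
Qed.

Lemma near_segment (P : V -> Prop) q a b : (\forall z \near q, P z) ->
  exists2 r : R, 0 < r & forall s t, `|s| < r -> `|t| < r -> P (q + s *: a + t *: b).
Proof.
move=> nP; have cF : {for 0, continuous (fun p : R * R => q + p.1 *: a + p.2 *: b)}.
  apply: differentiable_continuous; apply: differentiableD.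
    apply: differentiableD; first exact: differentiable_cst.
    apply: differentiableZl; exact: diff_fst.
  apply: differentiableZl; exact: diff_snd.
have : \forall p \near (0 : R * R), P (q + p.1 *: a + p.2 *: b).
  by apply: cF; rewrite /= !scale0r !addr0.
by move=> /nbhs_box[r r0 H]; exists r => // s t sr tr; exact: (H s t).
Qed.

(** The mean value theorem is applied twice: along [a] to the increment of [f] in the direction [b],
    then along [b] to the derivative along [a]. *)
Lemma mixed_difference f q a b (r : R) : (forall s t : R, `|s| < r -> `|t| < r ->
    differentiable f (q + s *: a + t *: b) /\ differentiable ('D_a f) (q + s *: a + t *: b)) ->
  forall s, 0 < s -> s < r -> exists c d, [/\ `|c| < s, `|d| < s &
   f (q + s *: a + s *: b) - f (q + s *: a) - f (q + s *: b) + f q =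
   s ^+ 2 * 'D_b ('D_a f) (q + c *: a + d *: b)].
Proof.
move=> H s s0 sr.
have lt0s c : c \in `]0, s[%R -> `|c| < s.
  by rewrite in_itv /= => /andP[c0 cs]; rewrite gtr0_norm.
have les c : c \in `[0, s]%R -> `|c| < r.
  by rewrite in_itv /= => /andP[c0 cs]; rewrite ger0_norm // (le_lt_trans cs).
have ss : `|s| < r by rewrite gtr0_norm.
have n0 : `|0 : R| < r by rewrite normr0 (lt_trans s0).
pose g (c : R) := f (q + s *: b + c *: a) - f (q + c *: a).
have dg c : c \in `[0, s]%R ->
    is_derive c (1 : R) g ('D_a f (q + s *: b + c *: a) - 'D_a f (q + c *: a)).
  move=> /les cr; apply: is_deriveB; apply: derive_line.
    by rewrite addrAC; have [] := H c s cr ss.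
  by have [] := H c 0 cr n0; rewrite scale0r addr0.
have cg : {within `[0, s], continuous g}.
  by apply: derivable_within_continuous => c /dg[].
have oo_cc c : c \in `]0, s[%R -> c \in `[0, s]%R.
  by rewrite !in_itv /= => /andP[/ltW-> /ltW->].
have [c c0s E1] := @MVT _ g (fun c => 'D_a f (q + s *: b + c *: a) - 'D_a f (q + c *: a))
  0 s s0 (fun c c0s => dg c (oo_cc c c0s)) cg.
have cr : `|c| < r by exact: lt_trans (lt0s _ c0s) sr.
pose k (d : R) := 'D_a f (q + c *: a + d *: b).
have dk d : d \in `[0, s]%R ->
    is_derive d (1 : R) k ('D_b ('D_a f) (q + c *: a + d *: b)).
  by move=> /les dr; apply: derive_line; have [] := H c d cr dr.
have ck : {within `[0, s], continuous k}.
  by apply: derivable_within_continuous => d /dk[].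
have [d d0s E2] := @MVT _ k (fun d => 'D_b ('D_a f) (q + c *: a + d *: b))
  0 s s0 (fun d d0s => dk d (oo_cc d d0s)) ck.
exists c, d; split; [exact: lt0s|exact: lt0s|].
transitivity (g s - g 0).
  rewrite /g !scale0r !addr0 [q + s *: b + _]addrAC.
  by move: (f _) (f _) (f _) (f _) => x y z w; ring.
rewrite E1; move: E2; rewrite /k scale0r addr0 [q + s *: b + _]addrAC => ->.
by rewrite !subr0; ring.
Qed.

Lemma dist_half (x y z e : R) :
  `|x - z| < e / 2 -> `|y - z| < e / 2 -> `|x - y| <= e.
Proof.
move=> h1 h2; apply: le_trans (ler_distD z _ _) _.
by rewrite [`|z - _|]distrC [e]splitr lerD // ltW.
Qed.

(** The second difference is symmetric in [a] and [b], so the two mixed derivatives agree at two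
    points arbitrarily close to [q]; their continuity concludes. *)
Lemma schwarz f q a b : smooth_at f q -> 'D_a ('D_b f) q = 'D_b ('D_a f) q.
Proof.
move=> sf; apply/eqP; rewrite -subr_eq0 -normr_le0; apply/ler_addgt0Pr => e e0.
rewrite add0r.
have cc v w : \forall z \near q, `|'D_v ('D_w f) q - 'D_v ('D_w f) z| < e / 2.
  have c := smooth_at_continuous (smooth_derive v (smooth_derive w sf)).
  by move/cvgrPdist_lt : c; apply; rewrite divr_gt0.
have nd : \forall z \near q, [/\ differentiable f z, differentiable ('D_a f) z & differentiable ('D_b f) z].
  by apply: filterS (smooth_near sf) => z sz; split; apply: smooth_diff => //; exact: smooth_derive.
have [r r0 H] := near_segment a b (filterI nd (filterI (cc a b) (cc b a))).
pose s := r / 2; have s0 : 0 < s by rewrite divr_gt0.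
have sr : s < r by rewrite /s ltr_pdivrMr // mulr_natr mulr2n ltrDl.
have s2 : s ^+ 2 != 0 by rewrite expf_neq0 // gt_eqF.
have [c [d [cs ds E1]]] : exists c d, [/\ `|c| < s, `|d| < s &
   f (q + s *: a + s *: b) - f (q + s *: a) - f (q + s *: b) + f q =
   s ^+ 2 * 'D_b ('D_a f) (q + c *: a + d *: b)].
  apply: (@mixed_difference f q a b r) => // u v ur vr.
  by have [[]] := H u v ur vr.
have [c' [d' [cs' ds' E2]]] : exists c d, [/\ `|c| < s, `|d| < s &
   f (q + s *: b + s *: a) - f (q + s *: b) - f (q + s *: a) + f q =
   s ^+ 2 * 'D_a ('D_b f) (q + c *: b + d *: a)].
  apply: (@mixed_difference f q b a r) => // u v ur vr.
  by rewrite addrAC; have [[]] := H v u vr ur.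
have [_ [_]] := H c d (lt_trans cs sr) (lt_trans ds sr).
have [_ []] := H d' c' (lt_trans ds' sr) (lt_trans cs' sr).
rewrite [q + d' *: a + _]addrAC.
have EE : s ^+ 2 * 'D_b ('D_a f) (q + c *: a + d *: b) =
          s ^+ 2 * 'D_a ('D_b f) (q + c' *: b + d' *: a).
  apply: (eq_trans (esym E1)); apply: (eq_trans _ E2); rewrite [q + s *: b + _]addrAC.
  by rewrite [X in X + f q = _]addrAC.
move/(mulfI s2): EE => ->.
by move=> h1 _ h2; exact: dist_half h1 h2.
Qed.

End Schwarz.

Section Frames.
Context {R : realType}.
Local Notation R3 := 'rV[R]_3.
Implicit Types (u v w : R3) (a b c d : R).

Lemma minkDr u v w : mink u (v + w) = mink u v + mink u w.
Proof. by rewrite /mink !mxE; ring. Qed.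
Lemma minkZr a u v : mink u (a *: v) = a * mink u v.
Proof. by rewrite /mink !mxE; ring. Qed.
Lemma minkC u v : mink u v = mink v u.
Proof. by rewrite /mink; ring. Qed.
Lemma minkZl a u v : mink (a *: u) v = a * mink u v.
Proof. by rewrite minkC minkZr minkC. Qed.
Lemma minkDl u v w : mink (u + v) w = mink u w + mink v w.
Proof. by rewrite minkC minkDr !(minkC w). Qed.

Lemma mcross_lin a b c d u v :
  mcross (a *: u + c *: v) (b *: u + d *: v) = (a * d - c * b) *: mcross u v.
Proof.
apply/rowP; apply: ord3P; rewrite [RHS]mxE ?mcross0 ?mcross1 ?mcross2 !mxE /=; ring.
Qed.

Lemma mcross_orthl u v : mink (mcross u v) u = 0.
Proof. by rewrite /mink mcross0 mcross1 mcross2; ring. Qed.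
Lemma mcross_orthr u v : mink (mcross u v) v = 0.
Proof. by rewrite /mink mcross0 mcross1 mcross2; ring. Qed.

(** The combinations of [u] and [v] with coefficients [p], [q] and their primes come from the second
    derivatives of the change of variables; being tangential, they are orthogonal to the cross
    product and disappear. *)
Lemma frame_change a b c d p q p' q' p'' q'' u v uu uv vv :
  let x := a *: u + c *: v in let y := b *: u + d *: v in
  let xx := (a * a) *: uu + (a * c + c * a) *: uv + (c * c) *: vv + (p *: u + q *: v) in
  let xy := (a * b) *: uu + (a * d + c * b) *: uv + (c * d) *: vv + (p' *: u + q' *: v) in
  let yy := (b * b) *: uu + (b * d + d * b) *: uv + (d * d) *: vv + (p'' *: u + q'' *: v) in
  let J := a * d - c * b in
  let E := mink u u in let F := mink u v in let G := mink v v in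
  let l := mink (mcross u v) uu in let m := mink (mcross u v) uv in
  let n := mink (mcross u v) vv in
  [/\ mink x x = a ^+ 2 * E + 2 * a * c * F + c ^+ 2 * G,
      mink x y = a * b * E + (a * d + b * c) * F + c * d * G &
      mink y y = b ^+ 2 * E + 2 * b * d * F + d ^+ 2 * G] /\
  [/\ mink (mcross x y) xx = J * (a ^+ 2 * l + 2 * a * c * m + c ^+ 2 * n),
      mink (mcross x y) xy = J * (a * b * l + (a * d + b * c) * m + c * d * n) &
      mink (mcross x y) yy = J * (b ^+ 2 * l + 2 * b * d * m + d ^+ 2 * n)].
Proof.
move=> x y xx xy yy J E F G l m n; split.
  rewrite /x /y !minkDl !minkDr !minkZl !minkZr (minkC v u) -/E -/F -/G.
  by split; ring.
rewrite mcross_lin -/J /xx /xy /yy !minkZl !minkDr !minkZr.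
rewrite mcross_orthl mcross_orthr -/l -/m -/n.
by split; ring.
Qed.

(** The two triples change as quadratic forms, the second with an extra factor [J] from the cross
    product. Discriminants of such forms, and the polarized discriminant that Hbar is, are
    multiplied by [J ^+ 2]; the extra factors make the exponents 2, 3 and 4. *)
Lemma forms_arith a b c d (E F G l m n E' F' G' l' m' n' : R) :
  let J := a * d - c * b in
  [/\ E' = a ^+ 2 * E + 2 * a * c * F + c ^+ 2 * G,
      F' = a * b * E + (a * d + b * c) * F + c * d * G &
      G' = b ^+ 2 * E + 2 * b * d * F + d ^+ 2 * G] ->
  [/\ l' = J * (a ^+ 2 * l + 2 * a * c * m + c ^+ 2 * n),
      m' = J * (a * b * l + (a * d + b * c) * m + c * d * n) &
      n' = J * (b ^+ 2 * l + 2 * b * d * m + d ^+ 2 * n)] ->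
  [/\ F' ^+ 2 - E' * G' = J ^+ 2 * (F ^+ 2 - E * G),
      l' * G' - 2 * m' * F' + n' * E' = J ^+ 3 * (l * G - 2 * m * F + n * E) &
      l' * n' - m' ^+ 2 = J ^+ 4 * (l * n - m ^+ 2)].
Proof.
by move=> J [-> -> ->] [-> -> ->]; rewrite /J; split; ring.
Qed.

End Frames.

Section ChangeOfVariables.
Context {R : realType}.
Local Notation R2 := 'rV[R]_2.
Local Notation R3 := 'rV[R]_3.
Local Notation X := (pb eu ev).

Lemma schwarz_row n (f : R2 -> 'rV[R]_n) q a b : smooth_at f q ->
  'D_a ('D_b f) q = 'D_b ('D_a f) q.
Proof.
move=> sf; apply/rowP => i.
have c v w : 'D_v ('D_w f) q 0 i = 'D_v ('D_w (fun z => f z 0 i)) q.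
  rewrite Dcoord; last exact: smooth_derive.
  by apply: derive_near; apply: filterS (smooth_near sf) => z sz; exact: Dcoord.
exact: (eq_trans (c a b) (eq_trans (schwarz a b (smooth_coord i sf)) (esym (c b a)))).
Qed.

Lemma derive_scale_sum n (a c : R2 -> R) (u v : R2 -> 'rV[R]_n) w p :
  smooth_at a p -> smooth_at c p -> smooth_at u p -> smooth_at v p ->
  'D_w (fun z => a z *: u z + c z *: v z) p =
  (a p *: 'D_w u p + 'D_w a p *: u p) + (c p *: 'D_w v p + 'D_w c p *: v p).
Proof.
move=> sa sc su sv; rewrite deriveD; [|apply: smooth_derivable; exact: smoothZ..].
have [_ ->] := diff_scale (smooth_diff sa) (smooth_diff su).
by have [_ ->] := diff_scale (smooth_diff sc) (smooth_diff sv).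
Qed.

Lemma scale_regroup (W : normedModType R) (a b c d : R) (uu uv vv s t : W) :
  (a *: (b *: uu + d *: uv) + s) + (c *: (b *: uv + d *: vv) + t) =
  (a * b) *: uu + (a * d + c * b) *: uv + (c * d) *: vv + (s + t).
Proof.
rewrite addrACA; congr (_ + _).
by rewrite !scalerDr !scalerA scalerDl !addrA.
Qed.

Section At.
Variables (phi : R2 -> R2) (p : R2).
Hypothesis sphi : smooth_at phi p.

Definition jacu v z := 'D_v phi z 0 0.
Definition jacv v z := 'D_v phi z 0 1.
Definition jacdet z := jacu eu z * jacv ev z - jacv eu z * jacu ev z.

Lemma smooth_jacu v : smooth_at (jacu v) p.
Proof. by apply: smooth_coord; exact: smooth_derive. Qed.
Lemma smooth_jacv v : smooth_at (jacv v) p.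
Proof. by apply: smooth_coord; exact: smooth_derive. Qed.
Lemma smooth_jacdet : smooth_at jacdet p.
Proof. by apply: smoothB; apply: smoothM; try exact: smooth_jacu; exact: smooth_jacv. Qed.

Lemma derive_comp2 (W : normedModType R) (f : R2 -> W) v : smooth_at f (phi p) ->
  'D_v (f \o phi) p = jacu v p *: 'D_eu f (phi p) + jacv v p *: 'D_ev f (phi p).
Proof.
move=> /smooth_diff df; have dphi := smooth_diff sphi.
rewrite deriveE; last exact: differentiable_comp.
by rewrite diff_comp //= -(deriveE _ dphi) -deriveE // derive_row2.
Qed.

Lemma pb_comp (f g : R2 -> R) : smooth_at f (phi p) -> smooth_at g (phi p) ->
  X (f \o phi) (g \o phi) p = jacdet p * X f g (phi p).
Proof.
move=> sf sg; rewrite /pb (derive_comp2 eu sf) (derive_comp2 ev sf).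
rewrite (derive_comp2 eu sg) (derive_comp2 ev sg) /jacdet.
have H (a b c d A B C D : R) : (a * A + c * B) * (b * C + d * D) -
  (b * A + d * B) * (a * C + c * D) = (a * d - c * b) * (A * D - B * C) by ring.
exact: H.
Qed.

End At.

Variables (phi : R2 -> R2) (p : R2) (y : R2 -> R3).
Hypotheses (sphi : smooth_at phi p) (sy : smooth_at y (phi p)).
Local Notation A := (jacu phi).
Local Notation B := (jacv phi).
Local Notation q := (phi p).

Let near_s : \forall z \near p, smooth_at phi z /\ smooth_at y (phi z).
Proof.
have c := smooth_at_continuous sphi; have sn := smooth_near sy.
by apply: filterS2 (smooth_near sphi) (c _ sn).
Qed.

Lemma derive2_comp2 v w : 'D_w ('D_v (y \o phi)) p =
  (A v p * A w p) *: 'D_eu ('D_eu y) q + (A v p * B w p + B v p * A w p) *: 'D_ev ('D_eu y) q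
  + (B v p * B w p) *: 'D_ev ('D_ev y) q
  + ('D_w (A v) p *: 'D_eu y q + 'D_w (B v) p *: 'D_ev y q).
Proof.
have nE : \forall z \near p, 'D_v (y \o phi) z =
    A v z *: ('D_eu y \o phi) z + B v z *: ('D_ev y \o phi) z.
  by apply: filterS near_s => z [sp sz]; exact: derive_comp2.
apply: (eq_trans (derive_near w nE)).
have su := smooth_at_comp sphi (smooth_derive eu sy).
have sv := smooth_at_comp sphi (smooth_derive ev sy).
apply: (eq_trans (derive_scale_sum w (smooth_jacu sphi v) (smooth_jacv sphi v) su sv)).
have E1 := derive_comp2 sphi w (smooth_derive eu sy).
have E2 := derive_comp2 sphi w (smooth_derive ev sy).
(* The symmetry of second derivatives merges the two mixed terms. *)
have E2' := eq_trans E2 (congr1 (fun s => A w p *: s + B w p *: 'D_ev ('D_ev y) q)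
  (schwarz_row eu ev sy)).
apply: (eq_trans (congr2 (fun s t => (A v p *: s + 'D_w (A v) p *: 'D_eu y q) +
  (B v p *: t + 'D_w (B v) p *: 'D_ev y q)) E1 E2')).
exact: scale_regroup.
Qed.

Lemma forms_comp : let J := jacdet phi p in
  [/\ delta (y \o phi) p = J ^+ 2 * delta y q,
      Hbar (y \o phi) p = J ^+ 3 * Hbar y q &
      gaussc (y \o phi) p = J ^+ 4 * gaussc y q].
Proof.
have x1 v := derive_comp2 sphi v sy.
have xuu := derive2_comp2 eu eu; have xuv := derive2_comp2 eu ev.
have xvv := derive2_comp2 ev ev.
rewrite /jacdet; move: (x1 eu) (x1 ev) xuu xuv xvv.
have [a Ea] : exists a, A eu p = a by exists (A eu p).
have [b Eb] : exists b, A ev p = b by exists (A ev p).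
have [c Ec] : exists c, B eu p = c by exists (B eu p).
have [d Ed] : exists d, B ev p = d by exists (B ev p).
rewrite Ea Eb Ec Ed => xu xv xuu xuv xvv.
have [[fE fF fG] [fl fm fn]] := frame_change a b c d
  ('D_eu (A eu) p) ('D_eu (B eu) p) ('D_ev (A eu) p) ('D_ev (B eu) p)
  ('D_ev (A ev) p) ('D_ev (B ev) p) ('D_eu y q) ('D_ev y q)
  ('D_eu ('D_eu y) q) ('D_ev ('D_eu y) q) ('D_ev ('D_ev y) q).
have cr := congr2 mcross xu xv.
apply: forms_arith.
  split; [exact: (eq_trans (congr2 mink xu xu) fE)|
          exact: (eq_trans (congr2 mink xu xv) fF)|
          exact: (eq_trans (congr2 mink xv xv) fG)].
split; [exact: (eq_trans (congr2 mink cr xuu) fl)|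
        exact: (eq_trans (congr2 mink cr xuv) fm)|
        exact: (eq_trans (congr2 mink cr xvv) fn)].
Qed.

End ChangeOfVariables.

Section PoissonFactor.
Context {R : realType}.
Local Notation R2 := 'rV[R]_2.
Local Notation X := (pb eu ev).
Implicit Types (d h u w f g : R2 -> R) (z v : R2).

Lemma DM0 f g v : smooth_at f 0 -> smooth_at g 0 -> f 0 = 0 ->
  'D_v (fun z => f z * g z) 0 = 'D_v f 0 * g 0.
Proof. by move=> sf sg f0; rewrite DM // f0 mul0r addr0. Qed.

Lemma pb_factor u d w h z : smooth_at u z -> smooth_at d z -> smooth_at w z ->
  smooth_at h z -> X (fun z => u z * d z) (fun z => w z * h z) z =
  X d h z * (u z * w z) + h z * (u z * X d w z) + d z * (w z * X u h z + h z * X u w z).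
Proof.
move=> su sd sw sh; rewrite /pb !DM //.
have H (a b c e a1 b1 c1 e1 a2 b2 c2 e2 : R) :
  (a1 * b + a * b1) * (c2 * e + c * e2) - (a2 * b + a * b2) * (c1 * e + c * e1) =
  (b1 * e2 - b2 * e1) * (a * c) + e * (a * (b1 * c2 - b2 * c1))
  + b * (c * (a1 * e2 - a2 * e1) + e * (a1 * c2 - a2 * c1)) by ring.
exact: H.
Qed.

Lemma D_sum3 (P0 Q0 d0 S0 h0 T0 : R2 -> R) v : smooth_at P0 0 -> smooth_at Q0 0 ->
  smooth_at h0 0 -> smooth_at S0 0 -> smooth_at d0 0 -> smooth_at T0 0 ->
  P0 0 = 0 -> h0 0 = 0 -> d0 0 = 0 ->
  'D_v (fun z => P0 z * Q0 z + h0 z * S0 z + d0 z * T0 z) 0 =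
  'D_v P0 0 * Q0 0 + 'D_v h0 0 * S0 0 + 'D_v d0 0 * T0 0.
Proof.
move=> sP sQ sh sS sd sT P00 h00 d00.
by rewrite DD ?DD ?DM0 //; repeat apply: smoothD; exact: smoothM.
Qed.

(** Up to multiples of [d] and [h], the inner bracket is [u * w * pb d h]. The outer bracket brings
    these multiples to multiples of [pb d d], which is 0, and of [pb d h], which vanishes at 0. *)
Lemma pb2_factor u d w h : smooth_at u 0 -> smooth_at d 0 -> smooth_at w 0 ->
  smooth_at h 0 -> d 0 = 0 -> h 0 = 0 -> X d h 0 = 0 ->
  X (fun z => u z * d z) (X (fun z => u z * d z) (fun z => w z * h z)) 0 =
  u 0 ^+ 2 * w 0 * X d (X d h) 0.
Proof.
move=> su sd sw sh d0 h0 p0.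
have sud : smooth_at (fun z => u z * d z) 0 by exact: smoothM.
pose F z := X d h z * (u z * w z) + h z * (u z * X d w z) +
  d z * (w z * X u h z + h z * X u w z).
have nF : \forall z \near (0 : R2), X (fun z => u z * d z) (fun z => w z * h z) z = F z.
  apply: filterS (filterI (filterI (smooth_near su) (smooth_near sd))
    (filterI (smooth_near sw) (smooth_near sh))) => z [[su' sd'] [sw' sh']].
  exact: pb_factor.
have DF v : 'D_v F 0 = 'D_v (X d h) 0 * (u 0 * w 0) + 'D_v h 0 * (u 0 * X d w 0)
    + 'D_v d 0 * (w 0 * X u h 0).
  have sT : smooth_at (fun z => w z * X u h z + h z * X u w z) 0.
    by apply: smoothD; apply: smoothM => //; exact: smooth_pb.
  have := D_sum3 v (smooth_pb eu ev sd sh) (smoothM su sw) sh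
    (smoothM su (smooth_pb eu ev sd sw)) sd sT p0 h0 d0.
  by rewrite [in X in _ -> X]/F => ->; rewrite h0 mul0r addr0.
have Dud v : 'D_v (fun z => u z * d z) 0 = u 0 * 'D_v d 0.
  by rewrite DM // d0 mulr0 add0r.
have E v := eq_trans (derive_near v nF) (DF v).
have H (U W a b a' b' p1 p2 q1 q2 : R) : a * b' - b * a' = 0 ->
    (U * a) * (p2 * (U * W) + b' * q1 + b * q2) - (U * b) * (p1 * (U * W) + a' * q1 + a * q2)
    = U ^+ 2 * W * (a * p2 - b * p1).
  move=> ab; transitivity (U ^+ 2 * W * (a * p2 - b * p1) + U * q1 * (a * b' - b * a')).
    ring.
  by rewrite ab mulr0 addr0.
apply: (eq_trans _ (H _ _ _ _ _ _ _ _ (u 0 * X d w 0) (w 0 * X u h 0) p0)).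
exact: (congr2 (fun s t : R => s - t) (congr2 *%R (Dud eu) (E ev)) (congr2 *%R (Dud ev) (E eu))).
Qed.

End PoissonFactor.

Section Invariance.
Context {R : realType}.
Local Notation R2 := 'rV[R]_2.
Local Notation R3 := 'rV[R]_3.
Local Notation X := (pb eu ev).
Implicit Types (x y : R2 -> R3).

(* The germs violating the open condition, described so that the description is
   closed and, without further assumption, invariant under reparametrization. *)
Definition degenerate x := [/\ delta x 0 = 0, Hbar x 0 = 0, X (delta x) (Hbar x) 0 = 0 &
  ('D_eu (Hbar x) 0 = 0 /\ 'D_ev (Hbar x) 0 = 0) \/ tangency x = 0].

(** The coordinates of [psi \o phi] are those of the identity, whose bracket is 1, and composition
    with [phi] multiplies brackets by the Jacobian. *)
Lemma jacdet_neq0 (phi : R2 -> R2) : diffeo_germ phi -> jacdet phi 0 != 0.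
Proof.
move=> [sphi phi0 [psi [spsi psi0 psiK _]]].
have sc i : smooth_at (fun z : R2 => psi z 0 i) (phi 0) by rewrite phi0; exact: smooth_coord.
have := pb_comp sphi (sc 0) (sc 1).
have nid i : \forall z \near (0 : R2), ((fun z : R2 => psi z 0 i) \o phi) z = z 0 i.
  by apply: filterS psiK => z /= ->.
rewrite (nbhs_singleton (pb_near eu ev (nid 0) (nid 1))).
have sid : smooth_at (id : R2 -> R2) 0 by exact: smooth_at_id.
have D1 v i : 'D_v (fun z : R2 => z 0 i) 0 = v 0 i.
  by rewrite -(Dcoord i v sid) derive_id.
rewrite [X in X = _ -> _]/pb !D1 !euvE mulr1 mulr0 subr0 => E.
by apply/eqP => J0; move: E => /eqP; rewrite J0 mul0r oner_eq0.
Qed.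

Lemma reparam_forms x y : smooth_at y 0 -> reparam x y ->
  exists phi, diffeo_germ phi /\ \forall z \near (0 : R2), [/\
    delta x z = jacdet phi z ^+ 2 * delta y (phi z),
    Hbar x z = jacdet phi z ^+ 3 * Hbar y (phi z) &
    gaussc x z = jacdet phi z ^+ 4 * gaussc y (phi z)].
Proof.
move=> sy [phi dphi xy]; exists phi; split=> //.
have [sphi phi0 _] := dphi.
have ns : \forall z \near (0 : R2), smooth_at phi z /\ smooth_at y (phi z).
  have c := smooth_at_continuous sphi.
  have sn : nbhs (phi 0) [set z | smooth_at y z] by rewrite phi0; exact: smooth_near sy.
  by apply: filterS2 (smooth_near sphi) (c _ sn).
have nf := forms_near eu ev (xy : \forall z \near (0 : R2), x z = (y \o phi) z).
apply: filterS2 ns nf => z [sp sz] [e1 e2 e3 _].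
have [f1 f2 f3] := forms_comp sp sz.
by split; [exact: eq_trans e1 f1|exact: eq_trans e2 f2|exact: eq_trans e3 f3].
Qed.

(** [delta] and [Hbar] have weights 2 and 3 in the Jacobian and each bracket adds one, whence 6 = 1
    + 2 + 3 and 9 = 1 + 2 + 6; the factor between the gradients has weight 3 - 2. The vanishing of
    the lower order terms at 0 keeps derivatives of the Jacobian out of these formulas. *)
Lemma reparam_jets x y : smooth_at y 0 -> reparam x y ->
  exists J : R, J != 0 /\ [/\ delta x 0 = J ^+ 2 * delta y 0,
    Hbar x 0 = J ^+ 3 * Hbar y 0, gaussc x 0 = J ^+ 4 * gaussc y 0 &
    delta y 0 = 0 -> Hbar y 0 = 0 -> [/\
      (('D_eu (delta y) 0 = 0 /\ 'D_ev (delta y) 0 = 0) ->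
       ('D_eu (delta x) 0 = 0 /\ 'D_ev (delta x) 0 = 0)),
      (('D_eu (Hbar y) 0 = 0 /\ 'D_ev (Hbar y) 0 = 0) ->
       ('D_eu (Hbar x) 0 = 0 /\ 'D_ev (Hbar x) 0 = 0)),
      X (delta x) (Hbar x) 0 = J ^+ 6 * X (delta y) (Hbar y) 0,
      X (delta y) (Hbar y) 0 = 0 -> tangency x = J ^+ 9 * tangency y &
      forall r, 'D_eu (Hbar y) 0 = r * 'D_eu (delta y) 0 ->
        'D_ev (Hbar y) 0 = r * 'D_ev (delta y) 0 -> forall v,
        'D_v (Hbar x) 0 = J * r * 'D_v (delta x) 0]].
Proof.
move=> sy rxy; have [phi [dphi nf]] := reparam_forms sy rxy.
have [sphi phi0 _] := dphi; have J0 := jacdet_neq0 dphi.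
exists (jacdet phi 0); split; first exact: J0.
have [e1 e2 e3] := nbhs_singleton nf; rewrite phi0 in e1 e2 e3.
split; [exact: e1|exact: e2|exact: e3|move=> d0 h0].
have sy' : smooth_at y (phi 0) by rewrite phi0.
have sd := smooth_delta sy'; have sh := smooth_Hbar sy'.
have sdp := smooth_at_comp sphi sd; have shp := smooth_at_comp sphi sh.
have sJ := smooth_jacdet sphi.
have sJn n := smoothX n sJ.
have nd : \forall z \near (0 : R2), delta x z =
    jacdet phi z ^+ 2 * (delta y \o phi) z.
  by apply: filterS nf => z [e _ _]; exact: e.
have nh : \forall z \near (0 : R2), Hbar x z =
    jacdet phi z ^+ 3 * (Hbar y \o phi) z.
  by apply: filterS nf => z [_ e _]; exact: e.
have d0' : (delta y \o phi) 0 = 0 by rewrite /= phi0.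
have h0' : (Hbar y \o phi) 0 = 0 by rewrite /= phi0.
have np : \forall z \near (0 : R2), X (delta y \o phi) (Hbar y \o phi) z =
    jacdet phi z * (X (delta y) (Hbar y) \o phi) z.
  have c := smooth_at_continuous sphi.
  have sn : nbhs (phi 0) [set z | smooth_at y z] by rewrite phi0; exact: smooth_near sy.
  apply: filterS2 (smooth_near sphi) (c _ sn) => z sp sz.
  exact: (pb_comp sp (smooth_delta sz) (smooth_Hbar sz)).
have p0' := nbhs_singleton np.
have tangency_part : X (delta y) (Hbar y) 0 = 0 -> tangency x = jacdet phi 0 ^+ 9 * tangency y.
  move=> pb0.
  have pc0 : (X (delta y) (Hbar y) \o phi) 0 = 0 by rewrite /= phi0.
  apply: (eq_trans (nbhs_singleton (pb_near eu ev nd (pb_near eu ev nd nh)))).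
  have p0 : X (delta y \o phi) (Hbar y \o phi) 0 = 0 by rewrite p0' pc0 mulr0.
  apply: (eq_trans (pb2_factor (sJn 2%N) sdp (sJn 3%N) shp d0' h0' p0)).
  have nd' : \forall z \near (0 : R2), (delta y \o phi) z = (delta y \o phi) z.
    exact: filterE.
  have sW := smooth_pb eu ev sd sh; have sWp := smooth_at_comp sphi sW.
  have E v : 'D_v (fun z => jacdet phi z * (X (delta y) (Hbar y) \o phi) z) 0 =
      jacdet phi 0 * 'D_v (X (delta y) (Hbar y) \o phi) 0.
    by apply: (eq_trans (DM v sJ sWp)); rewrite pc0 mulr0 add0r.
  have pJ : X (delta y \o phi) (fun z => jacdet phi z * (X (delta y) (Hbar y) \o phi) z) 0
      = jacdet phi 0 * X (delta y \o phi) (X (delta y) (Hbar y) \o phi) 0.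
    have H (a b c d j : R) : a * (j * b) - c * (j * d) = j * (a * b - c * d) by ring.
    apply: (eq_trans _ (H _ _ _ _ _)).
    exact: (congr2 (fun s t => 'D_eu (delta y \o phi) 0 * s - 'D_ev (delta y \o phi) 0 * t)
      (E ev) (E eu)).
  have pc : X (delta y \o phi) (X (delta y) (Hbar y) \o phi) 0 =
      jacdet phi 0 * X (delta y) (X (delta y) (Hbar y)) 0.
    exact: (eq_trans (pb_comp sphi sd sW) (congr1 (fun q => jacdet phi 0 *
      X (delta y) (X (delta y) (Hbar y)) q) phi0)).
  have H (j k t : R) : k = j * (j * t) -> (j ^+ 2) ^+ 2 * j ^+ 3 * k = j ^+ 9 * t.
    by move=> ->; ring.
  apply: H; apply: (eq_trans (nbhs_singleton (pb_near eu ev nd' np))).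
  exact: (eq_trans pJ (congr1 ( *%R (jacdet phi 0)) pc)).
have Ed v : 'D_v (delta x) 0 = jacdet phi 0 ^+ 2 * 'D_v (delta y \o phi) 0.
  apply: (eq_trans (derive_near v nd)); apply: (eq_trans (DM v (sJn 2%N) sdp)).
  by rewrite d0' mulr0 add0r.
have Eh v : 'D_v (Hbar x) 0 = jacdet phi 0 ^+ 3 * 'D_v (Hbar y \o phi) 0.
  apply: (eq_trans (derive_near v nh)); apply: (eq_trans (DM v (sJn 3%N) shp)).
  by rewrite h0' mulr0 add0r.
split.
- move=> [a b].
  have H v : 'D_v (delta x) 0 = 0.
    apply: (eq_trans (Ed v)); rewrite (derive_comp2 sphi v sd) phi0 a b.
    by rewrite !scaler0 addr0 mulr0.
  exact: conj (H eu) (H ev).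
- move=> [a b].
  have H v : 'D_v (Hbar x) 0 = 0.
    apply: (eq_trans (Eh v)); rewrite (derive_comp2 sphi v sh) phi0 a b.
    by rewrite !scaler0 addr0 mulr0.
  exact: conj (H eu) (H ev).
- have H (P j t h q d r : R) : h = 0 -> d = 0 -> P = j * t ->
      P * (j ^+ 2 * j ^+ 3) + h * q + d * r = j ^+ 6 * t.
    by move=> -> -> ->; ring.
  apply: (eq_trans (nbhs_singleton (pb_near eu ev nd nh))).
  apply: (eq_trans (pb_factor (sJn 2%N) sdp (sJn 3%N) shp)).
  exact: H h0' d0' (eq_trans p0' (congr1 (fun q => jacdet phi 0 *
    X (delta y) (Hbar y) q) phi0)).
- exact: tangency_part.
move=> r Ru Rv v; apply: (eq_trans (Eh v)).
have H (j r' a b s t s' t' h d D : R) : h = a * s' + b * t' -> d = a * s + b * t ->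
    s' = r' * s -> t' = r' * t -> D = j ^+ 2 * d -> j ^+ 3 * h = j * r' * D.
  by move=> -> -> -> -> ->; ring.
have Ru' : 'D_eu (Hbar y) (phi 0) = r * 'D_eu (delta y) (phi 0) :=
  eq_ind_r (fun q => 'D_eu (Hbar y) q = r * 'D_eu (delta y) q) Ru phi0.
have Rv' : 'D_ev (Hbar y) (phi 0) = r * 'D_ev (delta y) (phi 0) :=
  eq_ind_r (fun q => 'D_ev (Hbar y) q = r * 'D_ev (delta y) q) Rv phi0.
exact: (H _ _ _ _ _ _ _ _ _ _ _ (derive_comp2 sphi v sh) (derive_comp2 sphi v sd) Ru' Rv' (Ed v)).
Qed.

Lemma reparam_tangent_at x y : smooth_at x 0 -> smooth_at y 0 -> reparam x y ->
  tangent_at x -> tangent_at y.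
Proof.
move=> sx sy rxy [d0 rd h0 p0 K0].
have [J [J0 [Ed Eh EK Hj]]] := reparam_jets sy rxy.
have nJ n : J ^+ n != 0 by rewrite expf_neq0.
have d0' : delta y 0 = 0 by apply: (mulfI (nJ 2%N)); rewrite mulr0 -Ed.
have h0' : Hbar y 0 = 0 by apply: (mulfI (nJ 3%N)); rewrite mulr0 -Eh.
have [Hd _ Hp _ _] := Hj d0' h0'.
split.
- exact: d0'.
- apply/(regularP (smooth_diff (smooth_delta sy))) => /Hd dx.
  exact: (regularP (smooth_diff (smooth_delta sx))).1 rd dx.
- exact: h0'.
- by apply: (mulfI (nJ 6%N)); rewrite mulr0 -Hp.
- by apply: contraNneq K0 => K0; rewrite EK K0 mulr0.
Qed.

(** The weights 9, 1 and 4 of the factors add up to 14. An even weight is what makes the sign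
    independent of the orientation of the parameters. *)
Lemma reparam_sign x y : smooth_at x 0 -> smooth_at y 0 -> reparam x y ->
  tangent_at x -> tangent_at y -> exists2 k : R, 0 < k &
  tangency x * ratio x * gaussc x 0 = k * (tangency y * ratio y * gaussc y 0).
Proof.
move=> sx sy rxy Ax Ay; have [J [J0 [_ _ EK Hj]]] := reparam_jets sy rxy.
have [d0 _ h0 p0 _] := Ay; have [_ _ _ Ht Hr] := Hj d0 h0.
have [Eu Ev] := ratioE sy Ay; have [Eu' Ev'] := ratioE sx Ax.
have H (a b s t : R) : ~ (a = 0 /\ b = 0) -> s * a = t * a -> s * b = t * b -> s = t.
  move=> ab E1 E2; apply/eqP; rewrite -subr_eq0; apply/eqP; apply: contra_notP ab => /eqP st.
  by split; apply: (mulfI st); rewrite mulr0 mulrBl ?E1 ?E2 subrr.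
have [_ rd _ _ _] := Ax.
have Er : ratio x = J * ratio y.
  apply: (H _ _ _ _ ((regularP (smooth_diff (smooth_delta sx))).1 rd)).
    exact: eq_trans (esym Eu') (Hr _ Eu Ev eu).
  exact: eq_trans (esym Ev') (Hr _ Eu Ev ev).
exists (J ^+ 14); first by rewrite exprn_even_gt0.
rewrite (Ht p0) Er EK; move: (tangency y) (ratio y) (gaussc y 0) => b c d; ring.
Qed.

Lemma reparam_degenerate x y : smooth_at x 0 -> smooth_at y 0 -> reparam x y ->
  degenerate x -> degenerate y.
Proof.
move=> sx sy rxy [d0 h0 p0 C].
have [J [J0 [Ed Eh _ Hj]]] := reparam_jets sy rxy.
have nJ n : J ^+ n != 0 by rewrite expf_neq0.
have d0' : delta y 0 = 0 by apply: (mulfI (nJ 2%N)); rewrite mulr0 -Ed.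
have h0' : Hbar y 0 = 0 by apply: (mulfI (nJ 3%N)); rewrite mulr0 -Eh.
have [_ _ Hp Ht _] := Hj d0' h0'.
have p0' : X (delta y) (Hbar y) 0 = 0 by apply: (mulfI (nJ 6%N)); rewrite mulr0 -Hp.
split; [exact: d0'|exact: h0'|exact: p0'|].
case: C => [dH|t0]; last first.
  by right; apply: (mulfI (nJ 9%N)); rewrite mulr0 -Ht.
(* [reparam_jets] carries the vanishing of gradients from the second map to the first, hence the
   inverse reparametrization. *)
left; have [J' [_ [_ _ _ Hj']]] := reparam_jets sx (reparam_sym rxy).
by have [_ H _ _ _] := Hj' d0 h0; exact: H.
Qed.

End Invariance.

(** * Openness and density *)

Section JetContinuity.
Context {R : realType} {V : normedModType R} {T : topologicalType}.
Local Notation R3 := 'rV[R]_3.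
Implicit Types (F G : T -> V -> R) (X Y : T -> V -> R3).

(** Continuity, in the jet topology, of a germ depending on [t]; [T] will be the space of
    parametrizations or that of deformations. By the Leibniz rule the notion is stable under the
    operations that build the forms, so the equations between jets define closed sets. *)
Definition jet_cont F := (forall t, smooth_at (F t) 0) /\
  forall vs, continuous (fun t => iterD vs (F t) 0).

Lemma jet_cont_val F : jet_cont F -> continuous (fun t => F t 0).
Proof. by move=> [_ /(_ [::])]. Qed.

Lemma jet_cont_eq F G : (forall t, \forall z \near (0 : V), F t z = G t z) ->
  jet_cont F -> jet_cont G.
Proof.
move=> FG [sF cF]; split=> [t|vs]; first exact: smooth_eq (FG t) (sF t).
by rewrite -(_ : (fun t => iterD vs (F t) 0) = (fun t => iterD vs (G t) 0)) //;
   apply/funext => t; exact: iterD_eq.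
Qed.

Lemma jet_cont_cst (f : V -> R) : smooth_at f 0 -> jet_cont (fun=> f).
Proof. by move=> sf; split=> // vs; exact: cst_continuous. Qed.

Lemma iterD_addE (f g : V -> R) vs : smooth_at f 0 -> smooth_at g 0 ->
  iterD vs (fun z => f z + g z) 0 = iterD vs f 0 + iterD vs g 0.
Proof.
elim/last_ind: vs f g => [//|vs v IH] f g sf sg; rewrite !iterD_rcons.
rewrite -IH; [|exact: smooth_derive..].
apply: iterD_eq; apply: filterS2 (smooth_near sf) (smooth_near sg) => z.
exact: DD.
Qed.

Lemma jet_contD F G : jet_cont F -> jet_cont G -> jet_cont (fun t z => F t z + G t z).
Proof.
move=> [sF cF] [sG cG]; split=> [t|vs]; first exact: smoothD.
rewrite (_ : (fun t => _) = (fun t => iterD vs (F t) 0 + iterD vs (G t) 0)).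
  by move=> t; apply: cvgD; [exact: cF|exact: cG].
by apply/funext => t; exact: iterD_addE.
Qed.

Lemma jet_cont_D F v : jet_cont F -> jet_cont (fun t => 'D_v (F t)).
Proof.
move=> [sF cF]; split=> [t|vs]; first exact: smooth_derive.
by have := cF (rcons vs v); under eq_fun do rewrite iterD_rcons.
Qed.

Lemma jet_contM F G : jet_cont F -> jet_cont G -> jet_cont (fun t z => F t z * G t z).
Proof.
move=> jF jG; split=> [t|vs]; first by case: jF jG => sF _ [sG _]; exact: smoothM.
elim/last_ind: vs F G jF jG => [|vs v IH] F G jF jG.
  by move=> t; apply: cvgM; [exact: jet_cont_val jF t|exact: jet_cont_val jG t].
have H1 := IH _ _ (jet_cont_D v jF) jG; have H2 := IH _ _ jF (jet_cont_D v jG).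
have [sF _] := jF; have [sG _] := jG.
rewrite (_ : (fun t => _) = (fun t => iterD vs (fun z => 'D_v (F t) z * G t z) 0
   + iterD vs (fun z => F t z * 'D_v (G t) z) 0)).
  by move=> t; apply: cvgD; [exact: H1|exact: H2].
apply/funext => t; rewrite iterD_rcons -iterD_addE.
- apply: iterD_eq; apply: filterS (DM_near v (sF t) (sG t)) => z E; exact: esym.
- apply: smoothM (sG t); exact: smooth_derive.
- by apply: smoothM (sF t) _; exact: smooth_derive.
Qed.

Lemma jet_contN F : jet_cont F -> jet_cont (fun t z => - F t z).
Proof.
move=> jF; have s1 : smooth_at (fun _ : V => -1 : R) 0 by exact: smooth_cst.
apply: jet_cont_eq (jet_contM (jet_cont_cst s1) jF) => t; apply: filterE => z.
by rewrite mulN1r.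
Qed.

Lemma jet_contB F G : jet_cont F -> jet_cont G -> jet_cont (fun t z => F t z - G t z).
Proof. by move=> jF jG; apply: jet_contD => //; exact: jet_contN. Qed.

Lemma jet_cont_pb a b F G : jet_cont F -> jet_cont G ->
  jet_cont (fun t => pb a b (F t) (G t)).
Proof.
by move=> jF jG; apply: jet_contB; apply: jet_contM; exact: jet_cont_D.
Qed.

Definition jet_cont3 X := (forall t, smooth_at (X t) 0) /\
  forall i, jet_cont (fun t z => X t z 0 i).

Lemma jet_cont3_D X v : jet_cont3 X -> jet_cont3 (fun t => 'D_v (X t)).
Proof.
move=> [sX jX]; split=> [t|i]; first exact: smooth_derive.
apply: jet_cont_eq (jet_cont_D v (jX i)) => t.
by apply: filterS (smooth_near (sX t)) => z sz; rewrite Dcoord.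
Qed.

Lemma jet_cont_mink X Y : jet_cont3 X -> jet_cont3 Y ->
  jet_cont (fun t z => mink (X t z) (Y t z)).
Proof.
by move=> [_ jX] [_ jY]; apply: jet_contB; [apply: jet_contD|]; apply: jet_contM.
Qed.

Lemma jet_cont3_mcross X Y : jet_cont3 X -> jet_cont3 Y ->
  jet_cont3 (fun t z => mcross (X t z) (Y t z)).
Proof.
move=> [sX jX] [sY jY]; split=> [t|i]; first exact: smooth_mcross.
apply: (@jet_cont_eq (fun t z => [:: X t z 0 1 * Y t z 0 2 - X t z 0 2 * Y t z 0 1;
      X t z 0 2 * Y t z 0 0 - X t z 0 0 * Y t z 0 2;
      X t z 0 1 * Y t z 0 0 - X t z 0 0 * Y t z 0 1]`_i)).
  by move=> t; apply: filterE => z; rewrite mxE.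
by elim/ord3P: i => /=; apply: jet_contB; exact: jet_contM.
Qed.

Variables (a b : V) (X : T -> V -> R3).
Hypothesis jX : jet_cont3 X.

Let jE v : jet_cont (fun t => formE v (X t)).
Proof. by apply: jet_cont_mink; exact: jet_cont3_D. Qed.
Let jF : jet_cont (fun t => formF a b (X t)).
Proof. by apply: jet_cont_mink; exact: jet_cont3_D. Qed.
Let jform v w : jet_cont (fun t z =>
  mink (mcross ('D_a (X t) z) ('D_b (X t) z)) ('D_w ('D_v (X t)) z)).
Proof.
apply: jet_cont_mink; first by apply: jet_cont3_mcross; exact: jet_cont3_D.
exact: jet_cont3_D (jet_cont3_D v jX).
Qed.

Lemma jet_cont_disc : jet_cont (fun t => disc a b (X t)).
Proof. exact: jet_contB (jet_contM jF jF) (jet_contM (jE a) (jE b)). Qed.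

Lemma jet_cont_hbar : jet_cont (fun t => hbar a b (X t)).
Proof.
have j2 : jet_cont (fun _ : T => fun _ : V => 2 : R) by apply/jet_cont_cst/smooth_cst.
exact: jet_contD (jet_contB (jet_contM (jform a a) (jE b))
  (jet_contM (jet_contM j2 (jform a b)) jF)) (jet_contM (jform b b) (jE a)).
Qed.

End JetContinuity.

Section Openness.
Variable R : realType.
Local Notation R2 := 'rV[R]_2.
Local Notation R3 := 'rV[R]_3.
Local Notation X := (pb eu ev).

Lemma param_smooth (x : param R) : smooth_at (fun_of_param x) 0.
Proof. by have [] := set_valP (x : @local_params R). Qed.

Lemma param_jet_cont vs : continuous (fun x : param R => iterD vs (fun_of_param x) 0).
Proof.
have c1 : continuous (fun x : param R => jet 0 (fun_of_param x)).
  exact: initial_continuous.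
have c2 := @proj_continuous _ (fun _ : seq R2 => R3 : topologicalType) vs.
by move=> x; exact: (continuous_comp (c1 x) (c2 _)).
Qed.

Lemma iterD_coord (V : normedModType R) n (x : V -> 'rV[R]_n) i vs : smooth_at x 0 ->
  iterD vs (fun z => x z 0 i) 0 = iterD vs x 0 0 i.
Proof.
elim/last_ind: vs x => [//|vs v IH] x sx; rewrite !iterD_rcons -IH; last exact: smooth_derive.
by apply: iterD_eq; apply: filterS (smooth_near sx) => z sz; rewrite Dcoord.
Qed.

Lemma param_jet_cont3 : jet_cont3 (@fun_of_param R).
Proof.
split=> [x|i]; first exact: param_smooth.
split=> [x|vs]; first exact/smooth_coord/param_smooth.
rewrite (_ : (fun x => _) = (fun M : R3 => M 0 i) \o (fun x => iterD vs (fun_of_param x) 0)).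
  by move=> x; apply: continuous_comp; [exact: param_jet_cont|exact: coord_continuous].
by apply/funext => x; exact: iterD_coord (param_smooth x).
Qed.

Lemma closed_zero (T : topologicalType) (F : T -> R) : continuous F ->
  closed [set t | F t = 0].
Proof.
by move=> cF; apply: (@closed_comp _ _ F [set y | y = 0]) => [t _|]; [exact: cF|exact: closed_eq].
Qed.

Lemma closed_degenerate : closed [set x : param R | degenerate (fun_of_param x)].
Proof.
have jd : jet_cont (fun x : param R => delta (fun_of_param x)).
  exact: (jet_cont_disc eu ev param_jet_cont3).
have jh : jet_cont (fun x : param R => Hbar (fun_of_param x)).
  exact: (jet_cont_hbar eu ev param_jet_cont3).
have jp := jet_cont_pb eu ev jd jh.
have H (F : param R -> R2 -> R) (jF : jet_cont F) := closed_zero (jet_cont_val jF).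
have C := closedI (H _ jd) (closedI (H _ jh) (closedI (H _ jp)
  (closedU (closedI (H _ (jet_cont_D eu jh)) (H _ (jet_cont_D ev jh)))
    (H _ (jet_cont_pb eu ev jd jp))))).
apply: (eq_ind _ closed C); apply/seteqP; split=> x /=.
  by move=> [p1 [p2 [p3 p4]]]; exact: And4 p1 p2 p3 p4.
by move=> [p1 p2 p3 p4]; exact: conj p1 (conj p2 (conj p3 p4)).
Qed.

Local Open Scope quotient_scope.

Lemma pi_eqP (x y : param R) :
  \pi_(surface_germ R) x = \pi_(surface_germ R) y <-> reparam (fun_of_param x) (fun_of_param y).
Proof.
have P := @eqmodP _ (@reparam_equiv R) x y.
split=> [E|xy]; first by have /P/asboolP : x = y %[mod {eq_quot (@reparam_equiv R)}] by exact: E.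
have /P E : reparamb x y by apply/asboolP.
exact: E.
Qed.

End Openness.

(** * Lines of perturbed germs *)

Section Lines.
Context {R : realType}.

Lemma iterD_bump (V W : normedModType R) (x : V -> W) (P : V -> R) (e : W) (eps : R) vs :
  smooth_at x 0 -> smooth_at P 0 ->
  iterD vs (bump x (fun z => eps * P z) e) 0 = iterD vs x 0 + (eps * iterD vs P 0) *: e.
Proof.
elim/last_ind: vs x P => [//|vs v IH] x P sx sP; rewrite !iterD_rcons.
have sc : smooth_at (fun _ : V => eps) 0 by exact: smooth_cst.
rewrite -IH; [|exact: smooth_derive..].
apply: iterD_eq; apply: filterS2 (D_bump_near e v sx (smoothM sc sP)) (smooth_near sP).
by move=> z -> sPz; rewrite /bump DMl.
Qed.

(** Each derivative at 0 is affine in [eps], and continuity into the product topology on jets is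
    checked one derivative at a time. *)
Lemma jet_line_continuous (T : topologicalType) (V W : normedModType R)
    (c : R -> T) (j : T -> V -> W) (x : V -> W) (P : V -> R) (e : W) :
  smooth_at x 0 -> smooth_at P 0 ->
  (forall eps, j (c eps) = bump x (fun z => eps * P z) e) ->
  continuous (fun eps => jet 0 (j (c eps))).
Proof.
move=> sx sP jc t.
have cvs vs : {for t, continuous (fun eps => iterD vs (j (c eps)) 0)}.
  have E eps : iterD vs (j (c eps)) 0 = iterD vs x 0 + (eps * iterD vs P 0) *: e.
    by rewrite jc; exact: iterD_bump.
  rewrite /prop_for (funext E); apply: cvgD; first exact: cvg_cst.
  apply: cvgZ; last exact: cvg_cst.
  by apply: cvgM; [exact: cvg_id|exact: cvg_cst].
apply/cvg_sup => vs U [_] [[C oC <-]] Ct CU.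
have nC : nbhs (iterD vs (j (c t)) 0) C by apply: open_nbhs_nbhs; split.
have nU : \forall eps \near t, C (iterD vs (j (c eps)) 0) by exact: (cvs vs _ nC).
suff : \forall eps \near t, U (jet 0 (j (c eps))) by [].
by apply: filterS nU => eps Ceps; exact: CU.
Qed.

Lemma small_shift (k r : R) : k != 0 ->
  \forall eps \near (0 : R), eps != 0 -> r + eps * k != 0.
Proof.
move=> k0; have [->|r0] := eqVneq r 0.
  by apply: filterE => eps eps0; rewrite add0r mulf_neq0.
have H : \forall eps \near (0 : R), `|eps| < `|r| / `|k|.
  by apply: nbhs0_lt; rewrite divr_gt0 ?normr_gt0.
apply: filterS H => eps; rewrite ltr_pdivlMr ?normr_gt0 // -normrM => H _.
apply: contraTneq H => E; rewrite -leNgt; suff -> : eps * k = - r by rewrite normrN.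
by apply/eqP; rewrite -addr_eq0 addrC E.
Qed.

End Lines.

Section ParamLine.
Context {R : realType}.
Local Notation R2 := 'rV[R]_2.
Local Notation R3 := 'rV[R]_3.
Local Open Scope quotient_scope.

(** A perturbation vanishing to order 2 keeps the differential at 0, hence its injectivity. *)
Lemma flat2_bump_params (x : param R) (P : R2 -> R) (e : R3) (eps : R) : flat 2 P ->
  @local_params R (bump (fun_of_param x) (fun z => eps * P z) e).
Proof.
move=> fP; have sP := flat_smooth fP.
have sx := param_smooth x; have [_ ix] := set_valP (x : @local_params R).
have sc : smooth_at (fun _ : R2 => eps) 0 by exact: smooth_cst.
have sb : smooth_at (bump (fun_of_param x) (fun z => eps * P z) e) 0.
  exact: smooth_bump sx (smoothM sc sP).
split; first exact: sb.
move=> v; have D0 : 'D_v (fun z => eps * P z) 0 = 0.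
  by rewrite DMl // (flat_Dval v fP) mulr0.
have -> : 'd (bump (fun_of_param x) (fun z => eps * P z) e) 0 v = 'd (fun_of_param x) 0 v.
  apply: (eq_trans (esym (deriveE v (smooth_diff sb)))).
  apply: (eq_trans (D_bump e v sx (smoothM sc sP))).
  apply: (eq_trans _ (deriveE v (smooth_diff sx))).
  by rewrite /bump D0 scale0r addr0.
exact: ix.
Qed.

Lemma param_line (x : param R) (P : R2 -> R) (e : R3) : flat 2 P ->
  exists2 c : R -> param R, continuous c &
    forall eps, fun_of_param (c eps) = bump (fun_of_param x) (fun z => eps * P z) e.
Proof.
move=> fP; pose c eps : param R := SigSub (mem_set (flat2_bump_params x e eps fP)).
exists c => //; apply: continuous_comp_initial.
have cE eps : fun_of_param (c eps) = bump (fun_of_param x) (fun z => eps * P z) e by [].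
have H := @jet_line_continuous R (param R) R2 R3 c (@fun_of_param R) _ P e
  (param_smooth x) (flat_smooth fP) cE.
exact: H.
Qed.

(** The common form of the density arguments: the line of perturbed germs is continuous, so a
    neighbourhood of the class of [x] contains those of all small parameters, and one of these is
    nonzero. *)
Lemma closure_line (x : param R) (P : R2 -> R) (e : R3) (S : set (surface_germ R)) :
  flat 2 P ->
  (\forall eps \near (0 : R), eps != 0 -> forall y : param R,
    fun_of_param y = bump (fun_of_param x) (fun z => eps * P z) e ->
    S (\pi_(surface_germ R) y)) ->
  closure S (\pi_(surface_germ R) x).
Proof.
move=> fP nS B nB; have [c cc cE] := param_line x e fP.
have c0 : \pi_(surface_germ R) (c 0) = \pi_(surface_germ R) x.
  apply/pi_eqP; rewrite cE (_ : bump _ _ _ = fun_of_param x); first exact: reparam_refl.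
  by apply/funext => z; rewrite /bump mul0r scale0r addr0.
have cpi : continuous (fun eps => \pi_(surface_germ R) (c eps)).
  by move=> eps; apply: continuous_comp (cc eps) _; exact: pi_continuous.
have nB' : \forall eps \near (0 : R), B (\pi_(surface_germ R) (c eps)).
  by apply: cpi; rewrite c0.
have /nbhs_norm0P[r /= r0 Hr] : \forall eps \near (0 : R),
    B (\pi_(surface_germ R) (c eps)) /\ (eps != 0 -> forall y : param R,
    fun_of_param y = bump (fun_of_param x) (fun z => eps * P z) e ->
    S (\pi_(surface_germ R) y)) by exact: filterI.
have rr : `|r / 2| < r.
  by rewrite gtr0_norm ?divr_gt0 // ltr_pdivrMr // mulr_natr mulr2n ltrDl.
have [Bc Sc] := Hr (r / 2) rr.
exists (\pi_(surface_germ R) (c (r / 2))); split=> //.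
by apply: Sc; rewrite ?cE // gt_eqF // divr_gt0.
Qed.

End ParamLine.

Section LinearForms.
Context {R : realType} {V : normedModType R}.
Implicit Types (l P Q : V -> R) (a b v z : V).

Definition lin_form l := (forall z, smooth_at l z) /\ (forall v z, 'D_v l z = l v) /\ l 0 = 0.

Lemma D_linX l n c v z : lin_form l ->
  'D_v (fun z => c * l z ^+ n.+1) z = (c * n.+1%:R * l v) * l z ^+ n.
Proof.
move=> [sl [Dl _]]; elim: n z c => [|n IH] z c.
  by rewrite DMl ?expr0 ?Dl ?mulr1 //; exact: smoothX.
rewrite (_ : (fun z => _) = fun z => l z * (c * l z ^+ n.+1)); last first.
  by apply/funext => y; rewrite [in LHS]exprS mulrCA.
rewrite DM //; last first.
  by apply: smoothM; [exact: smooth_cst|exact: smoothX].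
by rewrite IH Dl [l z ^+ n.+1]exprS; move: (l z ^+ n) => k; rewrite -[n.+2%:R]natr1; ring.
Qed.

Lemma flat_linX l n c : lin_form l -> flat n (fun z => c * l z ^+ n).
Proof.
move=> [sl [Dl l0]]; apply: flatMl; first exact: smooth_cst.
exact/flatX/flat1.
Qed.

Definition quad E F G l a b : R := G * l a ^+ 2 - 2 * F * (l a * l b) + E * l b ^+ 2.

(** The derivatives of [l] are constant, so a second order operator lowers the power by two and
    multiplies by the value of its symbol on [l]. *)
Lemma d2form_linX a b E F G l n c z : lin_form l ->
  d2form a b E F G (fun z => c * l z ^+ n.+2) z =
  (c * n.+2%:R * n.+1%:R * quad E F G l a b) * l z ^+ n.
Proof.
move=> ll; have E2 v w : 'D_w ('D_v (fun z => c * l z ^+ n.+2)) z =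
    (c * n.+2%:R * l v * n.+1%:R * l w) * l z ^+ n.
  have -> : 'D_v (fun z => c * l z ^+ n.+2) = fun z => (c * n.+2%:R * l v) * l z ^+ n.+1.
    by apply/funext => y; exact: D_linX.
  exact: D_linX.
by rewrite /d2form !E2 /quad; ring.
Qed.

Lemma d2formD a b E F G P Q : smooth_at P 0 -> smooth_at Q 0 ->
  \forall z \near (0 : V), d2form a b E F G (fun z => P z + Q z) z =
    d2form a b E F G P z + d2form a b E F G Q z.
Proof.
move=> sP sQ.
have sn : \forall z \near (0 : V), smooth_at P z /\ smooth_at Q z.
  exact: filterI (smooth_near sP) (smooth_near sQ).
have D1 v : \forall z \near (0 : V), 'D_v (fun z => P z + Q z) z = 'D_v P z + 'D_v Q z.
  by apply: filterS sn => z [sPz sQz]; exact: DD.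
have D2 v w : \forall z \near (0 : V),
    'D_w ('D_v (fun z => P z + Q z)) z = 'D_w ('D_v P) z + 'D_w ('D_v Q) z.
  apply: filterS2 (near_derive1 w (D1 v)) sn => z E1 [sPz sQz].
  exact: (eq_trans E1 (DD w (smooth_derive v sPz) (smooth_derive v sQz))).
apply: filterS (filterI (D2 a a) (filterI (D2 a b) (D2 b b))) => z [e1 [e2 e3]].
rewrite /d2form e1 e2 e3.
have H (x1 x2 x3 y1 y2 y3 : R) : G * (x1 + y1) - 2 * F * (x2 + y2) + E * (x3 + y3) =
  (G * x1 - 2 * F * x2 + E * x3) + (G * y1 - 2 * F * y2 + E * y3) by ring.
exact: H.
Qed.

End LinearForms.

Section NullForms.
Context {R : realType}.
Implicit Types (E F G p q : R).

Definition qf E F G p q := G * p ^+ 2 - 2 * F * (p * q) + E * q ^+ 2.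

(** The form [qf E F G] has rank one, hence is nonzero outside a line of covectors; two independent
    covectors are picked off that line. *)
Lemma qf_basis E F G : F ^+ 2 - E * G = 0 -> ~ (E = 0 /\ G = 0) ->
  exists p q p' q', [/\ p * q' - q * p' != 0, qf E F G p q != 0 & qf E F G p' q' != 0].
Proof.
move=> dEFG EG0; have [G0|G0] := eqVneq G 0.
  have E0 : E != 0 by apply/eqP => E0; apply: EG0.
  have F0 : F = 0 by move/eqP: dEFG; rewrite G0 mulr0 subr0 sqrf_eq0 => /eqP.
  exists 0, 1, 1, 1; rewrite /qf G0 F0; split.
  - by rewrite (_ : 0 * 1 - 1 * 1 = -1 :> R) ?oppr_eq0 ?oner_neq0 //; ring.
  - by rewrite (_ : _ + _ = E) //; ring.
  - by rewrite (_ : _ + _ = E) //; ring.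
have [E0|E0] := eqVneq E 0.
  have F0 : F = 0 by move/eqP: dEFG; rewrite E0 mul0r subr0 sqrf_eq0 => /eqP.
  exists 1, 0, 1, 1; rewrite /qf E0 F0; split.
  - by rewrite (_ : 1 * 1 - 0 * 1 = 1 :> R) ?oner_neq0 //; ring.
  - by rewrite (_ : _ + _ = G) //; ring.
  - by rewrite (_ : _ + _ = G) //; ring.
exists 1, 0, 0, 1; rewrite /qf; split.
- by rewrite (_ : 1 * 1 - 0 * 0 = 1 :> R) ?oner_neq0 //; ring.
- by rewrite (_ : _ + _ = G) //; ring.
- by rewrite (_ : _ + _ = E) //; ring.
Qed.

Lemma exists_transverse (c : 'rV[R]_3) : c != 0 -> exists e, mink c e != 0.
Proof.
(* Changing the sign of the timelike coordinate turns the Minkowski product with [c] into the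
   Euclidean square of [c]. *)
move=> c0; exists (\row_j [:: c 0 0; c 0 1; - c 0 2]`_j).
rewrite /mink !mxE /= mulrN opprK -!expr2.
apply: contraNneq c0 => E.
have s0 := sqr_ge0 (c 0 0); have s1 := sqr_ge0 (c 0 1); have s2 := sqr_ge0 (c 0 2).
apply/eqP/rowP; apply: ord3P; rewrite mxE; apply/eqP; rewrite -sqrf_eq0; apply/eqP; lra.
Qed.

Lemma tangency_arith (A B p q m C eps a b x1 x2 x3 x4 : R) : a = A -> b = B ->
  x1 = eps * m * C * 2 * q * q -> x2 = eps * m * C * 2 * p * q ->
  x3 = eps * m * C * 2 * q * p -> x4 = eps * m * C * 2 * p * p ->
  a * (a * x1 - b * x2) - b * (a * x3 - b * x4) =
  eps * (m * C * 2 * (A * q - B * p) ^+ 2).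
Proof. by move=> -> -> -> -> -> ->; ring. Qed.

End NullForms.

(** * Perturbations shifting the ratio and the tangency *)

Section SurfaceBump.
Context {R : realType}.
Local Notation R2 := 'rV[R]_2.
Local Notation R3 := 'rV[R]_3.
Local Notation X := (pb eu ev).

Lemma pb2_add (d f g : R2 -> R) : smooth_at d 0 -> smooth_at f 0 -> smooth_at g 0 ->
  X d (X d (fun z => f z + g z)) 0 = X d (X d f) 0 + X d (X d g) 0.
Proof.
have pb_add (h k : R2 -> R) z : smooth_at h z -> smooth_at k z ->
    X d (fun z => h z + k z) z = X d h z + X d k z.
  move=> sh sk; rewrite /pb !DD //.
  have H (a b x1 x2 y1 y2 : R) : a * (x1 + y1) - b * (x2 + y2) =
    (a * x1 - b * x2) + (a * y1 - b * y2) by ring.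
  exact: H.
move=> sd sf sg; have nE : \forall z \near (0 : R2),
    X d (fun z => f z + g z) z = X d f z + X d g z.
  by apply: filterS2 (smooth_near sf) (smooth_near sg) => z sfz sgz; exact: pb_add.
have nd : \forall z \near (0 : R2), d z = d z by exact: filterE.
apply: (eq_trans (nbhs_singleton (pb_near eu ev nd nE))).
exact: pb_add (smooth_pb eu ev sd sf) (smooth_pb eu ev sd sg).
Qed.

Lemma D2_linX (V : normedModType R) (l : V -> R) c v w z : lin_form l ->
  'D_w ('D_v (fun z => c * l z ^+ 2)) z = c * 2 * l v * l w.
Proof.
move=> ll; have -> : 'D_v (fun z => c * l z ^+ 2) = fun z => (c * 2%:R * l v) * l z ^+ 1.
  by apply/funext => y; exact: D_linX.
by rewrite D_linX // expr0 !mulr1.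
Qed.

Definition ell (p q : R) (u : R2) := p * u 0 0 + q * u 0 1.

Lemma ell_lin p q : lin_form (ell p q).
Proof.
have sid z : smooth_at (id : R2 -> R2) z by exact: smooth_at_id.
have sc i z : smooth_at (fun u : R2 => u 0 i) z by exact: smooth_coord (sid z).
have Dc i v z : 'D_v (fun u : R2 => u 0 i) z = v 0 i.
  by rewrite -(Dcoord i v (sid z)) derive_id.
have s1 z : smooth_at (fun u : R2 => p * u 0 0) z by apply: smoothM => //; exact: smooth_cst.
have s2 z : smooth_at (fun u : R2 => q * u 0 1) z by apply: smoothM => //; exact: smooth_cst.
split; [by move=> z; exact: smoothD|split=> [v z|]].
  by rewrite /ell DD // !DMl // !Dc.
by rewrite /ell !mxE !mulr0 addr0.
Qed.

Lemma ell_eu p q : ell p q eu = p. Proof. by rewrite /ell !euvE mulr1 mulr0 addr0. Qed.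
Lemma ell_ev p q : ell p q ev = q. Proof. by rewrite /ell !euvE mulr1 mulr0 add0r. Qed.

Variable x : R2 -> R3.
Hypotheses (sx : smooth_at x 0) (Ax : tangent_at x).
Let c := mcross ('D_eu x 0) ('D_ev x 0).
Let E := formE eu x 0.
Let F := formF eu ev x 0.
Let G := formE ev x 0.

Lemma cross_neq0 : c != 0.
Proof.
have [_ _ _ _ K0] := Ax; apply: contraNneq K0 => c0.
have z w : mink c w = 0 by rewrite c0 /mink !mxE !mul0r addr0 subr0.
have H (l m n : R) : l = 0 -> m = 0 -> l * n - m ^+ 2 = 0.
  by move=> -> ->; rewrite mul0r expr0n subrr.
by apply/eqP; exact: (H _ _ _ (z _) (z _)).
Qed.

(** Otherwise E, F and G all vanish at 0, and F^2 - E G has a vanishing differential there, against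
    the regularity of the LD. *)
Lemma forms_nonzero : ~ (E = 0 /\ G = 0).
Proof.
move=> [E0 G0]; have [d0 rd _ _ _] := Ax.
have F0 : F = 0.
  have : F ^+ 2 - E * G = 0 by exact: d0.
  by rewrite E0 mul0r subr0 => /eqP; rewrite sqrf_eq0 => /eqP.
have fE := flat1 (smooth_formE eu sx) E0.
have fG := flat1 (smooth_formE ev sx) G0.
have fF := flat1 (smooth_formF eu ev sx) F0.
have fd : flat 2 (delta x) by exact: flatB (flatX 2 fF) (flatM fE fG).
apply: (regularP (smooth_diff (smooth_delta sx))).1 rd _.
exact: conj (flat_Dval eu fd) (flat_Dval ev fd).
Qed.

Lemma tangent_basis : exists p q p' q', [/\ p * q' - q * p' != 0,
  qf E F G p q != 0 & qf E F G p' q' != 0].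
Proof. by apply: qf_basis forms_nonzero; have [] := Ax. Qed.

Let Q (P : R2 -> R) : R2 -> R := d2form eu ev E F G P.

Lemma smooth_d2form P : smooth_at P 0 -> smooth_at (Q P) 0.
Proof.
move=> sP; have s2 v w : smooth_at ('D_w ('D_v P)) 0.
  exact: smooth_derive (smooth_derive _ sP).
apply: smoothD; last exact: smoothM (smooth_cst _ _) (s2 ev ev).
apply: smoothB; first exact: smoothM (smooth_cst _ _) (s2 eu eu).
exact: smoothM (smooth_cst _ _) (s2 eu ev).
Qed.

Let cong_hbar_bump P e k : flat k.+2 P -> cong k.+1 (Hbar (bump x P e))
  (fun z => Hbar x z + mink c e * Q P z).
Proof. by move=> fP; exact: (bump_hbar eu ev e sx fP). Qed.

Let cong_delta_bump P e k : flat k.+2 P -> cong k.+1 (delta (bump x P e)) (delta x).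
Proof. by move=> fP; exact: (bump_disc eu ev e sx fP). Qed.

(** At order 3 the 1-jet of [delta] and the value of [gaussc] are kept, and the differential of
    [Hbar] gains that of <c, e> Q P. If the gain is [mu] times that of [delta], the two gradients
    stay parallel and their ratio moves by [mu]. *)
Lemma tangent_bump P e (mu : R) : flat 3 P -> Q P 0 = 0 ->
  (forall v, mink c e * 'D_v (Q P) 0 = mu * 'D_v (delta x) 0) ->
  tangent_at (bump x P e) /\ ratio (bump x P e) = ratio x + mu.
Proof.
move=> fP Q0 DQ; have sP := flat_smooth fP.
have sd := smooth_delta sx; have sh := smooth_Hbar sx.
have sy : smooth_at (bump x P e) 0 by exact: smooth_bump sx sP.
have cd := cong_delta_bump e fP; have ch := cong_hbar_bump e fP.
have cg : cong 1 (gaussc (bump x P e)) (gaussc x) := bump_gauss eu ev e sx fP.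
have [d0 rd h0 p0 K0] := Ax; have [Eu Ev] := ratioE sx Ax.
have Ed v : 'D_v (delta (bump x P e)) 0 = 'D_v (delta x) 0 := cong_Dval v cd.
have sc : smooth_at (fun _ : R2 => mink c e) 0 by exact: smooth_cst.
have sQ := smooth_d2form sP.
have Eh v : 'D_v (Hbar (bump x P e)) 0 = 'D_v (Hbar x) 0 + mu * 'D_v (delta x) 0.
  apply: (eq_trans (cong_Dval v ch)); apply: (eq_trans (DD v sh (smoothM sc sQ))).
  exact: (congr1 (fun t => 'D_v (Hbar x) 0 + t) (eq_trans (DMl (mink c e) v sQ) (DQ v))).
have Ehu : 'D_eu (Hbar (bump x P e)) 0 = (ratio x + mu) * 'D_eu (delta x) 0.
  by apply: (eq_trans (Eh eu)); rewrite Eu mulrDl.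
have Ehv : 'D_ev (Hbar (bump x P e)) 0 = (ratio x + mu) * 'D_ev (delta x) 0.
  by apply: (eq_trans (Eh ev)); rewrite Ev mulrDl.
have d0' : delta (bump x P e) 0 = 0 := eq_trans (cong_val cd) d0.
have g0 := grad2_gt0 sd rd.
split; last first.
  have H (a b r m : R) : 0 < a ^+ 2 + b ^+ 2 -> m = a ^+ 2 + b ^+ 2 ->
      ((r * a) * a + (r * b) * b) / m = r.
    move=> ab ->; rewrite (_ : _ + _ = r * (a ^+ 2 + b ^+ 2)); last by ring.
    by rewrite mulfK // gt_eqF.
  have Eg : grad2 (delta (bump x P e)) 0 = grad2 (delta x) 0.
    exact: (congr2 (fun s t => s ^+ 2 + t ^+ 2) (Ed eu) (Ed ev)).
  apply: (eq_trans _ (H ('D_eu (delta x) 0) ('D_ev (delta x) 0) _ _ g0 Eg)).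
  exact: (congr1 (fun s => s / grad2 (delta (bump x P e)) 0)
    (congr2 +%R (congr2 *%R Ehu (Ed eu)) (congr2 *%R Ehv (Ed ev)))).
split.
- exact: d0'.
- apply/(regularP (smooth_diff (smooth_delta sy))) => -[a b].
  apply: (regularP (smooth_diff sd)).1 rd _.
  exact: conj (eq_trans (esym (Ed eu)) a) (eq_trans (esym (Ed ev)) b).
- by apply: (eq_trans (cong_val ch)); rewrite h0 Q0 mulr0 addr0.
- have H (a b r : R) : a * (r * b) - b * (r * a) = 0 by ring.
  apply: (eq_trans _ (H ('D_eu (delta x) 0) ('D_ev (delta x) 0) (ratio x + mu))).
  rewrite /pb.
  have E1 := congr2 *%R (Ed eu) Ehv.
  have E2 := congr2 *%R (Ed ev) Ehu.
  exact: (congr2 (fun s t : R => s - t) E1 E2).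
- by rewrite (cong_val cg).
Qed.

(** A cubic is wanted whose image under [Q] is the linear part of [delta]. [Q] sends the cube of a
    linear form to a multiple of this form, so two independent forms with nonzero multiples
    suffice. *)
Lemma ratio_bump : exists P e, flat 3 P /\ exists2 k : R, k != 0 & forall eps,
  tangent_at (bump x (fun z => eps * P z) e) /\
  ratio (bump x (fun z => eps * P z) e) = ratio x + eps * k.
Proof.
have [p [q [p' [q' [D0 Q1 Q2]]]]] := tangent_basis.
have [e e0] := exists_transverse cross_neq0.
have [A EA] : exists A, 'D_eu (delta x) 0 = A by exists ('D_eu (delta x) 0).
have [B EB] : exists B, 'D_ev (delta x) 0 = B by exists ('D_ev (delta x) 0).
(* Cramer's rule expresses (A, B) in the basis (p, q), (p', q'); the 6 is 3 * 2, from the second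
   derivatives of a cube. *)
pose a := (A * q' - B * p') / (p * q' - q * p') / (6 * qf E F G p q).
pose b := (p * B - q * A) / (p * q' - q * p') / (6 * qf E F G p' q').
pose P z := a * ell p q z ^+ 3 + b * ell p' q' z ^+ 3.
have l1 := ell_lin p q; have l2 := ell_lin p' q'.
have f1 := flat_linX 3 a l1; have f2 := flat_linX 3 b l2.
have fP : flat 3 P by exact: flatD f1 f2.
have QP : \forall z \near (0 : R2), Q P z = A * z 0 0 + B * z 0 1.
  apply: filterS (d2formD eu ev E F G (flat_smooth f1) (flat_smooth f2)) => z Ez.
  apply: (eq_trans Ez).
  apply: (eq_trans (congr2 +%R (d2form_linX eu ev E F G 1 a z l1)
    (d2form_linX eu ev E F G 1 b z l2))).
  rewrite /quad !ell_eu !ell_ev -!/(qf E F G _ _) /a /b !expr1 /ell.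
  move: (qf E F G p q) (qf E F G p' q') Q1 Q2 => s t s0 t0.
  by field; rewrite D0 s0 t0.
have [sl [Dl l0]] := ell_lin A B.
have DQ v : 'D_v (Q P) 0 = 'D_v (delta x) 0.
  apply: (eq_trans (derive_near v (QP : \forall z \near (0 : R2), Q P z = ell A B z))).
  rewrite Dl derive_row2; last exact/smooth_diff/smooth_delta.
  by rewrite EA EB /ell /GRing.scale /= mulrC [B * _]mulrC.
exists P, e; split; first exact: fP.
exists (mink c e); [exact: e0|move=> eps].
(* The factor [eps] moves to the direction, so that [P] stays fixed and [mu] is proportional to
   [eps]. *)
have -> : bump x (fun z => eps * P z) e = bump x P (eps *: e).
  by apply/funext => z; rewrite /bump scalerA [P z * _]mulrC.
apply: tangent_bump; [exact: fP| |move=> v].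
  by apply: (eq_trans (nbhs_singleton QP)); rewrite !mxE !mulr0 addr0.
have E1 : mink c (eps *: e) = eps * mink c e by exact: minkZr.
exact: (congr2 (fun s t : R => s * t) E1 (DQ v)).
Qed.

(** At order 4 the 2-jet of [delta] and the 1-jet of [Hbar] are kept, while the 2-jet of [Hbar]
    gains a multiple of the square of the linear form. *)
Lemma tangency_bump : exists P e, flat 4 P /\ exists2 k : R, k != 0 & forall eps,
  let y := bump x (fun z => eps * P z) e in
  [/\ tangent_at y, ratio y = ratio x, gaussc y 0 = gaussc x 0 &
      tangency y = tangency x + eps * k].
Proof.
have [e e0] := exists_transverse cross_neq0.
have [A EA] : exists A, 'D_eu (delta x) 0 = A by exists ('D_eu (delta x) 0).
have [B EB] : exists B, 'D_ev (delta x) 0 = B by exists ('D_ev (delta x) 0).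
have sd := smooth_delta sx; have sh := smooth_Hbar sx.
(* The linear form must also be nonzero on the tangent (- B, A) of the LD, for its square to be seen
   along the curve. Two independent forms cannot both vanish there. *)
have [p [q [Q1 pq]]] : exists p q, qf E F G p q != 0 /\ A * q - B * p != 0.
  have [p [q [p' [q' [D0 Q1 Q2]]]]] := tangent_basis.
  have [E1|E1] := eqVneq (A * q - B * p) 0; last by exists p, q.
  exists p', q'; split; [exact: Q2|apply/eqP => E2].
  have [_ rd _ _ _] := Ax; apply: (regularP (smooth_diff sd)).1 rd _.
  rewrite EA EB; split; apply: (mulIf D0); rewrite mul0r.
    transitivity (p * (A * q' - B * p') - p' * (A * q - B * p)); first by ring.
    by rewrite E1 E2 !mulr0 subr0.
  transitivity (q * (A * q' - B * p') - q' * (A * q - B * p)); first by ring.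
  by rewrite E1 E2 !mulr0 subr0.
have ll := ell_lin p q; have [sl [Dl l0]] := ll.
have fP := flat_linX 4 1 ll; pose P z := 1 * ell p q z ^+ 4.
pose C := 1 * 4%:R * 3%:R * quad E F G (ell p q) eu ev.
have QP z : Q P z = C * ell p q z ^+ 2 by exact: d2form_linX.
exists P, e; split; first exact: fP.
pose k := mink c e * C * 2 * (A * q - B * p) ^+ 2.
have C0 : C != 0.
  rewrite /C /quad ell_eu ell_ev -/(qf E F G p q) !mulf_neq0 ?pnatr_eq0 ?oner_neq0 //.
exists k.
  have H (a b d : R) : a != 0 -> b != 0 -> d != 0 -> a * b * 2 * d ^+ 2 != 0.
    by move=> a0 b0 d0; rewrite !mulf_neq0 ?pnatr_eq0 // expf_neq0.
  exact: H.
move=> eps y.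
have yE : y = bump x P (eps *: e).
  by apply/funext => z; rewrite /y /bump scalerA [P z * _]mulrC.
have fQ : flat 2 (Q P) by apply: flat_ext (flat_linX 2 C ll) => z; rewrite QP.
have DQ v : 'D_v (Q P) 0 = 0 by exact: flat_Dval fQ.
have [|||Ty ry] := @tangent_bump P (eps *: e) 0.
- exact: flatW fP.
- exact: flat_val fQ.
- by move=> v; rewrite DQ mulr0 mul0r.
rewrite yE; split; first exact: Ty.
- by rewrite ry addr0.
- exact: (cong_val (bump_gauss eu ev (eps *: e) sx fP)).
have cd := cong_delta_bump (eps *: e) fP; have ch := cong_hbar_bump (eps *: e) fP.
have cp := cong_pb eu ev (congW (leqnSn 2) cd) (cong_pb eu ev cd ch).
apply: (eq_trans (cong_val cp)).
pose C' := mink c (eps *: e) * C.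
have LE : (fun z => mink c (eps *: e) * Q P z) = fun z => C' * ell p q z ^+ 2.
  by apply/funext => z; rewrite QP mulrA.
have fL := flat_linX 2 C' ll.
have cH : cong 3 (fun z => Hbar x z + mink c (eps *: e) * Q P z)
    (fun z => Hbar x z + C' * ell p q z ^+ 2).
  apply: (cong_eq _ (smoothD sh (flat_smooth fL))); apply: filterE => z.
  exact: (congr1 (fun f : R2 -> R => Hbar x z + f z) LE).
have sd3 := cong_refl 3 sd.
apply: (eq_trans (cong_val (cong_pb eu ev (cong_refl 2 sd) (cong_pb eu ev sd3 cH)))).
apply: (eq_trans (pb2_add sd sh (flat_smooth fL))).
apply: (congr1 (fun t => tangency x + t)); apply: (eq_trans (pb2_flat sd fL)).
have CE : C' = eps * mink c e * C by rewrite /C' minkZr.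
have D2 v w r s : ell p q v = r -> ell p q w = s ->
    'D_w ('D_v (fun z => C' * ell p q z ^+ 2)) 0 = eps * mink c e * C * 2 * r * s.
  by move=> <- <-; apply: (eq_trans (D2_linX C' v w 0 ll)); rewrite CE.
exact: (tangency_arith EA EB (D2 _ _ _ _ (ell_ev p q) (ell_ev p q))
  (D2 _ _ _ _ (ell_eu p q) (ell_ev p q)) (D2 _ _ _ _ (ell_ev p q) (ell_eu p q))
  (D2 _ _ _ _ (ell_eu p q) (ell_eu p q))).
Qed.

End SurfaceBump.

(** * An explicit germ of G6 *)

Section Example.
Context {R : realType}.
Local Notation R2 := 'rV[R]_2.
Local Notation R3 := 'rV[R]_3.
Local Notation X := (ell (1 : R) 0).
Local Notation Y := (ell (0 : R) 1).

(* The graph z = x + x y - x^3 / 3: there d(Hbar) = 0, so both configurations are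
   obtained from it by perturbation. *)
Definition cubic_graph (u : R2) : R3 :=
  \row_j [:: X u; Y u; X u + X u * Y u - 3^-1 * X u ^+ 3]`_j.

Let sX z : smooth_at X z. Proof. by have [] := ell_lin (1 : R) 0. Qed.
Let sY z : smooth_at Y z. Proof. by have [] := ell_lin (0 : R) 1. Qed.
Let DX v z : 'D_v X z = X v. Proof. by have [_ []] := ell_lin (1 : R) 0. Qed.
Let DY v z : 'D_v Y z = Y v. Proof. by have [_ []] := ell_lin (0 : R) 1. Qed.
Let X0 : X 0 = 0 :> R. Proof. by have [_ []] := ell_lin (1 : R) 0. Qed.
Let Y0 : Y 0 = 0 :> R. Proof. by have [_ []] := ell_lin (0 : R) 1. Qed.

Let row3 (f g h : R2 -> R) (u : R2) : R3 := \row_j [:: f u; g u; h u]`_j.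

Let row3_0 f g h : (fun u => row3 f g h u 0 0) = f.
Proof. by apply/funext => u; rewrite mxE. Qed.
Let row3_1 f g h : (fun u => row3 f g h u 0 1) = g.
Proof. by apply/funext => u; rewrite mxE. Qed.
Let row3_2 f g h : (fun u => row3 f g h u 0 2) = h.
Proof. by apply/funext => u; rewrite mxE. Qed.

Let congr3 f g h f' g' h' : f = f' -> g = g' -> h = h' -> row3 f g h = row3 f' g' h'.
Proof. by move=> -> -> ->. Qed.

Let smooth_row3 f g h z : smooth_at f z -> smooth_at g z -> smooth_at h z ->
  smooth_at (row3 f g h) z.
Proof.
move=> sf sg sh; apply: smooth_row; apply: ord3P.
- by rewrite row3_0.
- by rewrite row3_1.
- by rewrite row3_2.
Qed.

Let D_row3 f g h v : (forall z, smooth_at f z) -> (forall z, smooth_at g z) ->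
  (forall z, smooth_at h z) -> 'D_v (row3 f g h) = row3 ('D_v f) ('D_v g) ('D_v h).
Proof.
move=> sf sg sh; apply/funext => z; apply/rowP => i.
have s3 : smooth_at (row3 f g h) z by exact: smooth_row3.
apply: (eq_trans (Dcoord i v s3)).
elim/ord3P: i; rewrite [RHS]mxE /=.
- by rewrite row3_0.
- by rewrite row3_1.
- by rewrite row3_2.
Qed.

Let c_ (r : R) : R2 -> R := fun=> r.
Let sc r z : smooth_at (c_ r) z. Proof. exact: smooth_cst. Qed.
Let Dc r v : 'D_v (c_ r) = c_ 0.
Proof. by apply/funext => z; exact: derive_cst. Qed.
Let DXf v : 'D_v X = c_ (X v). Proof. by apply/funext => z; exact: DX. Qed.
Let DYf v : 'D_v Y = c_ (Y v). Proof. by apply/funext => z; exact: DY. Qed.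

Let f3 (u : R2) := X u + X u * Y u - 3^-1 * X u ^+ 3.
Let s_ (u : R2) := 1 + Y u - X u * X u.

Let ss z : smooth_at s_ z.
Proof. by apply: smoothB; [apply: smoothD => //; exact: (sc 1)|exact: smoothM]. Qed.

Let sf3 z : smooth_at f3 z.
Proof.
apply: smoothB; first by apply: smoothD => //; exact: smoothM.
by apply: smoothM; [exact: (sc 3^-1)|exact: smoothX].
Qed.

Let Df3 v : 'D_v f3 = fun u => X v * s_ u + Y v * X u.
Proof.
apply/funext => z.
have sXY : smooth_at (fun u => X u * Y u) z by exact: smoothM.
have s3 : smooth_at (fun u => 3^-1 * X u ^+ 3) z.
  by apply: smoothM; [exact: (sc 3^-1)|exact: smoothX].
apply: (eq_trans (DB v (smoothD (sX z) sXY) s3)).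
apply: (eq_trans (congr2 (fun s t : R => s - t) (eq_trans (DD v (sX z) sXY)
  (congr2 (fun s t : R => s + t) (DX v z) (DM v (sX z) (sY z))))
  (D_linX 2 3^-1 v z (ell_lin 1 0)))).
rewrite DX DY /s_; move: (X v) (Y v) (X z) (Y z) => a b c d.
by field.
Qed.

Let Ds v : 'D_v s_ = fun u => Y v - 2 * X v * X u.
Proof.
apply/funext => z.
have sXX : smooth_at (fun u => X u * X u) z by exact: smoothM.
apply: (eq_trans (DB v (smoothD (sc 1 z) (sY z)) sXX)).
apply: (eq_trans (congr2 (fun s t : R => s - t) (eq_trans (DD v (sc 1 z) (sY z))
  (congr2 (fun s t : R => s + t) (derive_cst _ _ _) (DY v z))) (DM v (sX z) (sX z)))).
rewrite DX; move: (X v) (Y v) (X z) => a b c; ring.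
Qed.

Let xE : cubic_graph = row3 X Y f3. Proof. by []. Qed.

Lemma smooth_cubic_graph z : smooth_at cubic_graph z.
Proof. by rewrite xE; exact: smooth_row3. Qed.

Let Xu : X eu = 1. Proof. exact: ell_eu. Qed.
Let Xv : X ev = 0. Proof. exact: ell_ev. Qed.
Let Yu : Y eu = 0. Proof. exact: ell_eu. Qed.
Let Yv : Y ev = 1. Proof. exact: ell_ev. Qed.

Let Du : 'D_eu cubic_graph = row3 (c_ 1) (c_ 0) s_.
Proof.
rewrite xE D_row3 // DXf DYf Df3 Xu Yu; congr row3.
by apply/funext => u; rewrite mul1r mul0r addr0.
Qed.

Let Dv : 'D_ev cubic_graph = row3 (c_ 0) (c_ 1) X.
Proof.
rewrite xE D_row3 // DXf DYf Df3 Xv Yv; congr row3.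
by apply/funext => u; rewrite mul1r mul0r add0r.
Qed.

Let Duu : 'D_eu ('D_eu cubic_graph) = row3 (c_ 0) (c_ 0) (fun u => - 2 * X u).
Proof.
rewrite Du; apply: (eq_trans (D_row3 eu (sc 1) (sc 0) ss)).
apply: (eq_trans (congr3 (Dc 1 eu) (Dc 0 eu) (Ds eu))).
by rewrite Xu Yu; congr row3; apply/funext => u; ring.
Qed.

Let Duv : 'D_ev ('D_eu cubic_graph) = row3 (c_ 0) (c_ 0) (c_ 1).
Proof.
rewrite Du; apply: (eq_trans (D_row3 ev (sc 1) (sc 0) ss)).
apply: (eq_trans (congr3 (Dc 1 ev) (Dc 0 ev) (Ds ev))).
by rewrite Xv Yv; congr row3; apply/funext => u; rewrite /c_; ring.
Qed.

Let Dvv : 'D_ev ('D_ev cubic_graph) = row3 (c_ 0) (c_ 0) (c_ 0).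
Proof.
rewrite Dv; apply: (eq_trans (D_row3 ev (sc 0) (sc 1) sX)).
by apply: (eq_trans (congr3 (Dc 0 ev) (Dc 1 ev) (DXf ev))); rewrite Xv.
Qed.

Let minkE (a b c a' b' c' : R2 -> R) u : mink (row3 a b c u) (row3 a' b' c' u) =
  a u * a' u + b u * b' u - c u * c' u.
Proof. by rewrite /mink !mxE. Qed.

Let crossE u w : mink (mcross (row3 (c_ 1) (c_ 0) s_ u) (row3 (c_ 0) (c_ 1) X u)) w =
  w 0 2 - s_ u * w 0 0 - X u * w 0 1.
Proof. by rewrite /mink mcross0 mcross1 mcross2 !mxE /= /c_; ring. Qed.

Let forms u : [/\ delta cubic_graph u = 2 * Y u + (Y u * Y u - X u * X u
      - 2 * (X u * X u * Y u) + X u * X u * (X u * X u)),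
    Hbar cubic_graph u = 2 * (X u * Y u) & gaussc cubic_graph u = -1].
Proof.
have du : 'D_eu cubic_graph u = row3 (c_ 1) (c_ 0) s_ u := congr1 (fun f => f u) Du.
have dv : 'D_ev cubic_graph u = row3 (c_ 0) (c_ 1) X u := congr1 (fun f => f u) Dv.
have duu : 'D_eu ('D_eu cubic_graph) u = _ := congr1 (fun f => f u) Duu.
have duv : 'D_ev ('D_eu cubic_graph) u = _ := congr1 (fun f => f u) Duv.
have dvv : 'D_ev ('D_ev cubic_graph) u = _ := congr1 (fun f => f u) Dvv.
have cr := congr2 mcross du dv.
have fE : ffE cubic_graph u = 1 - s_ u * s_ u.
  by apply: (eq_trans (congr2 mink du du)); rewrite minkE /c_; ring.
have fF : ffF cubic_graph u = - (s_ u * X u).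
  by apply: (eq_trans (congr2 mink du dv)); rewrite minkE /c_; ring.
have fG : ffG cubic_graph u = 1 - X u * X u.
  by apply: (eq_trans (congr2 mink dv dv)); rewrite minkE /c_; ring.
have fl : ffl cubic_graph u = - 2 * X u.
  by apply: (eq_trans (congr2 mink cr duu)); rewrite crossE !mxE /= /c_; ring.
have fm : ffm cubic_graph u = 1.
  by apply: (eq_trans (congr2 mink cr duv)); rewrite crossE !mxE /= /c_; ring.
have fn : ffn cubic_graph u = 0.
  by apply: (eq_trans (congr2 mink cr dvv)); rewrite crossE !mxE /= /c_; ring.
clear du dv duu duv dvv cr.
have gE : gaussc cubic_graph u = ffl cubic_graph u * ffn cubic_graph u - ffm cubic_graph u ^+ 2 by [].
by rewrite gE /delta /Hbar fE fF fG fl fm fn /s_; split; ring.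
Qed.

Lemma cubic_graph_tangent : tangent_at cubic_graph.
Proof.
have sx := smooth_cubic_graph 0.
have fX : flat 1 X by exact: flat1.
have fY : flat 1 Y by exact: flat1.
have fXX := flatM fX fX; have fXY := flatM fX fY; have fYY := flatM fY fY.
have f2 : flat 2 (fun u => Y u * Y u - X u * X u
      - 2 * (X u * X u * Y u) + X u * X u * (X u * X u)).
  apply: flatD; last exact: flatMr fXX (flat_smooth fXX).
  apply: flatB; first exact: flatB.
  by apply: flatMl (sc 2 0) _; exact: flatMr fXX (flat_smooth fY).
have sd := smooth_delta sx; have sh := smooth_Hbar sx.
have Dd v : 'D_v (delta cubic_graph) 0 = 2 * Y v.
  have -> : delta cubic_graph = fun u => 2 * Y u + (Y u * Y u - X u * X u
      - 2 * (X u * X u * Y u) + X u * X u * (X u * X u)).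
    by apply/funext => u; have [-> _ _] := forms u.
  apply: (eq_trans (DD v (smoothM (sc 2 0) (sY 0)) (flat_smooth f2))).
  by rewrite (flat_Dval v f2) addr0 DMl // DY.
have fh : flat 2 (Hbar cubic_graph).
  apply: flat_ext (flatMl (sc 2 0) fXY) => u.
  by have [_ -> _] := forms u.
have [d0 h0 K0] := forms 0; split.
- have H (a b : R) : a = 0 -> b = 0 ->
      2 * b + (b * b - a * a - 2 * (a * a * b) + a * a * (a * a)) = 0.
    by move=> -> ->; ring.
  exact: eq_trans d0 (H _ _ X0 Y0).
- apply/(regularP (smooth_diff sd)) => -[_ E].
  have : 2 * Y ev = 0 by exact: eq_trans (esym (Dd ev)) E.
  by rewrite Yv mulr1 => /eqP; rewrite pnatr_eq0.
- exact: flat_val fh.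
- have H (a b c d : R) : c = 0 -> d = 0 -> a * c - b * d = 0.
    by move=> -> ->; rewrite !mulr0 subrr.
  exact: H (flat_Dval ev fh) (flat_Dval eu fh).
- by rewrite K0 oppr_eq0 oner_neq0.
Qed.

Lemma cubic_graph_param : @local_params R cubic_graph.
Proof.
have sx := smooth_cubic_graph 0; split; first exact: sx.
move=> v; rewrite -deriveE; last exact: smooth_diff.
rewrite derive_row2; last exact: smooth_diff.
have du : 'D_eu cubic_graph 0 = row3 (c_ 1) (c_ 0) s_ 0 := congr1 (fun f => f 0) Du.
have dv : 'D_ev cubic_graph 0 = row3 (c_ 0) (c_ 1) X 0 := congr1 (fun f => f 0) Dv.
rewrite du dv => /rowP E; move: (E 0) (E 1); rewrite !mxE /= /c_.
rewrite !mulr0 !mulr1 addr0 add0r => v0 v1.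
by apply/rowP; apply: ord2P; rewrite mxE.
Qed.

End Example.

(** * Splitting in families *)

Section Fold.
Context {R : realType}.
Variables (S dS : R -> R) (r : R).
Hypothesis S0 : S 0 = 0.
Hypothesis dSE : forall s, `|s| < r -> is_derive s (1 : R) S (dS s).
Hypothesis dS_sign : forall s, `|s| < r -> s != 0 -> 0 < s * dS s.

Let between a b c : `|a| < r -> `|b| < r -> c \in `[a, b]%R -> `|c| < r.
Proof.
rewrite !ltr_norml in_itv /= => /andP[ra _] /andP[_ br] /andP[ac cb].
by rewrite (lt_le_trans ra ac) (le_lt_trans cb br).
Qed.

Let cS a b : `|a| < r -> `|b| < r -> {within `[a, b], continuous S}.
Proof.
move=> ar br; apply: derivable_within_continuous => c /(between ar br)/dSE[] //.
Qed.

Let mvt a b : `|a| < r -> `|b| < r -> a < b ->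
  exists2 c, a < c < b & S b - S a = dS c * (b - a).
Proof.
move=> ar br ab; have H c : c \in `]a, b[%R -> is_derive c (1 : R) S (dS c).
  move=> cab; apply/dSE/(between ar br); move: cab.
  by rewrite !in_itv /= => /andP[/ltW-> /ltW->].
have [c cab E] := @MVT _ S dS a b ab H (cS ar br).
by exists c => //; move: cab; rewrite in_itv.
Qed.

Lemma fold_incr a b : 0 <= a -> a < b -> b < r -> S a < S b.
Proof.
move=> a0 ab br; have b0 : 0 < b by exact: le_lt_trans ab.
have ar : `|a| < r by rewrite ger0_norm // (lt_trans ab).
have br' : `|b| < r by rewrite gtr0_norm.
have [c /andP[ac cb] E] := mvt ar br' ab.
have c0 : 0 < c by exact: le_lt_trans ac.
have cr : `|c| < r by rewrite gtr0_norm // (lt_trans cb).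
have := dS_sign cr (lt0r_neq0 c0); rewrite pmulr_rgt0 // => d0.
by rewrite -subr_gt0 E mulr_gt0 // subr_gt0.
Qed.

Lemma fold_decr a b : - r < a -> a < b -> b <= 0 -> S b < S a.
Proof.
move=> ra ab b0; have a0 : a < 0 by exact: lt_le_trans b0.
have ar : `|a| < r by rewrite ltr0_norm // ltrNl.
have br : `|b| < r by rewrite ler0_norm // ltrNl (lt_trans ra).
have [c /andP[ac cb] E] := mvt ar br ab.
have c0 : c < 0 by exact: lt_le_trans b0.
have cr : `|c| < r by rewrite ltr0_norm // ltrNl (lt_trans ra).
have := dS_sign cr (ltr0_neq0 c0); rewrite nmulr_rgt0 // => d0.
by rewrite -subr_gt0 -opprB E oppr_gt0 nmulr_rlt0 // subr_gt0.
Qed.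

Lemma fold_ge0 s : `|s| < r -> 0 <= S s.
Proof.
rewrite ltr_norml => /andP[rs sr]; case: (ltgtP s 0) => [s0|s0|->]; last by rewrite S0.
  by rewrite -S0 ltW // fold_decr.
by rewrite -S0 ltW // fold_incr.
Qed.

(** The two roots are found within [rho] but are the only ones within [r]: [rho] will shrink with
    the neighbourhood [U] of [splits], whereas [r] stays fixed. *)
Lemma fold_two rho : 0 < rho -> rho < r -> exists2 e, 0 < e &
  forall t, 0 < t -> t < e -> exists s1 s2,
    [/\ - rho < s1 < 0, 0 < s2 < rho, S s1 = t, S s2 = t &
        forall s, `|s| < r -> S s = t -> s = s1 \/ s = s2].
Proof.
move=> p0 pr; have pr' : - r < - rho by rewrite ltrN2.
have np : `|rho| < r by rewrite gtr0_norm.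
have nNp : `|- rho| < r by rewrite normrN.
have r0 : 0 < r by exact: lt_trans pr.
have n0 : `|0 : R| < r by rewrite normr0.
have S1 : 0 < S rho by rewrite -S0 fold_incr.
have S2 : 0 < S (- rho) by rewrite -S0 fold_decr // oppr_lt0.
exists (Num.min (S rho) (S (- rho))); first by rewrite lt_min S1.
move=> t t0; rewrite lt_min => /andP[t1 t2].
have [s2 s2i E2] : exists2 c, c \in `[0, rho]%R & S c = t.
  apply: IVT; [exact: ltW|exact: cS|].
  by rewrite S0 ge_min le_max (ltW t0) (ltW t1) orbT.
have [s1 s1i E1] : exists2 c, c \in `[- rho, 0]%R & S c = t.
  apply: IVT; [by rewrite oppr_le0 ltW|exact: cS|].
  by rewrite S0 ge_min le_max (ltW t0) (ltW t2) orbT.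
have s2p : 0 < s2 < rho.
  move: s2i; rewrite in_itv /= => /andP[]; rewrite !le_eqVlt.
  move=> /orP[/eqP E|->]; first by move: t0; rewrite -E2 -E S0 ltxx.
  by move=> /orP[/eqP E|-> //]; move: t1; rewrite -E2 E ltxx.
have s1p : - rho < s1 < 0.
  move: s1i; rewrite in_itv /= => /andP[]; rewrite !le_eqVlt.
  move=> /orP[/eqP E|->]; first by move: t2; rewrite -E1 -E ltxx.
  by move=> /orP[/eqP E|-> //]; move: t0; rewrite -E1 E S0 ltxx.
exists s1, s2; split=> // s; rewrite ltr_norml => /andP[rs sr] E.
have /andP[s1a s1b] := s1p; have /andP[s2a s2b] := s2p.
case: (lerP s 0) => s0; [left|right].
  case: (ltgtP s s1) => // ss.
    by have := fold_decr rs ss (ltW s1b); rewrite E E1 ltxx.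
  by have := fold_decr (lt_trans pr' s1a) ss s0; rewrite E E1 ltxx.
case: (ltgtP s s2) => // ss.
  by have := fold_incr (ltW s0) ss (lt_trans s2b pr); rewrite E E2 ltxx.
by have := fold_incr (ltW s2a) ss sr; rewrite E E2 ltxx.
Qed.

End Fold.

(** * Families as maps of the (u, t)-space *)

Section Slices.
Context {R : realType}.
Local Notation R2 := 'rV[R]_2.
Local Notation R3 := 'rV[R]_3.
Local Notation V := (R2 * R)%type.

Definition eu0 : V := (eu, 0).
Definition ev0 : V := (ev, 0).

Lemma slice_affine (t : R) (v u : R2) (h : R) : (h *: v + u, t) = h *: (v, 0) + (u, t) :> V.
Proof. by apply: injective_projections => //=; rewrite [h *: _]mulr0 add0r. Qed.

Lemma derive_slice (W : normedModType R) (G : V -> W) t v u :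
  'D_v (fun u => G (u, t)) u = 'D_(v, 0) G (u, t).
Proof.
exact: (derive_affineE G (A := fun u => (u, t)) (L := fun v => (v, 0)) v u (slice_affine t)).
Qed.

Lemma derive_slice_fun (W : normedModType R) (G : V -> W) t v :
  'D_v (fun u => G (u, t)) = fun u => 'D_(v, 0) G (u, t).
Proof. by apply/funext => u; exact: derive_slice. Qed.

Lemma derive_slice2 (W : normedModType R) (G : V -> W) t v w u :
  'D_w ('D_v (fun u => G (u, t))) u = 'D_(w, 0) ('D_(v, 0) G) (u, t).
Proof.
apply: (eq_trans _ (derive_slice ('D_(v, 0) G) t w u)).
by rewrite (derive_slice_fun G t v).
Qed.

Lemma smooth_slice (W : normedModType R) (G : V -> W) t u :
  smooth_at G (u, t) -> smooth_at (fun u => G (u, t)) u.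
Proof.
move=> sG; apply: (smooth_affine (A := fun u => (u, t)) (L := fun v => (v, 0)) _ _ sG).
  by move=> v z h; exact: slice_affine.
by move=> z; apply: differentiable_pair => //; exact: differentiable_cst.
Qed.

(** The forms of all the surfaces of a family become functions on the (u, t)-space, which can also
    be differentiated in [t]. *)
Lemma slice_forms (X : V -> R3) t u : let x := fun u => X (u, t) in
  [/\ delta x u = disc eu0 ev0 X (u, t), Hbar x u = hbar eu0 ev0 X (u, t),
      gaussc x u = gauss eu0 ev0 X (u, t) & tdelta x u = tdisc eu0 ev0 X (u, t)].
Proof.
move=> x; have du : 'D_eu x u = 'D_eu0 X (u, t) := derive_slice X t eu u.
have dv : 'D_ev x u = 'D_ev0 X (u, t) := derive_slice X t ev u.
have d2 v w : 'D_w ('D_v x) u = 'D_(w, 0) ('D_(v, 0) X) (u, t).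
  exact: derive_slice2.
have cr := congr2 mcross du dv.
have eE : ffE x u = formE eu0 X (u, t) := congr2 mink du du.
have eF : ffF x u = formF eu0 ev0 X (u, t) := congr2 mink du dv.
have eG : ffG x u = formE ev0 X (u, t) := congr2 mink dv dv.
have el : ffl x u = formL eu0 ev0 X (u, t) := congr2 mink cr (d2 eu eu).
have em : ffm x u = formM eu0 ev0 X (u, t) := congr2 mink cr (d2 eu ev).
have en : ffn x u = formN eu0 ev0 X (u, t) := congr2 mink cr (d2 ev ev).
have gE : gaussc x u = ffl x u * ffn x u - ffm x u ^+ 2 by [].
move: gE; clear du dv d2 cr; rewrite /delta /Hbar /tdelta eE eF eG el em en.
by move=> ->; split.
Qed.

End Slices.

Section Unfolding.
Context {R : realType}.
Local Notation R2 := 'rV[R]_2.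
Local Notation V := (R2 * R)%type.
Local Notation W3 := ((R * R) * R)%type.
Local Notation W := (pb eu0 ev0).
Variables (d h : V -> R) (A B ra : R).
Hypotheses (sd : smooth_at d 0) (sh : smooth_at h 0).
Hypotheses (d0 : d 0 = 0) (h0 : h 0 = 0).
Hypotheses (Ed1 : 'D_eu0 d 0 = A) (Ed2 : 'D_ev0 d 0 = B).
Hypotheses (Eh1 : 'D_eu0 h 0 = ra * A) (Eh2 : 'D_ev0 h 0 = ra * B).
Let m := A ^+ 2 + B ^+ 2.
Let Omega := 'D_(0, 1) h 0 - ra * 'D_(0, 1) d 0.
Let n := A * 'D_ev0 (W d h) 0 - B * 'D_eu0 (W d h) 0.
Hypotheses (m0 : 0 < m) (Omega0 : Omega != 0) (n0 : n != 0).

Let tau : R2 := - B *: eu + A *: ev.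
Let nu : R2 := A *: eu + B *: ev.

(** Coordinates ((s, t), y): [s] along the tangent of the LD, [y] along the gradient of [d], [t] the
    time. Their nesting lets the implicit function theorem solve first for [y], then for [t]. *)
Definition frame_map (p : W3) : V := (p.1.1 *: tau + p.2 *: nu, p.1.2).
Local Notation aff := frame_map.

Let aff_lin (v z : W3) (k : R) : aff (k *: v + z) = k *: aff v + aff z.
Proof.
case: v z => [[a b] c] [[a' b'] c']; apply: injective_projections => //.
have E := affine_comb 0 tau nu (a, c) (a', c') k; rewrite !add0r in E; exact: E.
Qed.

Lemma frame_map_diff z : differentiable aff z.
Proof.
apply: differentiable_pair; last first.
  exact: (differentiable_comp (diff_fst z) (diff_snd _)).
apply: differentiableD; apply: differentiableZl; last exact: diff_snd.
exact: (differentiable_comp (diff_fst z) (diff_fst _)).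
Qed.

Lemma frame_map0 : aff 0 = 0.
Proof.
rewrite -[LHS]/((0 : R) *: tau + (0 : R) *: nu, 0 : R) !scale0r addr0.
by [].
Qed.

Let D_aff (g : V -> R) v p : 'D_v (g \o aff) p = 'D_(aff v) g (aff p).
Proof. exact: (derive_affineE g v p aff_lin). Qed.

Let smooth_aff (g : V -> R) p : smooth_at g (aff p) -> smooth_at (g \o aff) p.
Proof. exact: (smooth_affine aff_lin frame_map_diff). Qed.

Let aff_s : aff ((1, 0), 0) = - B *: eu0 + A *: ev0.
Proof.
apply: injective_projections => /=; first by rewrite scale1r scale0r addr0.
by rewrite ![_ *: 0]mulr0 addr0.
Qed.

Let aff_n : aff (0, 1) = A *: eu0 + B *: ev0.
Proof.
apply: injective_projections => /=; first by rewrite scale1r scale0r add0r.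
by rewrite ![_ *: 0]mulr0 addr0.
Qed.

Let aff_t : aff ((0, 1), 0) = (0, 1).
Proof. by apply: injective_projections => //=; rewrite !scale0r addr0. Qed.

Let Ds (g : V -> R) z : smooth_at g z ->
  'D_(aff ((1, 0), 0)) g z = - B * 'D_eu0 g z + A * 'D_ev0 g z.
Proof. by move=> sg; rewrite aff_s Dlin //; exact: smooth_diff. Qed.

Let Dn (g : V -> R) z : smooth_at g z ->
  'D_(aff (0, 1)) g z = A * 'D_eu0 g z + B * 'D_ev0 g z.
Proof. by move=> sg; rewrite aff_n Dlin //; exact: smooth_diff. Qed.

Let sd' : smooth_at (d \o aff) 0.
Proof. by apply: smooth_aff; rewrite frame_map0. Qed.
Let sh' : smooth_at (h \o aff) 0.
Proof. by apply: smooth_aff; rewrite frame_map0. Qed.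

Let Dn0 (g : V -> R) : smooth_at g 0 ->
  'D_(0, 1) (g \o aff) 0 = A * 'D_eu0 g 0 + B * 'D_ev0 g 0.
Proof. by move=> sg; apply: (eq_trans (D_aff g _ _)); rewrite frame_map0; exact: Dn. Qed.

Let Ds0 (g : V -> R) : smooth_at g 0 ->
  'D_((1, 0), 0) (g \o aff) 0 = - B * 'D_eu0 g 0 + A * 'D_ev0 g 0.
Proof. by move=> sg; apply: (eq_trans (D_aff g _ _)); rewrite frame_map0; exact: Ds. Qed.

Let Dt0 (g : V -> R) : 'D_((0, 1), 0) (g \o aff) 0 = 'D_(0, 1) g 0.
Proof. by apply: (eq_trans (D_aff g _ _)); rewrite frame_map0 aff_t. Qed.

Let near_aff (P : set V) (Y : R * R -> R) : {for 0, continuous Y} -> Y 0 = 0 ->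
  nbhs (0 : V) P -> \forall w \near (0 : R * R), P (aff (w, Y w)).
Proof.
move=> cY Y0 nP; apply: (near_graph (P := [set p | P (aff p)])) => //.
rewrite Y0; have c : {for 0, continuous aff}.
    exact: differentiable_continuous (frame_map_diff 0).
by apply: c; rewrite frame_map0.
Qed.

(** The left factor is the derivative in [s] of [h] restricted to d = 0, at fixed [t]; up to nonzero
    factors it is the bracket of [d] and [h]. *)
Let slope_arith (du dv hu hv : R) : A * du + B * dv != 0 ->
  ((- B * hu + A * hv) + - (- B * du + A * dv) / (A * du + B * dv) *
    (A * hu + B * hv)) * (A * du + B * dv) = m * (du * hv - dv * hu).
Proof. by move=> D0; rewrite mulrDl mulrAC divfK // /m; ring. Qed.

Let slope_pack (P y hs hn ds dn du dv hu hv : R) :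
  P = hs + y * hn -> y = - ds / dn -> hs = - B * hu + A * hv ->
  hn = A * hu + B * hv -> ds = - B * du + A * dv -> dn = A * du + B * dv ->
  dn != 0 -> P * dn = m * (du * hv - dv * hu).
Proof. by move=> -> -> -> -> -> ->; exact: slope_arith. Qed.

Let slope_arith2 (Ps Pt N psi : R) : Pt != 0 -> Ps * N = m * psi ->
  - Ps / Pt * (N * Pt) = - m * psi.
Proof. by move=> Pt0 E; rewrite mulrCA mulrC divfK // mulNr E mulNr. Qed.

Let sign_arith (s q T1 psi : R) : s != 0 -> 0 < q * Omega -> T1 * q = - m * psi ->
  0 < s * (n * psi) -> 0 < s * (- n * Omega * T1) /\ psi != 0.
Proof.
move=> s0 q0 E ps; split; last by apply: contraTneq ps => ->; rewrite !mulr0 ltxx.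
rewrite -(pmulr_lgt0 _ q0).
have -> : s * (- n * Omega * T1) * (q * Omega) = - (Omega ^+ 2 * n * s * (T1 * q)).
  by ring.
rewrite E; have -> : - (Omega ^+ 2 * n * s * (- m * psi)) =
  Omega ^+ 2 * m * (s * (n * psi)) by ring.
by apply: mulr_gt0 ps; apply: mulr_gt0 m0; rewrite exprn_even_gt0.
Qed.

Let graph_arith (a b y : R) : y = 0 -> a + y * b = a.
Proof. by move=> ->; rewrite mul0r addr0. Qed.

(* Solving d = 0 for y and then h = 0 for t along it: near 0 the equations
   d = h = 0 define the curve (s tau + Y (s, T s) nu, T s), whose height T is a
   fold. *)
Lemma solve_curve : exists (Y : R * R -> R) (T dT : R -> R) (kappa : R),
  [/\ Y 0 = 0 /\ T 0 = 0, smooth_at Y 0 /\ smooth_at T 0,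
   \forall p \near (0 : W3), d (aff p) = 0 /\ h (aff p) = 0 <->
     p.2 = Y p.1 /\ p.1.2 = T p.1.1,
   kappa != 0 &
   \forall s \near (0 : R), [/\ is_derive s (1 : R) T (dT s),
     s != 0 -> 0 < s * (kappa * dT s) &
     s != 0 -> W d h (aff ((s, T s), Y (s, T s))) != 0]].
Proof.
have Dnd : 'D_(0, 1) (d \o aff) 0 = m.
  by apply: (eq_trans (Dn0 sd)); rewrite Ed1 Ed2 /m !expr2.
have Dnh : 'D_(0, 1) (h \o aff) 0 = ra * m.
  by apply: (eq_trans (Dn0 sh)); rewrite Eh1 Eh2 /m; ring.
have Dsd : 'D_((1, 0), 0) (d \o aff) 0 = 0.
  by apply: (eq_trans (Ds0 sd)); rewrite Ed1 Ed2; ring.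
have mn : m != 0 by rewrite gt_eqF.
have [||Y [Y0 sY nY DY]] := implicit_function sd'.
- by rewrite /= frame_map0.
- by rewrite Dnd.
have cY := smooth_at_continuous sY.
have [Y1 Y2] : 'D_(1, 0) Y 0 = 0 /\ 'D_(0, 1) Y 0 = - 'D_(0, 1) d 0 / m.
  have Dz v : 'D_v Y 0 = - 'D_(v, 0) (d \o aff) 0 / 'D_(0, 1) (d \o aff) 0.
    by apply: (eq_trans (nbhs_singleton DY v)); rewrite Y0.
  by rewrite !Dz Dsd Dnd Dt0 oppr0 mul0r.
pose c w := aff (w, Y w).
pose Phi w := (h \o aff) (w, Y w).
have sPhi : smooth_at Phi 0 by apply: smooth_graph => //; rewrite Y0.
have DPhi v : 'D_v Phi 0 = 'D_(v, 0) (h \o aff) 0 + 'D_v Y 0 * 'D_(0, 1) (h \o aff) 0.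
  have sh0 : smooth_at (h \o aff) (0, Y 0) by rewrite Y0.
  by apply: (eq_trans (derive_graph v (smooth_diff sY) (smooth_diff sh0))); rewrite Y0.
(* On d = 0 the coordinate [y] has [t]-derivative - d_t / m, and [h] has [y]-derivative [ra * m];
   eliminating [y] leaves [Omega]. *)
have DPt : 'D_(0, 1) Phi 0 = Omega.
  apply: (eq_trans (DPhi _)); rewrite Dt0 Y2 Dnh /Omega mulNr mulNr.
  by rewrite mulrA mulrAC mulfVK // mulrC.
have DP1 : 'D_(1, 0) Phi 0 = 0.
  apply: (eq_trans (DPhi _)); rewrite Y1 mul0r addr0.
  by apply: (eq_trans (Ds0 sh)); rewrite Eh1 Eh2; ring.
have Phi0 : Phi 0 = 0 by rewrite /Phi Y0 /= frame_map0.
have [|T [T0 sT nT DT]] := implicit_function sPhi Phi0.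
  by rewrite DPt.
have cT := smooth_at_continuous sT.
have T1 : 'D_(1 : R) T 0 = 0.
  by apply: (eq_trans (nbhs_singleton DT 1)); rewrite T0 DP1 oppr0 mul0r.
have sW : smooth_at (W d h) 0 by exact: smooth_pb.
have sW' : smooth_at (W d h \o aff) 0 by apply: smooth_aff; rewrite frame_map0.
pose F w := (W d h \o aff) (w, Y w).
have sF : smooth_at F 0 by apply: smooth_graph => //; rewrite Y0.
have F0 : F 0 = 0.
  rewrite /F Y0 /= frame_map0 /pb Ed1 Ed2 Eh1 Eh2; ring.
have DF : 'D_(1, 0) F 0 = n.
  have sW0 : smooth_at (W d h \o aff) (0, Y 0) by rewrite Y0.
  apply: (eq_trans (derive_graph ((1, 0) : R * R) (smooth_diff sY) (smooth_diff sW0))).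
  have E : 'D_((1, 0), 0) (W d h \o aff) 0 = n.
    by apply: (eq_trans (Ds0 sW)); rewrite addrC mulNr.
  by apply: (eq_trans (graph_arith _ _ Y1)); rewrite Y0.
(* The bracket of [d] and [h] along the solution curve. It has a simple zero at 0, with derivative
   [n], and controls the derivative of [T]. *)
pose psi s := F (s, T s).
have sF0 : smooth_at F (0, T 0) by rewrite T0.
have spsi : smooth_at psi 0 by exact: smooth_graph.
have psi0 : psi 0 = 0 by rewrite /psi T0.
have Dpsi : 'D_(1 : R) psi 0 = n.
  apply: (eq_trans (derive_graph (1 : R) (smooth_diff sT) (smooth_diff sF0))).
  by rewrite T1 mul0r addr0 T0.
have nsign : \forall s \near (0 : R), s != 0 -> 0 < s * (n * psi s).
  apply: (near_sign (f := fun s => n * psi s)).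
  - by apply: smoothM => //; exact: smooth_cst.
  - by rewrite psi0 mulr0.
  by rewrite DMl // Dpsi -expr2 exprn_even_gt0.
pose Nd w := 'D_(0, 1) (d \o aff) (w, Y w).
have sDd : smooth_at ('D_(0, 1) (d \o aff)) (0, Y 0).
  by rewrite Y0; exact: smooth_derive.
have sNd : smooth_at Nd 0 by exact: (smooth_graph sY sDd).
have Nd0 : Nd 0 = m by rewrite /Nd Y0.
have nNd : \forall w \near (0 : R * R), 0 < Nd w.
  by apply: (cvgr_gt _ (smooth_at_continuous sNd)); rewrite Nd0.
have nid : \forall w \near (0 : R * R), 'D_(1, 0) Phi w * Nd w = m * F w.
  have n1 : \forall w \near (0 : R * R), smooth_at d (aff (w, Y w)) /\ smooth_at h (aff (w, Y w)).
    exact: (near_aff cY Y0 (filterI (smooth_near sd) (smooth_near sh))).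
  have n2 : \forall w \near (0 : R * R), smooth_at Y w := smooth_near sY.
  apply: filterS2 (filterI n1 nNd) (filterI DY n2) => w [[sdw shw] Nw] [DYw sYw].
  have shw' : smooth_at (h \o aff) (w, Y w) by exact: smooth_aff.
  have E1 := derive_graph ((1, 0) : R * R) (smooth_diff sYw) (smooth_diff shw').
  have Eh1' := eq_trans (D_aff h ((1, 0), 0) (w, Y w)) (Ds shw).
  have Eh2' := eq_trans (D_aff h (0, 1) (w, Y w)) (Dn shw).
  have Ed1' := eq_trans (D_aff d ((1, 0), 0) (w, Y w)) (Ds sdw).
  have Ed2' := eq_trans (D_aff d (0, 1) (w, Y w)) (Dn sdw).
  exact: (slope_pack E1 (DYw _) Eh1' Eh2' Ed1' Ed2' (lt0r_neq0 Nw)).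
(* The derivative of [T] is - m psi / q, where psi behaves like n s and q like m Omega; the factor -
   n Omega thus makes 0 a minimum of [kappa * T]. *)
exists Y, T, ('D_(1 : R) T), (- n * Omega); split=> //.
- have nT' : \forall p \near (0 : W3), Phi p.1 = 0 <-> p.1.2 = T p.1.1.
    exact: (cvg_fst nT).
  apply: filterS2 nY nT' => -[w y] /= HY HT; split=> [[/HY yE]|[yE tE]].
    by rewrite yE => hp; split=> //; apply/HT.
  by split; [exact/HY|move/HT: tE; rewrite yE].
- by rewrite mulf_neq0 // oppr_eq0.
pose q s := Nd (s, T s) * 'D_(0, 1) Phi (s, T s).
have sNd0 : smooth_at Nd (0, T 0) by rewrite T0.
have sDP0 : smooth_at ('D_(0, 1) Phi) (0, T 0) by rewrite T0; exact: smooth_derive.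
have sq : smooth_at q 0.
  by apply: smoothM; [exact: (smooth_graph sT sNd0)|exact: (smooth_graph sT sDP0)].
have q0 : q 0 = m * Omega by rewrite /q T0 Nd0 DPt.
have sqO : smooth_at (fun s => q s * Omega) 0.
  by apply: smoothM => //; exact: smooth_cst.
have nq : \forall s \near (0 : R), 0 < q s * Omega.
  apply: (cvgr_gt _ (smooth_at_continuous sqO)).
  by rewrite q0 -mulrA -expr2; apply: mulr_gt0 m0 _; rewrite exprn_even_gt0.
have nid' : \forall s \near (0 : R), 'D_(1, 0) Phi (s, T s) * Nd (s, T s) = m * psi s.
  by apply: (near_graph (P := [set w | 'D_(1, 0) Phi w * Nd w = m * F w]) cT); rewrite T0.
apply: filterS3 (filterI (smooth_near sT) nsign) (filterI nq nid') DT.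
move=> s [sTs Hs] [qs ids] DTs; split.
- exact/derivableP/smooth_derivable.
- move=> s0.
  have Dt0' : 'D_(0, 1) Phi (s, T s) != 0.
    by apply: contraTneq qs; rewrite /q => ->; rewrite mulr0 mul0r ltxx.
  have E : 'D_(1 : R) T s * q s = - m * psi s.
    apply: (eq_trans (congr1 (fun a : R => a * q s) (DTs 1))).
    exact: (slope_arith2 Dt0' ids).
  exact: (sign_arith s0 qs E (Hs s0)).1.
move=> s0.
have p0 : 0 < s * (n * psi s) := Hs s0.
by apply: contraTneq p0 => E; rewrite /psi /F /= E !mulr0 ltxx.
Qed.

End Unfolding.

Section FrameCoordinates.
Context {R : realType}.
Local Notation R2 := 'rV[R]_2.
Variables (A B : R).
Hypothesis m0 : 0 < A ^+ 2 + B ^+ 2.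

Definition coord_tau (u : R2) : R := (- B * u 0 0 + A * u 0 1) / (A ^+ 2 + B ^+ 2).
Definition coord_nu (u : R2) : R := (A * u 0 0 + B * u 0 1) / (A ^+ 2 + B ^+ 2).

Lemma frame_coord0 s t y : (frame_map A B ((s, t), y)).1 0 0 = - s * B + y * A.
Proof. by rewrite /frame_map /= !(mxE, euvE) /=; ring. Qed.

Lemma frame_coord1 s t y : (frame_map A B ((s, t), y)).1 0 1 = s * A + y * B.
Proof. by rewrite /frame_map /= !(mxE, euvE) /=; ring. Qed.

Lemma coord_tauK s t y : coord_tau (frame_map A B ((s, t), y)).1 = s.
Proof.
rewrite /coord_tau frame_coord0 frame_coord1; apply: (mulIf (lt0r_neq0 m0)).
by rewrite divfK ?gt_eqF //; ring.
Qed.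

Lemma coord_nuK s t y : coord_nu (frame_map A B ((s, t), y)).1 = y.
Proof.
rewrite /coord_nu frame_coord0 frame_coord1; apply: (mulIf (lt0r_neq0 m0)).
by rewrite divfK ?gt_eqF //; ring.
Qed.

Lemma frame_coordK u t : frame_map A B ((coord_tau u, t), coord_nu u) = (u, t).
Proof.
apply: injective_projections; last by [].
have mn := lt0r_neq0 m0.
apply/rowP; apply: ord2P; rewrite ?frame_coord0 ?frame_coord1 /coord_tau /coord_nu /=.
  by field.
by field.
Qed.

Lemma near_coord (f : R2 -> R) (a b r : R) : 0 < r ->
  (forall u, f u = a * u 0 0 + b * u 0 1) -> \forall u \near (0 : R2), `|f u| < r.
Proof.
move=> r0 fE; have sf : smooth_at f 0.
  have -> : f = fun u => a * u 0 0 + b * u 0 1 by apply/funext.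
  by apply: smoothD; apply: smoothM; try exact: smooth_cst;
    exact: (smooth_coord _ (smooth_at_id 0)).
have f0 : f 0 = 0 by rewrite fE !mxE !mulr0 addr0.
have /cvgrPdist_lt /(_ r r0) := smooth_at_continuous sf.
by apply: filterS => u; rewrite f0 sub0r normrN.
Qed.

Lemma near_frame r : 0 < r ->
  \forall u \near (0 : R2), `|coord_tau u| < r /\ `|coord_nu u| < r.
Proof.
move=> r0; apply: filterI.
  apply: (near_coord (a := - B / (A ^+ 2 + B ^+ 2)) (b := A / (A ^+ 2 + B ^+ 2)) r0) => u.
  by rewrite /coord_tau mulrDl !(mulrAC _ _ (_^-1)).
apply: (near_coord (a := A / (A ^+ 2 + B ^+ 2)) (b := B / (A ^+ 2 + B ^+ 2)) r0) => u.
by rewrite /coord_nu mulrDl !(mulrAC _ _ (_^-1)).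
Qed.

End FrameCoordinates.

Lemma nbhs_box3 (R : realType) (P : set (R * R * R)) : nbhs (0 : R * R * R) P ->
  exists2 r : R, 0 < r & forall s t y, `|s| < r -> `|t| < r -> `|y| < r -> P ((s, t), y).
Proof.
case=> -[Q1 Q2] [/= n1 /nbhs_norm0P[r r0 H]] QP; have [r' r'0 H'] := nbhs_box n1.
exists (Num.min r r'); first by rewrite lt_min r0.
move=> s t y; rewrite !lt_min => /andP[_ sr] /andP[_ tr] /andP[yr _].
by apply: QP; split; [exact: H'|exact: H].
Qed.

Section Splitting.
Context {R : realType}.
Local Notation R2 := 'rV[R]_2.
Local Notation R3 := 'rV[R]_3.
Local Notation V := (R2 * R)%type.
Variable X : V -> R3.
Let d := disc eu0 ev0 X.
Let h := hbar eu0 ev0 X.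
Let K := gauss eu0 ev0 X.
Let x t u := X (u, t).

Let zero_pair (a b c d' h' K' t' : R) : c != 0 -> d' = a -> h' = b -> K' = c ->
  t' = h' ^+ 2 + 4 * d' * K' ->
  (d' = 0 /\ t' = 0) \/ (d' = 0 /\ h' = 0) \/ (t' = 0 /\ h' = 0) -> a = 0 /\ b = 0.
Proof.
move=> c0 -> -> -> -> [[-> H]|[[-> ->]|[H b0]]] //; split=> //; apply/eqP; move: H.
  by rewrite mulr0 mul0r addr0 => /eqP; rewrite expf_eq0.
by rewrite b0 expr0n /= add0r => /eqP; rewrite !mulf_eq0 (negbTE c0) orbF pnatr_eq0.
Qed.

(** When K is nonzero, t = h^2 + 4 d K makes any two of d, h, t vanish only together with the third,
    so all the intersections lie on d = h = 0. *)
Lemma slice_intersections t u : K (u, t) != 0 ->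
  intersections (x t) u -> d (u, t) = 0 /\ h (u, t) = 0.
Proof.
move=> K0 I; have [dE hE KE _] := slice_forms X t u.
apply: (zero_pair K0 dE hE KE (tdeltaE (x t) u)).
case: I => [[[dz tz]|[dz hz]]|[tz hz]].
- exact: or_introl (conj dz tz).
- exact: or_intror (or_introl (conj dz hz)).
exact: or_intror (or_intror (conj tz hz)).
Qed.

Lemma slice_tangency t u : smooth_at X (u, t) -> d (u, t) = 0 -> h (u, t) = 0 ->
  K (u, t) != 0 -> pb eu0 ev0 d h (u, t) != 0 ->
  [/\ Defs.transversal (delta (x t)) (Hbar (x t)) u, LPL (x t) u &
      ordinary_tangency (delta (x t)) (tdelta (x t)) u].
Proof.
move=> sX d0 h0 K0 p0; have sx : smooth_at (x t) u := smooth_slice sX.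
have [dE hE KE _] := slice_forms X t u.
have fE : delta (x t) = fun u => d (u, t).
  by apply/funext => z; have [] := slice_forms X t z.
have gE : Hbar (x t) = fun u => h (u, t).
  by apply/funext => z; have [] := slice_forms X t z.
have pE : pb eu ev (delta (x t)) (Hbar (x t)) u = pb eu0 ev0 d h (u, t).
  rewrite fE gE.
  exact: (congr2 (fun a b : R => a - b)
    (congr2 (fun a b : R => a * b) (derive_slice d t eu u) (derive_slice h t ev u))
    (congr2 (fun a b : R => a * b) (derive_slice d t ev u) (derive_slice h t eu u))).
have p0' : pb eu ev (delta (x t)) (Hbar (x t)) u != 0 by exact: (eq_ind_r (fun s : R => s != 0) p0 pE).
have K0' : gaussc (x t) u != 0 := eq_ind_r (fun s : R => s != 0) K0 KE.
exact: (pb_tangency (smooth_delta sx) (smooth_Hbar sx) (smooth_gaussc sx)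
  (tdeltaE (x t)) (eq_trans dE d0) (eq_trans hE h0) K0' p0').
Qed.

End Splitting.

Section Model.
Context {R : realType}.
Local Notation R2 := 'rV[R]_2.
Local Notation R3 := 'rV[R]_3.
Local Notation V := (R2 * R)%type.
Variable X : V -> R3.
Let d := disc eu0 ev0 X.
Let h := hbar eu0 ev0 X.
Let K := gauss eu0 ev0 X.
Let x t u := X (u, t).

(** All that the splitting needs, gathered on one box of radius [r]: the solution curve, the
    derivative of its height [T], and the fact that its points enter every neighbourhood of 0 as [s]
    tends to 0. *)
Lemma curves_model : smooth_at X 0 -> tangent_at (x 0) -> tangency (x 0) != 0 ->
  'D_(0, 1) h 0 - ratio (x 0) * 'D_(0, 1) d 0 != 0 ->
  exists (A B : R) (Y : R * R -> R) (T dT : R -> R) (kappa r : R),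
  [/\ 0 < A ^+ 2 + B ^+ 2, [/\ 0 < r, kappa != 0 & T 0 = 0],
   forall s t y, `|s| < r -> `|t| < r -> `|y| < r ->
     let p := frame_map A B ((s, t), y) in
     [/\ K p != 0, smooth_at X p &
         d p = 0 /\ h p = 0 <-> y = Y (s, t) /\ t = T s],
   forall s, `|s| < r -> [/\ is_derive s (1 : R) T (dT s),
     s != 0 -> 0 < s * (kappa * dT s) &
     s != 0 -> pb eu0 ev0 d h (frame_map A B ((s, T s), Y (s, T s))) != 0] &
   forall U : set R2, nbhs (0 : R2) U -> \forall s \near (0 : R),
     [/\ U (frame_map A B ((s, T s), Y (s, T s))).1, `|Y (s, T s)| < r & `|T s| < r]].
Proof.
move=> sX Ax n0 Om0; have sx : smooth_at (x 0) 0 by exact: (smooth_slice sX).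
have sd : smooth_at d 0 by exact: smooth_disc.
have sh : smooth_at h 0 by exact: smooth_hbar.
have sK : smooth_at K 0 by exact: smooth_gauss.
have fE : delta (x 0) = fun u => d (u, 0).
  by apply/funext => z; have [] := slice_forms X 0 z.
have gE : Hbar (x 0) = fun u => h (u, 0).
  by apply/funext => z; have [] := slice_forms X 0 z.
have dE v u : 'D_v (delta (x 0)) u = 'D_(v, 0) d (u, 0).
  exact: (eq_trans (congr1 (fun f => 'D_v f u) fE) (derive_slice d 0 v u)).
have hE v u : 'D_v (Hbar (x 0)) u = 'D_(v, 0) h (u, 0).
  exact: (eq_trans (congr1 (fun f => 'D_v f u) gE) (derive_slice h 0 v u)).
have pE : pb eu ev (delta (x 0)) (Hbar (x 0)) = fun u => pb eu0 ev0 d h (u, 0).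
  apply/funext => u; exact: (congr2 (fun a b : R => a - b)
    (congr2 (fun a b : R => a * b) (dE eu u) (hE ev u))
    (congr2 (fun a b : R => a * b) (dE ev u) (hE eu u))).
have wE v u : 'D_v (pb eu ev (delta (x 0)) (Hbar (x 0))) u = 'D_(v, 0) (pb eu0 ev0 d h) (u, 0).
  exact: (eq_trans (congr1 (fun f => 'D_v f u) pE) (derive_slice (pb eu0 ev0 d h) 0 v u)).
have [d00 rd h00 p00 K00] := Ax.
have d0 : d 0 = 0 := eq_trans (esym (congr1 (fun f => f 0) fE)) d00.
have h0 : h 0 = 0 := eq_trans (esym (congr1 (fun f => f 0) gE)) h00.
have K0 : K 0 != 0.
  by have [_ _ KE _] := slice_forms X 0 0; move: K00; rewrite KE.
have [Eu Ev] := ratioE sx Ax.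
have Eh1 := eq_trans (eq_trans (esym (hE eu 0)) Eu) (congr1 ( *%R (ratio (x 0))) (dE eu 0)).
have Eh2 := eq_trans (eq_trans (esym (hE ev 0)) Ev) (congr1 ( *%R (ratio (x 0))) (dE ev 0)).
have m0 : 0 < 'D_eu0 d 0 ^+ 2 + 'D_ev0 d 0 ^+ 2.
  exact: (eq_ind_r (fun s : R => 0 < s) (grad2_gt0 (smooth_delta sx) rd)
    (esym (congr2 (fun a b : R => a ^+ 2 + b ^+ 2) (dE eu 0) (dE ev 0)))).
have nE : 'D_eu0 d 0 * 'D_ev0 (pb eu0 ev0 d h) 0 - 'D_ev0 d 0 * 'D_eu0 (pb eu0 ev0 d h) 0 != 0.
  exact: (eq_ind_r (fun s : R => s != 0) n0 (esym (congr2 (fun a b : R => a - b)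
    (congr2 (fun a b : R => a * b) (dE eu 0) (wE ev 0))
    (congr2 (fun a b : R => a * b) (dE ev 0) (wE eu 0))))).
have [Y [T [dT [kappa [[Y0 T0] [sY sT] E k0 C]]]]] :=
  solve_curve sd sh d0 h0 erefl erefl Eh1 Eh2 m0 Om0 nE.
pose A := 'D_eu0 d 0; pose B := 'D_ev0 d 0; pose aff := frame_map A B.
have c0 : {for 0, continuous aff}.
  exact: differentiable_continuous (frame_map_diff A B 0).
have near_aff (P : set V) : nbhs (0 : V) P -> \forall p \near (0 : R * R * R), P (aff p).
  by move=> nP; apply: (c0 P); rewrite /aff frame_map0.
have nK : \forall p \near (0 : V), K p != 0.
  exact: (cvgr_neq0 (K 0) (smooth_at_continuous sK) K0).
have n1 : \forall p \near (0 : R * R * R), K (aff p) != 0 /\ smooth_at X (aff p).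
  exact: (near_aff _ (filterI nK (smooth_near sX))).
have [r1 r10 H1] := nbhs_box3 (filterI n1 E).
have [r2 r20 H2] := (nbhs_norm0P (P := [set s | _]).1 C).
pose r := Num.min r1 r2.
have r0 : 0 < r by rewrite lt_min r10.
exists A, B, Y, T, dT, kappa, r; split; [exact: m0|by split| | |].
- move=> s t y; rewrite !lt_min => /andP[s1 _] /andP[t1 _] /andP[y1 _].
  have [[K1 sX1] E1] := H1 _ _ _ s1 t1 y1; exact: And3 K1 sX1 E1.
- by move=> s; rewrite lt_min => /andP[_ s2]; exact: H2 s2.
move=> U nU.
have nP : nbhs (0 : R * R * R) [set p : R * R * R |
    [/\ U (aff p).1, `|p.2| < r & `|p.1.2| < r]].
  have nU' : \forall p \near (0 : R * R * R), U (aff p).1.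
    exact: (near_aff [set p | U p.1] (cvg_fst nU)).
  have n2 : \forall p \near (0 : R * R * R), `|p.2| < r.
    exact: (cvg_snd (nbhs0_lt r0)).
  have n3 : \forall w \near (0 : R * R), `|w.2| < r.
    exact: (cvg_snd (nbhs0_lt r0)).
  have n3' : \forall p \near (0 : R * R * R), `|p.1.2| < r.
    exact: (cvg_fst n3).
  apply: (@filterS2 _ _ _ _ _ _ _ nU' (filterI n2 n3')) => p a [b c]; exact: And3 a b c.
have n4 : \forall w \near (0 : R * R), [set p : R * R * R |
    [/\ U (aff p).1, `|p.2| < r & `|p.1.2| < r]] (w, Y w).
  by apply: (near_graph (smooth_at_continuous sY)); rewrite Y0.
apply: (near_graph (P := [set w | [set p : R * R * R |
  [/\ U (aff p).1, `|p.2| < r & `|p.1.2| < r]] (w, Y w)]) (smooth_at_continuous sT)).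
by rewrite T0.
Qed.
End Model.

Section Geometry.
Context {R : realType}.
Local Notation R2 := 'rV[R]_2.
Local Notation R3 := 'rV[R]_3.
Local Notation V := (R2 * R)%type.
Variable X : V -> R3.
Let d := disc eu0 ev0 X.
Let h := hbar eu0 ev0 X.
Let K := gauss eu0 ev0 X.
Let x t u := X (u, t).
Variables (A B : R) (Y : R * R -> R) (T dT : R -> R) (kappa r : R).
Hypotheses (m0 : 0 < A ^+ 2 + B ^+ 2) (r0 : 0 < r) (k0 : kappa != 0) (T0 : T 0 = 0).
Hypothesis box : forall s t y, `|s| < r -> `|t| < r -> `|y| < r ->
  let p := frame_map A B ((s, t), y) in
  [/\ K p != 0, smooth_at X p & d p = 0 /\ h p = 0 <-> y = Y (s, t) /\ t = T s].
Hypothesis curve : forall s, `|s| < r -> [/\ is_derive s (1 : R) T (dT s),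
  s != 0 -> 0 < s * (kappa * dT s) &
  s != 0 -> pb eu0 ev0 d h (frame_map A B ((s, T s), Y (s, T s))) != 0].
Hypothesis small : forall U : set R2, nbhs (0 : R2) U -> \forall s \near (0 : R),
  [/\ U (frame_map A B ((s, T s), Y (s, T s))).1, `|Y (s, T s)| < r & `|T s| < r].

Let S s := kappa * T s.
Let dS s := kappa * dT s.
Let pt s := (frame_map A B ((s, T s), Y (s, T s))).1.

Let S0 : S 0 = 0. Proof. by rewrite /S T0 mulr0. Qed.
Let dSE s : `|s| < r -> is_derive s (1 : R) S (dS s).
Proof.
by move=> /curve[dT1 _ _]; apply: is_deriveZ.
Qed.
Let dS_sign s : `|s| < r -> s != 0 -> 0 < s * dS s.
Proof. by move=> /curve[_ H _]. Qed.

Let U0 : set R2 := [set u | `|coord_tau A B u| < r /\ `|coord_nu A B u| < r].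

Let on_curve t u : U0 u -> `|t| < r ->
  [/\ K (u, t) != 0, smooth_at X (u, t) & d (u, t) = 0 /\ h (u, t) = 0 <->
    T (coord_tau A B u) = t /\ u = pt (coord_tau A B u)].
Proof.
move=> [u1 u2] tr; have := box u1 tr u2; rewrite /= (frame_coordK m0).
move=> [K0 sX E]; split=> //; apply: (iff_trans E).
split=> [[E1 E2]|[E1 E2]]; split.
- by rewrite -E2.
- by rewrite /pt -E2 -E1 (frame_coordK m0).
- by rewrite [in LHS]E2 (coord_nuK m0) E1.
by rewrite E1.
Qed.

Let curves t u : U0 u -> `|t| < r -> intersections (x t) u ->
  T (coord_tau A B u) = t /\ u = pt (coord_tau A B u).
Proof.
move=> Uu tr I; have [K0 _ E] := on_curve Uu tr.
by apply/E; exact: slice_intersections K0 I.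
Qed.

Let tangencies t s : `|t| < r -> `|s| < r -> s != 0 -> T s = t -> U0 (pt s) ->
  [/\ delta (x t) (pt s) = 0, Hbar (x t) (pt s) = 0 &
  [/\ Defs.transversal (delta (x t)) (Hbar (x t)) (pt s), LPL (x t) (pt s) &
      ordinary_tangency (delta (x t)) (tdelta (x t)) (pt s)]].
Proof.
move=> tr sr s0 Ts Us; have [K0 sX E] := on_curve Us tr.
have [d0 h0] : d (pt s, t) = 0 /\ h (pt s, t) = 0.
  by apply/E; rewrite (coord_tauK m0).
have [_ _ /(_ s0) W0] := curve sr.
have [dE hE _ _] := slice_forms X t (pt s).
have W0' : pb eu0 ev0 d h (pt s, t) != 0 by rewrite -Ts; exact: W0.
by split; [exact: (eq_trans dE)|exact: (eq_trans hE)|exact: slice_tangency].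
Qed.

(** The intersections at time [t] are the points of the curve with T s = t, and [kappa * T] has a
    strict minimum 0 at 0: two points when kappa t > 0 is small, none when kappa t < 0. *)
Lemma model_splits : splits x.
Proof.
(* This sign makes kappa times the signed time equal to [|kappa| * t]. [U0] is the box in frame
   coordinates, fixed before [U] is given. *)
exists (kappa < 0), U0; first exact: near_frame.
move=> U nU UU0.
(* The radius below which the points of the curve lie in [U]. *)
have [rho0 rho0p Hrho0] := (nbhs_norm0P (P := [set s | _]).1 (small nU)).
pose rho := Num.min rho0 (r / 2).
have rr : rho < r by rewrite gt_min; apply/orP; right; rewrite ltr_pdivrMr // ltr_pMr // ltr1n.
have rho_gt0 : 0 < rho by rewrite lt_min rho0p divr_gt0.
have [e e0 He] := fold_two S0 dSE dS_sign rho_gt0 rr.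
have ka : 0 < `|kappa| by rewrite normr_gt0.
exists (Num.min (e / `|kappa|) r); first by rewrite lt_min r0 divr_gt0.
move=> t t0; rewrite lt_min ltr_pdivlMr // => /andP[te tr].
have kE : kappa * ((-1) ^+ (kappa < 0)%R * t) = `|kappa| * t.
  by rewrite mulrA [kappa * _]mulrC -normrEsign.
have tr' : `|(-1) ^+ (kappa < 0)%R * t| < r.
  by rewrite normrM normr_sign mul1r gtr0_norm.
split; last first.
  apply/seteqP; split=> // u [I Uu].
  have [|Tc _] := curves (UU0 _ Uu) _ I; first by rewrite normrN.
  have [u1 _] := UU0 _ Uu.
  have := fold_ge0 S0 dSE dS_sign u1.
  by rewrite /S Tc mulrN kE oppr_ge0 leNgt mulr_gt0.
have := He (`|kappa| * t) (mulr_gt0 ka t0).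
rewrite mulrC => /(_ te) [s1 [s2 [/andP[a1 b1] /andP[a2 b2] E1 E2 H]]].
have Ts s : S s = t * `|kappa| -> T s = (-1) ^+ (kappa < 0)%R * t.
  by rewrite mulrC -kE /S => /(mulfI k0).
have ns1 : `|s1| < rho by rewrite ltr0_norm // ltrNl.
have ns2 : `|s2| < rho by rewrite gtr0_norm.
have ns s : `|s| < rho -> U (pt s).
  by rewrite lt_min => /andP[/Hrho0[]].
have I s : `|s| < rho -> s != 0 -> S s = t * `|kappa| -> _ :=
  fun sr s0 Es => tangencies tr' (lt_trans sr rr) s0 (Ts _ Es) (UU0 _ (ns _ sr)).
have T1 := I s1 ns1 (ltr0_neq0 b1) E1.
have T2 := I s2 ns2 (lt0r_neq0 a2) E2.
have only u : intersections (x ((-1) ^+ (kappa < 0)%R * t)) u -> U u ->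
    u = pt s1 \/ u = pt s2.
  move=> Iu Uu; have [Tc ->] := curves (UU0 _ Uu) tr' Iu; have [u1 _] := UU0 _ Uu.
  have [|->|->] := H _ u1; [by rewrite /S Tc kE mulrC|by left|by right].
exists (pt s1), (pt s2); split.
- apply/eqP => E; have : coord_tau A B (pt s1) = coord_tau A B (pt s2) by rewrite E.
  by rewrite !(coord_tauK m0) => E'; move: b1; rewrite E' ltNge ltW.
- apply/seteqP; split=> u.
    by case=> -[uD uM] Uu; apply: only Uu; left; right.
  by case=> ->; [case: T1|case: T2] => D1 D2 _; split=> //; exact: ns.
- by move=> u [Iu Uu]; exact: only.
by move=> q [->|->]; [case: T1|case: T2].
Qed.
End Geometry.

Lemma transverse_splits (R : realType) (X : 'rV[R]_2 * R -> 'rV[R]_3) (x := fun u => X (u, 0)) :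
  smooth_at X 0 -> tangent_at x -> tangency x != 0 ->
  'D_(0, 1) (hbar eu0 ev0 X) 0 - ratio x * 'D_(0, 1) (disc eu0 ev0 X) 0 != 0 ->
  splits (fun t u => X (u, t)).
Proof.
move=> sX Ax n0 Om0.
have [A [B [Y [T [dT [kappa [r [m0 [r0 k0 T0] box C small]]]]]]]] := curves_model sX Ax n0 Om0.
exact: (model_splits m0 r0 k0 T0 box C small).
Qed.

Section TimeDependence.
Context {R : realType}.
Local Notation R2 := 'rV[R]_2.
Local Notation R3 := 'rV[R]_3.
Local Notation V := (R2 * R)%type.

Lemma smooth_fst (W : normedModType R) (g : R2 -> W) (p : V) :
  smooth_at g p.1 -> smooth_at (fun p : V => g p.1) p.
Proof.
apply: (smooth_affine (A := fst) (L := fst)) => [v z k|z]; first by [].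
exact: diff_fst.
Qed.

Lemma derive_fst (W : normedModType R) (g : R2 -> W) (v p : V) :
  'D_v (fun p : V => g p.1) p = 'D_(v.1) g p.1.
Proof. exact: (derive_affineE g (A := fst) (L := fst) v p). Qed.

Lemma smooth_snd (p : V) : smooth_at (snd : V -> R) p.
Proof.
have H := @smooth_affine R R V R id snd snd p.
by apply: H => [v z k|z|]; [|exact: diff_snd|exact: smooth_at_id].
Qed.

Lemma derive_snd (v p : V) : 'D_v (snd : V -> R) p = v.2.
Proof.
have H := @derive_affineE R R V R id snd snd v p.
by rewrite (H _) ?derive_id.
Qed.

Lemma near_tangency (x y : R2 -> R3) : (\forall u \near (0 : R2), x u = y u) ->
  tangency x = tangency y /\ ratio x = ratio y.
Proof.
move=> xy; have nf := forms_near eu ev xy.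
have nd : \forall u \near (0 : R2), delta x u = delta y u.
  by apply: filterS nf => u [e _ _ _]; exact: e.
have nh : \forall u \near (0 : R2), Hbar x u = Hbar y u.
  by apply: filterS nf => u [_ e _ _]; exact: e.
split; first exact: nbhs_singleton (pb_near eu ev nd (pb_near eu ev nd nh)).
have Ed v := derive_near v nd; have Eh v := derive_near v nh.
have Eg : grad2 (delta x) 0 = grad2 (delta y) 0.
  exact: (congr2 (fun s t => s ^+ 2 + t ^+ 2) (Ed eu) (Ed ev)).
exact: (congr2 (fun s t : R => s / t) (congr2 +%R (congr2 *%R (Eh eu) (Ed eu))
  (congr2 *%R (Eh ev) (Ed ev))) Eg).
Qed.

Lemma near_tangent_at (x y : R2 -> R3) : smooth_at x 0 ->
  (\forall u \near (0 : R2), x u = y u) -> tangent_at x -> tangent_at y.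
Proof.
move=> sx xy; apply: reparam_tangent_at => //; first exact: smooth_eq xy sx.
exists id; last exact: xy.
split=> //; first exact: smooth_at_id.
by exists id; split=> //; [exact: smooth_at_id|exact: filterE|exact: filterE].
Qed.

(** Of order 3 at the origin of the (u, t)-space, so it keeps the 1-jet of [delta]; the second order
    operator in [u] turns it into a multiple of [t], which alters the [t]-derivative of [Hbar]
    alone. *)
Definition square (p q : R) (z : V) : R := z.2 * ell p q z.1 ^+ 2.

Lemma smooth_square p q z : smooth_at (square p q) z.
Proof.
apply: smoothM; first exact: smooth_snd.
by apply: smoothX; apply: smooth_fst; have [] := ell_lin p q.
Qed.

Lemma square_flat p q : flat 3 (square p q).
Proof.
have [sl [Dl l0]] := ell_lin p q.
have sl' : smooth_at (fun z : V => ell p q z.1) 0 by exact: smooth_fst.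
exact: (flatM (i := 1) (j := 2) (flat1 (smooth_snd 0) erefl) (flatX 2 (flat1 sl' l0))).
Qed.

Lemma square_d2form p q E F G z : d2form eu0 ev0 E F G (square p q) z =
  2 * qf E F G p q * z.2.
Proof.
have [sl [Dl _]] := ell_lin p q.
have sl' z' : smooth_at (fun z : V => ell p q z.1) z' by exact: smooth_fst.
have Dl' v z' : 'D_v (fun z : V => ell p q z.1) z' = ell p q v.1.
  by apply: (eq_trans (derive_fst (ell p q) v z')).
have ss := smooth_snd.
have D1 u : 'D_(u, 0) (square p q) = fun z : V => (2 * ell p q u) * (z.2 * ell p q z.1).
  apply/funext => z'; rewrite /square.
  have -> : (fun z : V => z.2 * ell p q z.1 ^+ 2) = fun z => (z.2 * ell p q z.1) * ell p q z.1.
    by apply/funext => y; rewrite expr2 mulrA.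
  rewrite DM ?DM ?Dl' ?derive_snd //=; last exact: smoothM.
  by move: (ell p q u) (ell p q z'.1) => a b; ring.
have D2 u v z' : 'D_(v, 0) ('D_(u, 0) (square p q)) z' = 2 * ell p q u * ell p q v * z'.2.
  rewrite D1 DMl; last exact: smoothM.
  by rewrite DM ?Dl' ?derive_snd //=; move: (ell p q u) (ell p q v) => a b; ring.
rewrite /d2form; rewrite /eu0 /ev0.
apply: (eq_trans (congr2 +%R (congr2 (fun s t : R => G * s - 2 * F * t) (D2 _ _ _) (D2 _ _ _))
  (congr1 ( *%R E) (D2 _ _ _)))).
by rewrite !ell_eu !ell_ev /qf; ring.
Qed.

End TimeDependence.

(** * Generic deformations of a Monge form *)

Section Deformations.
Context {R : realType}.
Local Notation R2 := 'rV[R]_2.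
Local Notation R3 := 'rV[R]_3.
Local Notation V := (R2 * R)%type.
Implicit Type (h : deformation R).

Lemma deformation_smooth h : smooth_at (fun_of_deformation h) 0.
Proof. by have [] := set_valP (h : @deformations R). Qed.

Lemma deformation_jet_cont : jet_cont (@fun_of_deformation R).
Proof.
split=> [h|vs]; first exact: deformation_smooth.
have c1 : continuous (fun h : deformation R => jet 0 (fun_of_deformation h)).
  exact: initial_continuous.
have c2 := @proj_continuous _ (fun _ : seq V => R : topologicalType) vs.
by move=> h; exact: (continuous_comp (c1 h) (c2 _)).
Qed.

Lemma deformation_line h (P : V -> R) : smooth_at P 0 ->
  (forall u, P (u, 0) = 0) ->
  exists2 c : R -> deformation R, continuous c &
    forall eps, fun_of_deformation (c eps) = fun z => fun_of_deformation h z + eps * P z.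
Proof.
move=> sP P0; have [sh h0] := set_valP (h : @deformations R).
have D eps : @deformations R (fun z => fun_of_deformation h z + eps * P z).
  split; first by apply: smoothD => //; apply: smoothM => //; exact: smooth_cst.
  by apply: filterS h0 => u E; rewrite P0 mulr0 addr0.
pose c eps : deformation R := SigSub (mem_set (D eps)).
exists c => //; apply: continuous_comp_initial.
have cE eps : fun_of_deformation (c eps) = bump (fun_of_deformation h) (fun z => eps * P z) (1 : R).
  by apply/funext => z; rewrite /bump; congr (_ + _); rewrite /GRing.scale /= mulr1.
have H := @jet_line_continuous R (deformation R) V R c (@fun_of_deformation R) _ P (1 : R)
  sh sP cE.
exact: H.
Qed.

Variables (i : 'I_3) (a : R2) (f : R2 -> R).
Hypothesis sf : smooth_at f 0.
Let e : R3 := delta_mx 0 i.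

Lemma smooth_graph_map : smooth_at (graph i a f) 0.
Proof.
apply: smooth_row => j.
have -> : (fun u : R2 => graph i a f u 0 j) =
    if unlift i j is Some k then fun u : R2 => a 0 k + u 0 k else f.
  by apply/funext => u; rewrite mxE; case: unlift => [k|] //; rewrite mxE.
case: unlift => [k|//]; apply: smoothD; first exact: smooth_cst.
exact/smooth_coord/smooth_at_id.
Qed.

Definition family h (p : V) : R3 := deform i a f h p.2 p.1.

(** In this form the perturbation lemmas for maps apply to families, the direction being the axis
    orthogonal to the coordinate plane. *)
Lemma familyE h : family h = bump (fun p : V => graph i a f p.1) (fun_of_deformation h) e.
Proof.
apply/funext => p; apply/rowP => j; rewrite !mxE /=.
case: unliftP => [k ->|->]; last by rewrite eqxx mulr1 -surjective_pairing.
by rewrite [lift _ _ == _]eq_sym (negbTE (neq_lift _ _)) mulr0 addr0 mxE.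
Qed.

Lemma smooth_family h : smooth_at (family h) 0.
Proof.
rewrite familyE; apply: smooth_bump (deformation_smooth h).
by apply: smooth_fst; exact: smooth_graph_map.
Qed.

Lemma family_jet_cont : jet_cont3 family.
Proof.
split=> [h|j]; first exact: smooth_family.
have s1 : smooth_at (fun p : V => graph i a f p.1 0 j) 0.
  by apply: smooth_coord; apply: smooth_fst; exact: smooth_graph_map.
have s2 : smooth_at (fun _ : V => e 0 j) 0 by exact: smooth_cst.
apply: jet_cont_eq (jet_contD (jet_cont_cst s1) (jet_contM deformation_jet_cont (jet_cont_cst s2))).
by move=> h; apply: filterE => z; rewrite familyE /bump !mxE.
Qed.

Lemma family_start h : \forall u \near (0 : R2), family h (u, 0) = graph i a f u.
Proof.
have [_ h0] := set_valP (h : @deformations R).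
apply: filterS h0 => u E; apply/rowP => j; rewrite !mxE.
by case: unlift => // ; rewrite [fun_of_deformation _ _]E addr0.
Qed.

(** The left side is the determinant of the two tangent vectors of a graph and of its vertical axis,
    which is 1 or -1 according to the axis. Deformations of Monge form therefore do act on
    [Hbar]. *)
Lemma family_transverse h : mink (mcross ('D_eu0 (family h) 0) ('D_ev0 (family h) 0)) e != 0.
Proof.
have H v (k : 'I_2) : 'D_(v, 0) (family h) 0 0 (lift i k) = v 0 k.
  apply: (eq_trans (Dcoord (lift i k) ((v, 0) : V) (smooth_family h))).
  have -> : (fun p : V => family h p 0 (lift i k)) = fun p : V => a 0 k + p.1 0 k.
    by apply/funext => p; rewrite mxE liftK mxE.
  have s1 : smooth_at (fun p : V => p.1 0 k) 0.
    by apply: (smooth_fst (g := fun u : R2 => u 0 k)); exact/smooth_coord/smooth_at_id.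
  apply: (eq_trans (DD ((v, 0) : V) (smooth_cst (a 0 k) 0) s1)).
  rewrite derive_cst add0r; apply: (eq_trans (derive_fst (fun u : R2 => u 0 k) ((v, 0) : V) 0)).
  by rewrite -(Dcoord k v (smooth_at_id 0)) derive_id.
move: (H eu 0) (H eu 1) (H ev 0) (H ev 1); rewrite !euvE /e.
move: ('D_(eu, 0) _ _) ('D_(ev, 0) _ _) => x y; rewrite /mink mcross0 mcross1 mcross2.
elim/ord3P: i.
- have -> : lift 0 0 = 1 :> 'I_3 by exact/val_inj.
  have -> : lift 0 1 = 2 :> 'I_3 by exact/val_inj.
  move=> x1 x2 y1 y2; rewrite !mxE /= x1 x2 y1 y2.
  by rewrite (_ : _ - _ = 1) ?oner_neq0 //; ring.
- have -> : lift 1 0 = 0 :> 'I_3 by exact/val_inj.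
  have -> : lift 1 1 = 2 :> 'I_3 by exact/val_inj.
  move=> x1 x2 y1 y2; rewrite !mxE /= x1 x2 y1 y2.
  by rewrite (_ : _ - _ = -1) ?oppr_eq0 ?oner_neq0 //; ring.
have -> : lift 2 0 = 0 :> 'I_3 by exact/val_inj.
have -> : lift 2 1 = 1 :> 'I_3 by exact/val_inj.
move=> x1 x2 y1 y2; rewrite !mxE /= x1 x2 y1 y2.
by rewrite (_ : _ - _ = 1) ?oner_neq0 //; ring.
Qed.

Hypotheses (Ag : tangent_at (graph i a f)) (ng : tangency (graph i a f) != 0).
Let lam := ratio (graph i a f).

(** Every deformation starts from the same graph, so [lam] does not depend on [h] and [speed] is
    continuous in the jet of [h]. *)
Let speed h : R := 'D_(0, 1) (hbar eu0 ev0 (family h)) 0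
  - lam * 'D_(0, 1) (disc eu0 ev0 (family h)) 0.

Let start_tangent h : tangent_at (fun u => family h (u, 0)).
Proof.
apply: (near_tangent_at smooth_graph_map _ Ag).
by apply: filterS (family_start h) => u ->.
Qed.

Let speed_continuous : continuous speed.
Proof.
have s1 : smooth_at (fun _ : V => lam) 0 by exact: smooth_cst.
have j1 := jet_cont_D ((0, 1) : V) (jet_cont_hbar eu0 ev0 family_jet_cont).
have j2 := jet_cont_D ((0, 1) : V) (jet_cont_disc eu0 ev0 family_jet_cont).
exact: (jet_cont_val (jet_contB j1 (jet_contM (jet_cont_cst s1) j2))).
Qed.

Let speed_splits h : speed h != 0 -> splits (deform i a f h).
Proof.
move=> s0; have [t0 r0] := near_tangency (family_start h).
have n0 : tangency (fun u => family h (u, 0)) != 0 by rewrite t0.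
have sf0 := smooth_family h.
apply: (transverse_splits (X := family h) sf0 (start_tangent h) n0).
by rewrite r0.
Qed.

Let speed_arith (H' H D' D x : R) : H' = H + x -> D' = D ->
  H' - lam * D' = H - lam * D + x.
Proof. by move=> -> ->; rewrite addrAC. Qed.

(** The linear form is taken with nonzero value of the quadratic form, so [square] shifts the
    [t]-derivative of [Hbar] and leaves that of [delta] unchanged. *)
Let speed_line h : exists2 P : V -> R, (forall u, P (u, 0) = 0) /\ smooth_at P 0 &
  exists2 k : R, k != 0 & forall eps h',
    fun_of_deformation h' = (fun z => fun_of_deformation h z + eps * P z) ->
    speed h' = speed h + eps * k.
Proof.
have sx : smooth_at (fun u => family h (u, 0)) 0.
  by apply: smooth_slice; exact: smooth_family.
have [p [q [_ [_ [_ Q0 _]]]]] := tangent_basis sx (start_tangent h).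
have eu_ := derive_slice (family h) 0 eu 0; have ev_ := derive_slice (family h) 0 ev 0.
have EE : formE eu (fun u => family h (u, 0)) 0 = formE eu0 (family h) 0 := congr2 mink eu_ eu_.
have EF : formF eu ev (fun u => family h (u, 0)) 0 = formF eu0 ev0 (family h) 0 := congr2 mink eu_ ev_.
have EG : formE ev (fun u => family h (u, 0)) 0 = formE ev0 (family h) 0 := congr2 mink ev_ ev_.
have Q1 : qf (formE eu0 (family h) 0) (formF eu0 ev0 (family h) 0) (formE ev0 (family h) 0) p q != 0.
  by move: Q0; rewrite EE EF EG.
exists (square p q).
  by split; [move=> u; rewrite /square mul0r|exact: smooth_square].
pose c := mink (mcross ('D_eu0 (family h) 0) ('D_ev0 (family h) 0)) e.
pose Q := qf (formE eu0 (family h) 0) (formF eu0 ev0 (family h) 0) (formE ev0 (family h) 0) p q.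
exists (c * (2 * Q)).
  have c0 : c != 0 := family_transverse h.
  by rewrite !mulf_neq0 // pnatr_eq0.
move=> eps h' Eh'.
have fE : family h' = bump (family h) (square p q) (eps *: e).
  rewrite familyE Eh' familyE; apply/funext => z.
  by rewrite /bump scalerDl addrA scalerA [square _ _ _ * _]mulrC.
have ch := bump_hbar eu0 ev0 (eps *: e) (smooth_family h) (square_flat p q).
have cd := bump_disc eu0 ev0 (eps *: e) (smooth_family h) (square_flat p q).
rewrite -fE in ch cd.
have Dd : 'D_(0, 1) (disc eu0 ev0 (family h')) 0 = 'D_(0, 1) (disc eu0 ev0 (family h)) 0.
  exact: cong_Dval cd.
have ss := smooth_square p q 0.
have Dh : 'D_(0, 1) (hbar eu0 ev0 (family h')) 0 =
    'D_(0, 1) (hbar eu0 ev0 (family h)) 0 + eps * (c * (2 * Q)).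
  apply: (eq_trans (cong_Dval ((0, 1) : V) ch)).
  have qE : (fun z : V => mink (mcross ('D_eu0 (family h) 0) ('D_ev0 (family h) 0)) (eps *: e) *
      d2form eu0 ev0 (formE eu0 (family h) 0) (formF eu0 ev0 (family h) 0)
        (formE ev0 (family h) 0) (square p q) z) = fun z => (eps * (c * (2 * Q))) * z.2.
    by apply/funext => z; rewrite square_d2form minkZr -/c -/Q !mulrA.
  have s2 : smooth_at (fun z : V => (eps * (c * (2 * Q))) * z.2) 0.
    by apply: smoothM; [exact: smooth_cst|exact: smooth_snd].
  have sh := smooth_hbar eu0 ev0 (smooth_family h).
  apply: (eq_trans (congr1 (fun g : V -> R => 'D_((0, 1) : V) (fun z =>
    hbar eu0 ev0 (family h) z + g z) 0) qE)).
  apply: (eq_trans (DD ((0, 1) : V) sh s2)); congr (_ + _).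
  apply: (eq_trans (DMl _ ((0, 1) : V) (smooth_snd 0))).
  by rewrite derive_snd mulr1.
exact: (speed_arith Dh Dd).
Qed.

Lemma generic_deformation : exists O : set (deformation R), [/\ open O, dense O &
  forall h, O h -> splits (deform i a f h)].
Proof.
exists [set h | speed h != 0]; split; last exact: speed_splits.
  rewrite (_ : [set h | _] = ~` [set h | speed h = 0]).
    exact/closed_openC/closed_zero.
  by apply/seteqP; split=> h /=; [move/eqP|move=> ?; apply/eqP].
move=> U [h Uh] oU.
have [P [P0 sP] [k k0 Hk]] := speed_line h.
have [c cc cE] := deformation_line h sP P0.
have c0 : c 0 = h.
  apply: (val_inj : injective (@fun_of_deformation R)).
  by rewrite cE; apply/funext => z; rewrite mul0r addr0.
have nU : \forall eps \near (0 : R), U (c eps).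
  by apply: cc; rewrite c0; apply: open_nbhs_nbhs.
have /nbhs_norm0P[r /= r0 Hr] : \forall eps \near (0 : R),
    U (c eps) /\ (eps != 0 -> speed h + eps * k != 0).
  exact: filterI nU (small_shift (speed h) k0).
have rr : `|r / 2| < r.
  by rewrite gtr0_norm ?divr_gt0 // ltr_pdivrMr // mulr_natr mulr2n ltrDl.
have [Uc Sc] := Hr (r / 2) rr.
exists (c (r / 2)); split; [exact: Uc|rewrite /= (Hk _ _ (cE _))].
by apply: Sc; rewrite gt_eqF // divr_gt0.
Qed.

End Deformations.

(** * Genericity *)

Section Genericity.
Context {R : realType}.
Local Notation R2 := 'rV[R]_2.
Local Notation R3 := 'rV[R]_3.
Local Notation germ := (surface_germ R).
Local Open Scope quotient_scope.
Implicit Types (x y : R2 -> R3) (p q : param R) (M : germ).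

Lemma germP p q : \pi_germ p = \pi_germ q <-> reparam (fun_of_param p) (fun_of_param q).
Proof. exact: pi_eqP. Qed.

Lemma germ_rep M : exists p, \pi_germ p = M.
Proof. by exists (repr M); rewrite reprK. Qed.

Lemma G6P p : @G6 R (\pi_germ p) <-> tangent_at (fun_of_param p).
Proof.
split=> [H|Ap q /germP qp]; first exact: (tangent_atP (param_smooth p)).1 (H p erefl).
apply: (tangent_atP (param_smooth q)).2.
exact: reparam_tangent_at (param_smooth p) (param_smooth q) (reparam_sym qp) Ap.
Qed.

Lemma nondegenerateP x : smooth_at x 0 -> tangent_at x ->
  ~ degenerate x <-> ratio x != 0 /\ tangency x != 0.
Proof.
move=> sx Ax; have [d0 _ h0 p0 _] := Ax.
have rP := ratio_neq0 sx Ax; have rH := regularP (smooth_diff (smooth_Hbar sx)).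
split=> [nd|[r0 t0] [_ _ _ [dH|t0']]].
- split; first by apply/rP/rH => dH; apply: nd; exact: And4 d0 h0 p0 (or_introl dH).
  by apply/eqP => t0; apply: nd; exact: And4 d0 h0 p0 (or_intror t0).
- exact: (rH.1 (rP.2 r0)) dH.
by move: t0; rewrite t0' eqxx.
Qed.

Definition configuration x := [/\ contact_eq (delta x) (tdelta x) 0 4,
  contact_eq (delta x) (Hbar x) 0 2 & opposite_sides x \/ same_side x].

(** An equivalence is wanted because genericity asks the set of good germs to be exactly the trace
    on [G6] of an open set. The converse reads the ratio off the regularity of the MCNC and the
    tangency off the contact order 2. *)
Lemma configurationP x : smooth_at x 0 -> tangent_at x ->
  configuration x <-> ~ degenerate x.
Proof.
move=> sx Ax; have [d0 rd h0 p0 K0] := Ax.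
have sd := smooth_delta sx; have sh := smooth_Hbar sx; have sK := smooth_gaussc sx.
apply: (iff_trans _ (iff_sym (nondegenerateP sx Ax))); split=> [[_ c2 c]|[r0 t0]].
  have rH : regular_at (Hbar x) 0 by case: c => -[].
  split; first exact: (ratio_neq0 sx Ax).1 rH.
  exact: (contact_eq_pb sd sh h0 c2).2.
have [c4 c2] := pb_contact_eq sd sh (tdeltaE x) rd d0 h0 p0 t0.
split; [exact: c4|exact: c2|].
have : tangency x * ratio x * gaussc x 0 != 0 by exact: mulf_neq0 (mulf_neq0 t0 r0) K0.
rewrite neq_lt => /orP[/(opposite_sidesP sx Ax t0)|/(same_sideP sx Ax t0)] H; [left|right]; exact: H.
Qed.

Definition nondegenerate : set germ :=
  on_germ (fun x => ~ degenerate x).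

Lemma nondegenerate_germ p : nondegenerate (\pi_germ p) <-> ~ degenerate (fun_of_param p).
Proof.
split=> [H|nd q /germP qp dq]; first exact: H p erefl.
exact: nd (reparam_degenerate (param_smooth q) (param_smooth p) qp dq).
Qed.

Lemma open_nondegenerate : open nondegenerate.
Proof.
(* A set is open in the quotient when its preimage is, and by invariance the preimage is the
   complement of the degenerate parametrizations. *)
have -> : open nondegenerate = open (~` [set p : param R | degenerate (fun_of_param p)]).
  apply: (congr1 (@open (param R))); apply/seteqP.
  by split=> p /nondegenerate_germ.
exact/closed_openC/closed_degenerate.
Qed.

Let D := @G6 R `&` nondegenerate.

Lemma nondegenerate_of_ratio p : tangent_at (fun_of_param p) ->
  ratio (fun_of_param p) != 0 -> closure D (\pi_germ p).
Proof.
move=> Ap r0; have [P [e [fP [k k0 H]]]] := tangency_bump (param_smooth p) Ap.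
apply: (closure_line (e := e) (flatW (isT : (2 <= 4)%N) fP)).
apply: filterS (small_shift (tangency (fun_of_param p)) k0) => eps Heps eps0 y yE.
have [Ay ry _ ty] := H eps; rewrite -yE in Ay ry ty.
split; first exact/G6P.
apply/nondegenerate_germ; apply: (nondegenerateP (param_smooth y) Ay).2.
exact: conj (eq_ind_r (fun s : R => s != 0) r0 ry)
  (eq_ind_r (fun s : R => s != 0) (Heps eps0) ty).
Qed.

(** Two perturbations in succession: a cubic makes the ratio nonzero without control of the
    tangency, then a fourth power makes the tangency nonzero and keeps the ratio. The closure being
    closed, the two approximations compose. *)
Lemma G6_closure : @G6 R `<=` closure D.
Proof.
move=> M; have [p <-] := germ_rep M => /G6P Ap.
have [P [e [fP [k k0 H]]]] := ratio_bump (param_smooth p) Ap.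
rewrite ((closure_id (closure D)).1 (@closed_closure _ D)).
apply: (closure_line (e := e) (flatW (isT : (2 <= 3)%N) fP)).
apply: filterS (small_shift (ratio (fun_of_param p)) k0) => eps Heps eps0 y yE.
have [Ay ry] := H eps; rewrite -yE in Ay ry.
exact: nondegenerate_of_ratio Ay (eq_ind_r (fun s : R => s != 0) (Heps eps0) ry).
Qed.

(** Both perturbations are affine in their parameter, so ratio and tangency can be prescribed. These
    values make the product deciding the configuration [s] times a nonzero square. *)
Lemma configuration_exists (s : R) : exists2 p : param R, tangent_at (fun_of_param p) &
  ratio (fun_of_param p) = 1 /\
  tangency (fun_of_param p) = s * gaussc (fun_of_param p) 0.
Proof.
pose p0 : param R := SigSub (mem_set (@cubic_graph_param R)).
have A0 : tangent_at (fun_of_param p0) := @cubic_graph_tangent R.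
have [P [e [fP [k k0 H]]]] := ratio_bump (param_smooth p0) A0.
have [c _ cE] := param_line p0 e (flatW (isT : (2 <= 3)%N) fP).
pose p1 := c ((1 - ratio (fun_of_param p0)) / k).
have [A1 r1] := H ((1 - ratio (fun_of_param p0)) / k).
rewrite -cE -/p1 (divfK k0) subrKC in A1 r1.
have [P' [e' [fP' [k' k'0 H']]]] := tangency_bump (param_smooth p1) A1.
have [c' _ cE'] := param_line p1 e' (flatW (isT : (2 <= 4)%N) fP').
pose eps := (s * gaussc (fun_of_param p1) 0 - tangency (fun_of_param p1)) / k'.
have [A2 r2 g2 t2] := H' eps.
rewrite -cE' in A2 r2 g2 t2; exists (c' eps); first exact: A2.
have E : tangency (fun_of_param p1) + eps * k' = s * gaussc (fun_of_param p1) 0.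
  by rewrite (divfK k'0) subrKC.
split; first exact: eq_trans r2 r1.
exact: eq_trans t2 (eq_trans E (congr1 ( *%R s) (esym g2))).
Qed.

Lemma germ_sign p q : \pi_germ q = \pi_germ p -> tangent_at (fun_of_param p) ->
  tangent_at (fun_of_param q) /\ exists2 k : R, 0 < k &
    tangency (fun_of_param q) * ratio (fun_of_param q) * gaussc (fun_of_param q) 0 =
    k * (tangency (fun_of_param p) * ratio (fun_of_param p) * gaussc (fun_of_param p) 0).
Proof.
move=> /germP qp Ap; have sp := param_smooth p; have sq := param_smooth q.
have Aq := reparam_tangent_at sp sq (reparam_sym qp) Ap.
by split; [exact: Aq|exact: reparam_sign sq sp qp Aq Ap].
Qed.

Lemma configuration_sign p : tangent_at (fun_of_param p) ->
  tangency (fun_of_param p) * ratio (fun_of_param p) * gaussc (fun_of_param p) 0 != 0 ->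
  contact_eq (delta (fun_of_param p)) (tdelta (fun_of_param p)) 0 4 /\
  contact_eq (delta (fun_of_param p)) (Hbar (fun_of_param p)) 0 2.
Proof.
have H (a b c : R) : a * b * c != 0 -> a != 0 /\ b != 0.
  by rewrite !mulf_eq0 !negb_or => /andP[/andP[]].
move=> Ap /H[t0 r0].
have sp := param_smooth p.
have [c4 c2 _] := (configurationP sp Ap).2 ((nondegenerateP sp Ap).2 (conj r0 t0)).
exact: conj c4 c2.
Qed.

Lemma nondegenerate_deformation M i a f : (@G6 R `&` nondegenerate) M -> monge M i a f ->
  exists O : set (deformation R), [/\ open O, dense O &
    forall h, O h -> splits (deform i a f h)].
Proof.
move=> GM [sf [p pM E]]; rewrite -{}pM in GM; have [/G6P Ap /nondegenerate_germ nd] := GM.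
have sp := param_smooth p; have [_ t0] := (nondegenerateP sp Ap).1 nd.
have Ag := near_tangent_at sp E Ap; have [tE _] := near_tangency E.
by apply: (generic_deformation sf Ag); rewrite -tE.
Qed.

End Genericity.

Theorem theorem5p2 (R : realType) :
  generic_in (@G6 R)
    [set M : surface_germ R |
      on_germ (fun x => [/\ contact_eq (delta x) (tdelta x) 0 4,
                            contact_eq (delta x) (Hbar x) 0 2 &
                            opposite_sides x \/ same_side x]) M /\
      (forall i a f, monge M i a f ->
        exists O : set (deformation R), [/\ open O, dense O &
          forall h, O h -> splits (deform i a f h)])] /\
  (exists M : surface_germ R, G6 M /\
    on_germ (fun x => [/\ contact_eq (delta x) (tdelta x) 0 4,
                          contact_eq (delta x) (Hbar x) 0 2 &
                          opposite_sides x]) M) /\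
  (exists M : surface_germ R, G6 M /\
    on_germ (fun x => [/\ contact_eq (delta x) (tdelta x) 0 4,
                          contact_eq (delta x) (Hbar x) 0 2 &
                          same_side x]) M).
Proof.
pose P := [set M : surface_germ R | on_germ configuration M /\
  (forall i a f, monge M i a f ->
    exists O : set (deformation R), [/\ open O, dense O &
      forall h, O h -> splits (deform i a f h)])].
have PE : @G6 R `&` P = @G6 R `&` nondegenerate (R := R).
  apply/seteqP; split=> M [GM].
    have [p pM] := germ_rep M; rewrite -pM in GM *; move=> [C _]; split; first exact: GM.
    apply/nondegenerate_germ; have Ap := (G6P p).1 GM.
    exact: (configurationP (param_smooth p) Ap).1 (C p erefl).
  move=> nM; split; [exact: GM|split].
    move=> q qM; rewrite -qM in GM nM.
    exact: (configurationP (param_smooth q) ((G6P q).1 GM)).2 ((nondegenerate_germ q).1 nM).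
  by move=> i a f; apply: nondegenerate_deformation.
have gen : generic_in (@G6 R) P.
  split; last by rewrite PE; exact: G6_closure.
  by exists (nondegenerate (R := R)); [exact: open_nondegenerate|exact: PE].
(* The deciding sign is the same for all representatives of a germ, so one parametrization for each
   sign suffices: -1 for opposite sides, 1 for the same side. *)
have config (s : R) (C : ('rV[R]_2 -> 'rV[R]_3) -> Prop) : s != 0 ->
    (forall x, smooth_at x 0 -> tangent_at x -> tangency x != 0 ->
      0 < s * (tangency x * ratio x * gaussc x 0) -> C x) ->
    exists M : surface_germ R, G6 M /\ on_germ (fun x =>
      [/\ contact_eq (delta x) (tdelta x) 0 4, contact_eq (delta x) (Hbar x) 0 2 & C x]) M.
  move=> s0 HC; have [p Ap [r1 t1]] := configuration_exists s.
  exists (\pi_(surface_germ R)%qT p); split; first exact/G6P.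
  move=> q qp; have [Aq [k k0 E]] := germ_sign qp Ap.
  have [_ _ _ _ K0] := Ap.
  have pos : 0 < s * (tangency (fun_of_param q) * ratio (fun_of_param q) *
      gaussc (fun_of_param q) 0).
    rewrite E r1 t1; have -> (c : R) : s * (k * (s * c * 1 * c)) = k * (s * c) ^+ 2 by ring.
    by rewrite mulr_gt0 // exprn_even_gt0 //= mulf_neq0.
  have n0 : tangency (fun_of_param q) != 0.
    by apply: contraTneq pos => ->; rewrite !(mul0r, mulr0) ltxx.
  have [|c4 c2] := configuration_sign Aq.
    by apply: contraTneq pos => ->; rewrite mulr0 ltxx.
  by split; [exact: c4|exact: c2|exact: HC (param_smooth q) Aq n0 pos].
split; first exact: gen.
split.
  apply: (config (-1)) => [|x sx Ax n0]; first by rewrite oppr_eq0 oner_neq0.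
  by rewrite mulN1r oppr_gt0; exact: opposite_sidesP sx Ax n0.
apply: (config 1) => [|x sx Ax n0]; first exact: oner_neq0.
by rewrite mul1r; exact: same_sideP sx Ax n0.
Qed.
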